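(* Fix $q>0$ and fix $\epsilon\in(0,1)$ such that $\epsilon<2\epsilon^*(\delta/2)$. Let $\{\Pi_m\}_{m\ge1}$ be any sequence of random variables that is $\epsilon$-sparse and growing. Then for any fixed $0<\lambda_1<\lambda_2$ and any $\nu>0$ there exist $m'$ and $n'(m)$ such that $$\mathbb{P}\Big(\inf_{\lambda_1\le\lambda\le\lambda_2}\mathrm{TPP}(\lambda,\Pi_m,q)>1-\nu\Big)\ge 1-\nu$$ whenever $m\ge m'$ and $n\ge n'(m)$. Here $\mathrm{TPP}(\lambda,\Pi,q)$ denotes the true positive proportion of the level-$q$ LCD-knockoffs procedure with parameter $\lambda$ when the coefficients have distribution $\Pi$.
   Context: Model. $Y=\mathbf{X}\beta+\xi$, where $\mathbf{X}\in\mathbb{R}^{n\times p}$ has i.i.d. $\mathcal{N}(0,1/n)$ entries, $\xi\sim\mathcal{N}_n(0,\sigma^2 I)$ with $\sigma^2$ fixed, and $\beta=(\beta_1,\dots,\beta_p)^\top$ has i.i.d. components distributed as a random variable $\Pi$ with $\mathbb{E}\Pi^2<\infty$ (here $\Pi=\Pi_m$). $\mathbf{X},\beta,\xi$ are independent. The dimension $p$ grows with $n$ so that $n/p\to\delta>0$. LCD-knockoffs procedure. $\widetilde{\mathbf{X}}\in\mathbb{R}^{n\times p}$ has i.i.d. $\mathcal{N}(0,1/n)$ entries and is independent of $(\mathbf{X},\beta,\xi)$. Let $$\widehat\beta(\lambda)=\operatorname*{argmin}_{b\in\mathbb{R}^{2p}}\ \tfrac12\|Y-[\mathbf{X},\widetilde{\mathbf{X}}]b\|_2^2+\lambda\|b\|_1,\qquad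 W_j=|\widehat\beta_j(\lambda)|-|\widehat\beta_{p+j}(\lambda)|,\quad j=1,\dots,p.$$ The level-$q$ LCD-knockoffs procedure with parameter $\lambda$ selects $\widehat{\mathcal{S}}=\{j:W_j\ge\hat t\}$, where $$\hat t=\min\Big\{t>0:\ \frac{1+\#\{j:W_j\le -t\}}{\#\{j:W_j\ge t\}}\le q\Big\},$$ the minimum being taken over $t\in\{|W_j|:1\le j\le p\}\setminus\{0\}$ (and $\hat t=\infty$, i.e. nothing is selected, if no such $t$ exists; a ratio with zero denominator is $+\infty$). Its true positive proportion is $|\{j\in\widehat{\mathcal{S}}:\beta_j\ne0\}|/|\{j:\beta_j\ne0\}|$, with $0/0=0$. $\epsilon$-sparse and growing. A sequence $\{\Pi_m\}$ of random variables is $\epsilon$-sparse and growing if $\mathbb{P}(\Pi_m\ne0)=\epsilon$ for all $m$ and, for every $M>0$, $\mathbb{P}(|\Pi_m|>M\mid\Pi_m\ne0)\to1$ as $m\to\infty$. Donoho--Tanner curve. $\epsilon^*(\delta)$ denotes the point on the Donoho--Tanner phase transition curve at undersampling ratio $\delta$. For $0<\delta<1$ the curve is given parametrically, for $s>0$, by $$\delta=\frac{2\phi(s)}{s+2(\phi(s)-s\Phi(-s))},\qquad \epsilon^*(\delta)=\frac{2(\phi(s)-s\Phi(-s))}{s+2(\phi(s)-s\Phi(-s))},$$ where $\phi,\Phi$ are the standard normal density and distribution function; for $\delta\ge1$, $\epsilon^*(\delta)=1$ (no constraint). *)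

(* Defs.v *)
(* MathComp-Analysis *)
From HB Require Import structures.
From mathcomp Require Export all_boot all_order all_algebra.
From mathcomp Require Export all_classical all_reals all_analysis.
Set Implicit Arguments.
Unset Strict Implicit.
Unset Printing Implicit Defensive.
Import Order.TTheory GRing.Theory Num.Theory.
Import numFieldNormedType.Exports.
Local Open Scope classical_set_scope.
Local Open Scope ring_scope.

(** * Probability *)

Section Probability.
Context {R : realType} {d : measure_display} {T : measurableType d}.
Variable P : probability T R.

(* Mutual independence: the product rule over every subfamily. *)
Definition mutually_independent (I : finType) (X : I -> {RV P >-> R}) : Prop :=
  forall (J : {set I}) (A : I -> set R), (forall i, measurable (A i)) ->
    P [set w | forall i, i \in J -> A i (X i w)] =
    (\prod_(i in J) P (X i @^-1` A i))%E.

Definition has_law (X : {RV P >-> R}) (mu : set R -> \bar R) : Prop :=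
  forall A : set R, measurable A -> distribution P X A = mu A.

Definition cond_prob (A B : set T) : R := fine (P (A `&` B)) / fine (P B).

(* "P(A) >= c" for an event A that need not be measurable, as an inner
   measure; see [prob_atleast_measurable]. The event used below is an infimum
   over uncountably many lambda of a functional of a minimiser that is only
   almost surely unique, so its measurability is not immediate, whereas the
   library leaves the value of a measure outside measurable sets arbitrary. *)
Definition prob_atleast (A : set T) (c : R) : Prop :=
  exists E : set T, [/\ measurable E, E `<=` A & (c%:E <= P E)%E].

Lemma prob_atleast_measurable (A : set T) (c : R) :
  measurable A -> prob_atleast A c <-> (c%:E <= P A)%E.
Proof.
move=> mA; split => [[E [mE EA cE]]|cA]; last by exists A; split.
by apply: (le_trans cE); apply: le_measure => //; rewrite inE.
Qed.

End Probability.

Section NormalLaw.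
Context {R : realType}.

(* N(m, s^2), degenerate when s = 0; [normal_prob m 0] is the uniform law on
   [0, 1] by the library's convention. *)
Definition gauss_law (m s : R) : set R -> \bar R :=
  if s == 0 then dirac m else normal_prob m s.

Definition std_pdf (x : R) : R := normal_pdf 0 1 x.

Definition std_cdf (x : R) : R := fine (normal_prob 0 1 `]-oo, x]).

End NormalLaw.

(** * The Donoho-Tanner curve *)

Section DonohoTanner.
Context {R : realType}.

Definition dt_num (s : R) : R := 2 * (std_pdf s - s * std_cdf (- s)).
Definition dt_delta (s : R) : R := 2 * std_pdf s / (s + dt_num s).
Definition dt_eps (s : R) : R := dt_num s / (s + dt_num s).

(* [dt_delta] is a decreasing bijection from the positive reals onto ]0, 1[,
   so at most one value is available to [xget]. *)
Definition eps_star (delta : R) : R :=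
  if 1 <= delta then 1
  else xget 0 [set e | exists s, [/\ 0 < s, dt_delta s = delta & dt_eps s = e]].

End DonohoTanner.

(** * The LCD-knockoffs procedure *)

Section Knockoffs.
Context {R : realType}.

Definition lasso_obj (n k : nat) (A : 'M[R]_(n, k)) (y : 'cV[R]_n)
    (lambda : R) (b : 'cV[R]_k) : R :=
  2^-1 * (\sum_i (y - A *m b) i 0 ^+ 2) + lambda * (\sum_j `|b j 0|).

(* For [0 < lambda] a minimiser always exists; it is unique almost surely for
   a design with i.i.d. Gaussian entries. *)
Definition lasso (n k : nat) (A : 'M[R]_(n, k)) (y : 'cV[R]_n) (lambda : R) :
    'cV[R]_k :=
  xget 0 [set b | forall b', lasso_obj A y lambda b <= lasso_obj A y lambda b'].

Section Dimensions.
Variables n p : nat.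

Definition lcd_stat (X Xt : 'M[R]_(n, p)) (y : 'cV[R]_n) (lambda : R)
    (j : 'I_p) : R :=
  let b := lasso (row_mx X Xt) y lambda in
  `|b (lshift p j) 0| - `|b (rshift p j) 0|.

Definition count_ge (W : 'I_p -> R) (t : R) : nat :=
  #|[set j | (t <= W j)%R]%SET|.
Definition count_le (W : 'I_p -> R) (t : R) : nat :=
  #|[set j | (W j <= t)%R]%SET|.

(* The positivity conjunct encodes that a ratio with zero denominator is +oo. *)
Definition threshold_ok (W : 'I_p -> R) (q t : R) : bool :=
  (0 < count_ge W t)%N && ((1 + count_le W (- t))%:R / (count_ge W t)%:R <= q).

Definition threshold (W : 'I_p -> R) (q : R) : \bar R :=
  \big[Order.min/+oo%E]_(j < p | (0 < `|W j|) && threshold_ok W q `|W j|)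
    (`|W j|)%:E.

Definition selected (W : 'I_p -> R) (q : R) : {set 'I_p} :=
  [set j | (threshold W q <= (W j)%:E)%E]%SET.

(* [x / 0 = 0] gives the convention 0/0 = 0. *)
Definition TPP_of (S : {set 'I_p}) (beta : 'cV[R]_p) : R :=
  #|[set j in S | beta j 0 != 0]%SET|%:R / #|[set j | beta j 0 != 0]%SET|%:R.

Definition TPP (X Xt : 'M[R]_(n, p)) (beta : 'cV[R]_p) (xi : 'cV[R]_n)
    (q lambda : R) : R :=
  TPP_of (selected (lcd_stat X Xt (X *m beta + xi) lambda) q) beta.

End Dimensions.
End Knockoffs.

(** * The random model *)

Section Model.
Context {R : realType} {d : measure_display} {T : measurableType d}.
Variable P : probability T R.
Variables n p : nat.

Definition random_matrix (X : 'I_n -> 'I_p -> {RV P >-> R}) (w : T) :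
  'M[R]_(n, p) := \matrix_(i, j) X i j w.

Definition all_entries (X Xt : 'I_n -> 'I_p -> {RV P >-> R})
    (beta : 'I_p -> {RV P >-> R}) (xi : 'I_n -> {RV P >-> R})
    (i : ('I_n * 'I_p) + ('I_n * 'I_p) + 'I_p + 'I_n) : {RV P >-> R} :=
  match i with
  | inl (inl (inl ij)) => X ij.1 ij.2
  | inl (inl (inr ij)) => Xt ij.1 ij.2
  | inl (inr j) => beta j
  | inr k => xi k
  end.

(* Independence of X, Xt, beta and xi, together with independence of the
   entries within each of them, is mutual independence of all the entries. *)
Definition knockoff_model (X Xt : 'I_n -> 'I_p -> {RV P >-> R})
    (beta : 'I_p -> {RV P >-> R}) (xi : 'I_n -> {RV P >-> R})
    (sigma : R) (law : set R -> \bar R) : Prop :=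
  [/\ mutually_independent (all_entries X Xt beta xi),
      forall i j, has_law (X i j) (gauss_law 0 (Num.sqrt n%:R^-1)),
      forall i j, has_law (Xt i j) (gauss_law 0 (Num.sqrt n%:R^-1)),
      forall j, has_law (beta j) law &
      forall i, has_law (xi i) (gauss_law 0 sigma)].

End Model.

Definition random_vector {R : realType} {d : measure_display}
    {T : measurableType d} (P : probability T R) (k : nat)
    (v : 'I_k -> {RV P >-> R}) (w : T) : 'cV[R]_k := \col_i v i w.

Definition sparse_and_growing {R : realType} {d : measure_display}
    {T : measurableType d} (Q : probability T R) (eps : R)
    (Pi : nat -> {RV Q >-> R}) : Prop :=
  (forall m, Q [set w | Pi m w != 0] = eps%:E) /\
  (forall M : R, 0 < M ->
    cond_prob Q [set w | M < `|Pi m w|] [set w | Pi m w != 0]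
      @[m --> \oo] --> (1 : R)).

(* Main.v *)
Require Import Defs.
From mathcomp Require Import measurable_realfun ring lra.
Set Implicit Arguments.
Unset Strict Implicit.
Unset Printing Implicit Defensive.
Import Order.TTheory GRing.Theory Num.Theory.
Import numFieldNormedType.Exports.
Local Open Scope classical_set_scope.
Local Open Scope ring_scope.

(** Why the theorem holds. Write [A] for the augmented design, [b0] for the
    coefficients padded by zeros on the knockoffs, [N = 2 p], and [h] for the
    error of the lasso. Only two facts about the lasso matter: the basic
    inequality, and the fact that the design does not shrink the directions
    along which the l1 norm decreases or barely increases.

    _Design._ Below the phase transition there is a threshold [t] for which the
    mean square of [excess t], averaged over the coordinates of [b0], is less
    than [n / N] (below_phase_transition). Gordon's inequality then bounds
    [|A h|] from below by a multiple of [|h|], uniformly over the directions [h]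
    whose drift, the derivative of the l1 norm at [b0], is at most a small
    multiple of [sqrt N |h|] (restricted_singular_value, design_bound). The
    signs of [b0] are random, but they are independent of the design, so one may
    condition on each sign pattern separately.

    _Gordon's inequality._ For [u] in a finite net of the cone, the process
    [sqrt (1 + |G u|^2) + gamma] is compared with
    [sqrt (1 + |g|^2) + <h, u>]. Expectations of a product over [u] of logistic
    functions of the two processes are compared by replacing every Gaussian
    coordinate by [k] random signs of size [1 / sqrt k], moving all blocks of
    signs of one family to those of the other and letting [k] grow
    (gauss_comparison). Each exchange of a block changes the expectation by the
    trace of the Hessian over one family minus the trace over the other. For
    different vectors [u] and [v] this gap is a product of two nonnegative
    factors, and it vanishes on the Hessians of the process itself
    (gordon_gap_grad, gordon_gap_hess).

    _Error of the lasso._ The basic inequality bounds the drift of [h] by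
    [|xi|^2 / (2 lambda)], which is of order [N]. Either [|h|^2] is already
    [O(N)], or the drift is a small multiple of [sqrt N |h|], the design is
    bounded below on [h], and the quadratic term forces [|h|^2 = O(N)]
    (lasso_error). The constant depends on the range of the penalty and on the
    law of the coefficients only through [eps]: it is uniform in [lambda] and in
    [m].

    _Selection._ Hence for a large constant [T] all but a small fraction of the
    coordinates of [h] are below [T], while for large [m] almost all signals
    exceed [3 T]. Almost every signal has a statistic above [T] and very few
    statistics lie below [-T], so the data-driven threshold drops below the
    statistics of almost all signals (selected_above, TPP_lower). *)

(** * The standard normal law on the line *)

Definition mkRV {d} {T : measurableType d} {R : realType} (P : probability T R)
  (f : T -> R) (mf : measurable_fun setT f) : {RV P >-> R} := mfun_Sub (mem_set mf).

Section GaussDensity.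
Context {R : realType}.
Local Notation mu := (@lebesgue_measure R).

Lemma ge0_integral_normal_prob (s : R) (f : R -> \bar R) :
    measurable_fun setT f -> (forall x, 0 <= f x)%E ->
  (\int[normal_prob 0 s]_x f x = \int[mu]_x (f x * (normal_pdf 0 s x)%:E))%E.
Proof.
move=> mf f0.
have dom := @normal_prob_dominates R 0 s.
rewrite -(Radon_Nikodym_SigmaFinite.change_of_variables (mu := mu) dom)//=.
apply: ae_eq_integral => //=.
- apply: emeasurable_funM => //.
  by apply: (measurable_int mu); exact: Radon_Nikodym_SigmaFinite.f_integrable.
- apply: emeasurable_funM => //.
  by apply/measurable_EFinP; exact: measurable_normal_pdf.
- apply: ae_eqe_mul2l => /=.
  apply: integral_ae_eq => //=.
  + exact: Radon_Nikodym_SigmaFinite.f_integrable.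
  + by apply/measurable_EFinP; exact: measurable_normal_pdf.
  + by move=> E _ mE; rewrite -Radon_Nikodym_SigmaFinite.f_integral.
Qed.

Lemma lebesgue_measure_affine (a b : R) (A : set (measurableTypeR R)) :
    0 < a -> measurable A ->
  (a%:E * mu ((fun x => a * x + b)%R @^-1` A) = mu A)%E.
Proof.
move=> a0 mA.
pose h : measurableTypeR R -> measurableTypeR R := (fun x => a * x + b)%R.
have mh : measurable_fun setT h.
  by apply: measurable_funD => //; apply: measurable_funM.
pose m : {measure set (measurableTypeR R) -> \bar R} :=
  mscale (NngNum (ltW a0)) (pushforward mu h).
rewrite [RHS](@lebesgue_measure_unique R (m mh)) //= => _ [[x y] _ <-].
rewrite /m /= /mscale /= /pushforward /=.
rewrite (_ : h @^-1` _ = `](x - b) / a, (y - b) / a]%classic); last first.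
  apply/seteqP; split => z /=; rewrite !in_itv /= /h.
  - by rewrite ltr_pdivrMr// ler_pdivlMr// ltrBlDr lerBrDr ![z * a]mulrC.
  - by rewrite ltr_pdivrMr// ler_pdivlMr// ltrBlDr lerBrDr ![z * a]mulrC.
rewrite !lebesgue_measure_itv/= !lte_fin ltr_pM2r ?invr_gt0// ltrD2r.
case: ifP => _; last by rewrite mule0.
by rewrite -!EFinB -EFinM; congr (_%:E); field; rewrite gt_eqF.
Qed.

Lemma ge0_integral_affine (a b : R) (f : R -> R) : 0 < a ->
    measurable_fun setT f -> (forall x, 0 <= f x) ->
  (\int[mu]_x (f (a * x + b) * a)%:E = \int[mu]_x (f x)%:E)%E.
Proof.
move=> a0 mf f0.
pose h : measurableTypeR R -> measurableTypeR R := (fun x => a * x + b)%R.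
have mh : measurable_fun setT h.
  by apply: measurable_funD => //; apply: measurable_funM.
pose m : {measure set (measurableTypeR R) -> \bar R} := pushforward mu h.
have mEf : measurable_fun (setT : set (measurableTypeR R)) (fun x => (f x)%:E).
  by apply/measurable_EFinP; exact: mf.
transitivity (\int[mscale (NngNum (ltW a0)) (m mh)]_x (f x)%:E)%E.
  rewrite ge0_integral_mscale//=; last by move=> x _; rewrite lee_fin.
  rewrite ge0_integral_pushforward//=; last by move=> *; rewrite lee_fin.
  rewrite preimage_setT -ge0_integralZl//=.
  - by apply: eq_integral => x _; rewrite -EFinM mulrC.
  - exact: (measurableT_comp mEf mh).
  - by move=> x _; rewrite lee_fin.
  - by rewrite lee_fin ltW.
apply: eq_measure_integral => A mA _.
exact: lebesgue_measure_affine.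
Qed.

Local Notation gam := (normal_prob (0:R) 1).

Definition phi (x : R) : R := normal_pdf 0 1 x.

Lemma phiE x : phi x = (Num.sqrt (pi *+ 2))^-1 * expR (- (x ^+ 2 / 2)).
Proof.
rewrite /phi normal_pdfE ?oner_eq0// /normal_peak /normal_fun.
by rewrite expr1n mul1r subr0 mulNr.
Qed.

Lemma phiN x : phi (- x) = phi x.
Proof. by rewrite !phiE sqrrN. Qed.

Lemma phi_gt0 x : 0 < phi x.
Proof. by rewrite phiE mulr_gt0 ?expR_gt0// invr_gt0 sqrtr_gt0 pmulrn_lgt0// pi_gt0. Qed.

Lemma measurable_phi : measurable_fun setT phi.
Proof. exact: measurable_normal_pdf. Qed.

(** Completing the square: the joint density factors along the rotated axes. *)
Lemma phi_rotate (a b x s : R) : b != 0 -> a ^+ 2 + b ^+ 2 = 1 ->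
  phi x * phi ((s - a * x) / b) = phi s * phi ((x - a * s) / b).
Proof.
move=> b0 ab.
rewrite !phiE mulrACA -expRD [RHS]mulrACA -expRD; congr (_ * expR _).
apply/eqP; rewrite -subr_eq0; apply/eqP.
transitivity ((s ^+ 2 - x ^+ 2) * (a ^+ 2 + b ^+ 2 - 1) / (2 * b ^+ 2)); first by field.
by rewrite ab subrr mulr0 mul0r.
Qed.

Lemma integral_phi : (\int[mu]_x (phi x)%:E = 1)%E.
Proof. exact: integral_normal_pdf. Qed.

Lemma integral_gauss (f : R -> R) :
    measurable_fun setT f -> (forall x, 0 <= f x) ->
  (\int[gam]_x (f x)%:E = \int[mu]_x (f x * phi x)%:E)%E.
Proof.
move=> mf f0; rewrite ge0_integral_normal_prob//; exact/measurable_EFinP.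
Qed.

Lemma measurable_affine (a b : R) : measurable_fun setT (fun x : R => a * x + b).
Proof. by apply: measurable_funD => //; exact: measurable_funM. Qed.

(** A rotated pair of independent standard normals is again standard normal:
    after the substitution [s = a x + b y] the joint density splits off the
    density of [s] and leaves a normal density in [x]. *)
Lemma gauss_stable (a b : R) (f : R -> R) : 0 < b -> a ^+ 2 + b ^+ 2 = 1 ->
    measurable_fun setT f -> (forall x, 0 <= f x) ->
  (\int[gam]_x \int[gam]_y (f (a * x + b * y))%:E = \int[gam]_x (f x)%:E)%E.
Proof.
move=> b0 ab mf f0.
have bn0 : b != 0 by rewrite gt_eqF.
pose k (x s : R) := f s * (phi ((s - a * x) / b) / b).
have k0 x s : 0 <= k x s.
  by rewrite !mulr_ge0// ?ltW// ?phi_gt0// invr_gt0.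
have mphi2 (x : R) : measurable_fun setT (fun s : R => phi ((s - a * x) / b)).
  apply: (measurableT_comp measurable_phi).
  by apply: measurable_funM => //; exact: measurable_funB.
have mk x : measurable_fun setT (k x).
  apply: measurable_funM => //; exact: measurable_funM.
have E1 x : (\int[gam]_y (f (a * x + b * y))%:E = \int[mu]_s (k x s)%:E)%E.
  rewrite integral_gauss//; last first.
    apply: (measurableT_comp mf); under eq_fun do rewrite addrC; exact: measurable_affine.
  rewrite -(ge0_integral_affine (a * x) b0 (mk x))//.
  apply: eq_integral => y _; rewrite /k (addrC (b * y)) [a * x + b * y]addrC addrK.
  by congr (_%:E); rewrite mulrAC (mulrC b) mulfK//; field.
have mk2 : measurable_fun (setT : set (measurableTypeR R * measurableTypeR R))
    (fun p => (k p.1 p.2 * phi p.1)%:E).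
  apply/measurable_EFinP; apply: measurable_funM; last first.
    exact: (measurableT_comp measurable_phi measurable_fst).
  apply: measurable_funM; first exact: (measurableT_comp mf measurable_snd).
  apply: measurable_funM => //; apply: (measurableT_comp measurable_phi).
  apply: measurable_funM => //; apply: measurable_funB => //.
  exact: measurable_funM.
have mk3 : measurable_fun (setT : set (measurableTypeR R * measurableTypeR R))
    (fun p => (k p.1 p.2)%:E).
  apply/measurable_EFinP; apply: measurable_funM; first exact: (measurableT_comp mf measurable_snd).
  apply: measurable_funM => //; apply: (measurableT_comp measurable_phi).
  apply: measurable_funM => //; apply: measurable_funB => //.
  exact: measurable_funM.
under eq_integral do rewrite E1.
rewrite [LHS]ge0_integral_normal_prob; first last.
- by move=> x; apply: integral_ge0 => s _; rewrite lee_fin.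
- apply: (@measurable_fun_fubini_tonelli_F _ _ _ _ _ mu (fun p => (k p.1 p.2)%:E)) => //.
  by move=> p; rewrite lee_fin.
transitivity (\int[mu]_x \int[mu]_s (k x s * phi x)%:E)%E.
  apply: eq_integral => x _; rewrite -ge0_integralZr//=.
  - by apply/measurable_EFinP; exact: mk.
  - by move=> s _; rewrite lee_fin.
  - by rewrite lee_fin ltW// phi_gt0.
rewrite (@fubini_tonelli _ _ _ _ _ mu mu (fun p => (k p.1 p.2 * phi p.1)%:E))//; last first.
  by move=> p; rewrite lee_fin mulr_ge0// ltW// phi_gt0.
rewrite integral_gauss//; apply: eq_integral => s _.
transitivity (\int[mu]_x ((f s * phi s)%:E * (phi (b^-1 * x + - (a * s / b)) * b^-1)%:E))%E.
  apply: eq_integral => x _; rewrite -EFinM /k /=; congr (_%:E).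
  have -> : b^-1 * x + - (a * s / b) = (x - a * s) / b by field.
  transitivity (f s * (phi x * phi ((s - a * x) / b)) / b); first by ring.
  by rewrite phi_rotate//; ring.
rewrite ge0_integralZl//=.
- rewrite ge0_integral_affine ?invr_gt0//; first by rewrite integral_phi mule1.
  + exact: measurable_phi.
  + by move=> x; rewrite ltW// phi_gt0.
- apply/measurable_EFinP; apply: measurable_funM => //.
  apply: (measurableT_comp measurable_phi); exact: measurable_affine.
- by move=> x _; rewrite lee_fin mulr_ge0 ?invr_ge0 ?ltW// phi_gt0.
- by rewrite lee_fin mulr_ge0// ltW// phi_gt0.
Qed.

End GaussDensity.

Section GaussMoments.
Context {R : realType}.
Local Notation mu := (@lebesgue_measure R).
Local Notation gam := (normal_prob (0:R) 1).
Local Notation phi := (@phi R).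

Lemma is_derive_phi (x : R) : is_derive x 1 phi (- x * phi x).
Proof.
have -> : phi = (fun x => (Num.sqrt (pi *+ 2))^-1 * expR (- (x ^+ 2 / 2))).
  by apply/funext => y; rewrite phiE.
set c := (Num.sqrt _)^-1.
have H : is_derive x (1:R) (fun x : R => - (x ^+ 2 / 2)) (- x).
  apply: is_derive_eq.
  by rewrite /GRing.scale /=; field.
have H2 := @is_derive1_comp R expR (fun x => - (x ^+ 2 / 2)) x _ _ (is_derive_expR _) H.
rewrite (_ : (fun _ => _) = c \*: (expR \o (fun x => - (x ^+ 2 / 2)))) //.
apply: is_derive_eq; rewrite /GRing.scale /=; ring.
Qed.

Lemma continuous_phi : continuous phi.
Proof. by apply: continuous_normal_pdf; rewrite oner_eq0. Qed.

Lemma is_derive_std_cdf (x : R) : is_derive x 1 (@std_cdf R) (phi x).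
Proof.
have [] := @continuous_FTC1 R phi -oo%O x (x + 1).
- by rewrite ltrDl.
- by apply: integrableS (integrable_normal_pdf 0 1).
- by rewrite ltNyr.
- exact: continuous_phi.
- move=> H1 H2; apply: DeriveDef; first exact: H1.
  by rewrite -derive1E; exact: H2.
Qed.

Lemma cvg_std_cdfN : std_cdf (- x) @[x --> +oo%R] --> (0 : R).
Proof.
have mid : measurable_fun (setT : set (measurableTypeR R)) (idfun : measurableTypeR R -> R).
  exact: measurable_id.
have := cvg_cdfNy0 (mkRV gam mid).
rewrite cvgNy_compNP => /fine_cvg /=.
by apply: cvg_trans; apply: near_eq_cvg; near=> x.
Unshelve. all: by end_near. Qed.

Lemma phi_peak_bound : exists2 c : R, 0 < c & forall x, phi x * (1 + x ^+ 2 / 2) <= c.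
Proof.
exists ((Num.sqrt (pi *+ 2))^-1); first by rewrite invr_gt0 sqrtr_gt0 pmulrn_lgt0// pi_gt0.
move=> x; rewrite phiE -mulrA ler_piMr ?invr_ge0// expRN mulrC ler_pdivrMr ?expR_gt0//.
by rewrite mul1r expR_ge1Dx.
Qed.

Lemma cvg_xphi (a : R) : (a - x) * phi x @[x --> +oo%R] --> (0 : R).
Proof.
have [c c0 hc] := phi_peak_bound.
apply/cvgr0Pnorm_le => e e0; near=> x.
have x1 : 1 <= x by near: x; apply: nbhs_pinfty_ge; rewrite num_real.
have xa : (`|a| + 1) * 2 * c / e <= x by near: x; apply: nbhs_pinfty_ge; rewrite num_real.
rewrite normrM (ger0_norm (ltW (phi_gt0 x))).
have h1 : `|a - x| <= (`|a| + 1) * x.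
  rewrite (le_trans (ler_normB _ _))// mulrDl mul1r lerD//; last by rewrite ger0_norm //; lra.
  by rewrite ler_peMr.
have h2 := hc x; have p0 := phi_gt0 x.
rewrite ler_pdivrMr// in xa.
have a0 : 0 <= `|a| by [].
have h3 : `|a - x| * phi x <= (`|a| + 1) * x * phi x by rewrite ler_wpM2r// ltW.
apply: (le_trans h3).
have h4 : x ^+ 2 * phi x <= 2 * c.
  have : phi x * (1 + x ^+ 2 / 2) = phi x + x ^+ 2 * phi x / 2 by field.
  nra.
have x0 : 0 < x by lra.
rewrite -(ler_pM2r x0).
have -> : (`|a| + 1) * x * phi x * x = (`|a| + 1) * (x ^+ 2 * phi x) by ring.
rewrite [leRHS]mulrC; apply: (le_trans _ xa).
rewrite -[leRHS]mulrA ler_wpM2l//; lra.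
Unshelve. all: by end_near. Qed.

Lemma integral_phi_tail (t a b : R) : 
  (forall x, t <= x -> 0 <= a + (x - b) ^+ 2 ) ->
  (\int[mu]_(x in `[t, +oo[) ((a + (x - b) ^+ 2) * phi x)%:E =
   ((a + 1 + b ^+ 2) * std_cdf (- t) + (t - 2 * b) * phi t)%:E)%E.
Proof.
move=> h.
pose F (x : R) := - ((a + 1 + b ^+ 2) * std_cdf (- x)) + (2 * b - x) * phi x.
have dF (x : R) : is_derive x (1:R) F ((a + (x - b) ^+ 2) * phi x).
  have H1 : is_derive x (1:R) (fun x => std_cdf (- x) : R) (- phi x).
    have H0 := @is_derive1_comp R (@std_cdf R) -%R x _ _ (is_derive_std_cdf (- x)) (is_deriveNid x 1).
    by apply: is_derive_eq; rewrite phiN mulrN1.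
  have H2 := is_derive_phi x.
  apply: is_derive_eq; rewrite /GRing.scale /=; ring.
have -> : ((a + 1 + b ^+ 2) * std_cdf (- t) + (t - 2 * b) * phi t) = 0 - F t.
  by rewrite /F; ring.
rewrite EFinB; apply: ge0_continuous_FTC2y.
- by move=> x tx; rewrite mulr_ge0 ?h// ltW// phi_gt0.
- apply: continuous_subspaceT => x.
  apply: cvgM; last exact: continuous_phi.
  apply: cvgD; first exact: cvg_cst.
  have cb : {for x, continuous (fun x : R => x - b)}.
    by apply: cvgB; [exact: cvg_id|exact: cvg_cst].
  exact: (cvgM cb cb).
- rewrite -[X in _ --> X](_ : - ((a + 1 + b ^+ 2) * 0) + 0 = 0); last by rewrite mulr0 oppr0 addr0.
  apply: cvgD; last exact: cvg_xphi.
  by apply: cvgN; apply: cvgM; [exact: cvg_cst|exact: cvg_std_cdfN].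
- by move=> x _; case: (dF x).
- apply: cvg_at_right_filter; apply: differentiable_continuous.
  by apply/derivable1_diffP; case: (dF t).
- by move=> x _; rewrite derive1E; exact: (@derive_val _ _ _ _ _ _ _ (dF x)).
Qed.

Lemma ge0_integral_gauss_sym (f : R -> R) : continuous f -> (forall x, 0 <= f x) ->
    (forall x, f (- x) = f x) ->
  (\int[gam]_x (f x)%:E = 2%:E * \int[mu]_(x in `[0%R, +oo[) (f x * phi x)%:E)%E.
Proof.
move=> cf f0 fN; rewrite integral_gauss//; last exact: continuous_measurable_fun.
rewrite ge0_symfun_integralT.
- congr (_ * integral _ _ _)%E; apply/seteqP; split => x /=; by rewrite in_itv/= andbT.
- by move=> x; rewrite mulr_ge0// ltW// phi_gt0.
- by move=> x; apply: cvgM; [exact: cf|exact: continuous_phi].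
- by move=> x; rewrite /= fN phiN.
Qed.

Lemma integral_phi_0y : (\int[mu]_(x in `[0%R, +oo[) (phi x)%:E = (std_cdf (0%R:R))%:E)%E.
Proof.
have h1 : (\int[mu]_(x in `[0%R, +oo[) ((0 + (x - 0) ^+ 2) * phi x)%R%:E = (std_cdf (0%R:R))%:E)%E.
  rewrite integral_phi_tail; last by move=> x _; rewrite add0r sqr_ge0.
  by congr (_%:E); rewrite oppr0; ring.
have h2 : (\int[mu]_(x in `[0%R, +oo[) ((1 + (x - 0) ^+ 2) * phi x)%R%:E = (2 * std_cdf (0%R:R))%R%:E)%E.
  rewrite integral_phi_tail; last by move=> x _; rewrite addr_ge0 ?sqr_ge0.
  by congr (_%:E); rewrite oppr0; ring.
have mf : measurable_fun (setT : set (measurableTypeR R)) phi by exact: measurable_phi.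
have mg : measurable_fun (setT : set (measurableTypeR R)) (fun x : R => (0 + (x - 0) ^+ 2) * phi x).
  apply: measurable_funM => //; apply: measurable_funD => //.
  by apply: measurable_funX; apply: measurable_funB.
have h3 : (\int[mu]_(x in `[0%R, +oo[) ((1 + (x - 0) ^+ 2) * phi x)%R%:E =
  \int[mu]_(x in `[0%R, +oo[) (phi x)%:E +
  \int[mu]_(x in `[0%R, +oo[) ((0 + (x - 0) ^+ 2) * phi x)%R%:E)%E.
  rewrite -ge0_integralD//=.
  - by apply: eq_integral => x _; rewrite -EFinD; congr (_%:E); ring.
  - by move=> x _; rewrite lee_fin ltW// phi_gt0.
  - by apply/measurable_EFinP; apply: measurable_funTS.
  - by move=> x _; rewrite lee_fin mulr_ge0 ?add0r ?sqr_ge0// ltW// phi_gt0.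
  - by apply/measurable_EFinP; apply: measurable_funTS.
move: h3; rewrite h1 h2 => /eqP; rewrite eq_sym addeC.
have : (0 <= \int[mu]_(x in `[0%R, +oo[) (phi x)%:E)%E.
  by apply: integral_ge0 => x _; rewrite lee_fin ltW// phi_gt0.
case: (\int[mu]_(x in _) _)%E => // r _; rewrite -EFinD eqe => /eqP h.
congr (_%:E); lra.
Qed.

Lemma std_cdf0 : std_cdf (0 : R) = 1 / 2.
Proof.
have c1 : continuous (fun _ : R => 1 : R) by move=> x; exact: cvg_cst.
have := @ge0_integral_gauss_sym (fun=> 1) c1 (fun=> ler01) (fun=> erefl).
under [X in (_ = _ * X)%E]eq_integral do rewrite mul1r.
rewrite integral_phi_0y integral_cst//= mul1e probability_setT -EFinM.
by move=> /eqP; rewrite eqe => /eqP h; lra.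
Qed.

Lemma gauss_second_moment : (\int[gam]_x (x ^+ 2)%:E = 1)%E.
Proof.
rewrite (@ge0_integral_gauss_sym (fun x => x ^+ 2)); first last.
- by move=> x; rewrite sqrrN.
- by move=> x; rewrite sqr_ge0.
- by move=> x; exact: exprn_continuous.
have := @integral_phi_tail 0 0 0.
under eq_integral do rewrite add0r subr0.
move=> ->; last by move=> x _; rewrite add0r sqr_ge0.
by rewrite oppr0 std_cdf0 -EFinM; congr (_%:E); field.
Qed.

(** Soft thresholding; the mean square of this excess under the normal law
    governs the phase transition. *)
Definition soft (t x : R) : R := Num.max 0 (`|x| - t).

Lemma gauss_soft_moment (t : R) : 0 <= t ->
  (\int[gam]_x (soft t x ^+ 2)%:E =
   (2 * ((1 + t ^+ 2) * std_cdf (- t) - t * phi t))%R%:E)%E.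
Proof.
move=> t0; rewrite (@ge0_integral_gauss_sym (fun x => soft t x ^+ 2)); first last.
- by move=> x; rewrite /soft normrN.
- by move=> x; rewrite sqr_ge0.
- move=> x.
  have cs : {for x, continuous (soft t)}.
    apply: continuous_max; first exact: cvg_cst.
    by apply: cvgB; [exact: norm_continuous|exact: cvg_cst].
  exact: (cvgM cs cs).
rewrite EFinM; congr (_ * _)%E.
transitivity (\int[mu]_(x in `[t, +oo[) ((0 + (x - t) ^+ 2) * phi x)%R%:E)%E.
  rewrite [LHS]integral_mkcond [RHS]integral_mkcond; apply: eq_integral => x _.
  rewrite /restrict /= !mem_setE !in_itv/= !andbT /soft.
  case: ifPn => x0; case: ifPn => xt //.
  - rewrite ger0_norm// max_r ?subr_ge0// add0r//.
  - rewrite ger0_norm// max_l ?expr0n ?mul0r//= subr_le0; move: xt; rewrite -ltNge; exact: ltW.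
  - by move: x0; rewrite (le_trans t0 xt).
rewrite integral_phi_tail; last by move=> x _; rewrite add0r sqr_ge0.
by congr (_%:E); ring.
Qed.

End GaussMoments.

Section Integrable.
Context {d} {T : measurableType d} {R : realType} (mu : {measure set T -> \bar R}).
Implicit Types f g : T -> R.

Lemma integrableDR f g : mu.-integrable setT (EFin \o f) ->
  mu.-integrable setT (EFin \o g) -> mu.-integrable setT (EFin \o (fun x => f x + g x)).
Proof. by move=> hf hg; have := integrableD measurableT hf hg; exact. Qed.

Lemma integrableZR (c : R) f : mu.-integrable setT (EFin \o f) ->
  mu.-integrable setT (EFin \o (fun x => c * f x)).
Proof. by move=> hf; have := integrableZl measurableT c hf; exact. Qed.

End Integrable.

Section GaussExpectation.
Context {R : realType}.
Local Notation mu := (@lebesgue_measure R).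
Local Notation gam := (normal_prob (0:R) 1).
Local Notation phi := (@phi R).

Lemma ge0_integral_gaussN (f : R -> R) :
    measurable_fun setT f -> (forall x, 0 <= f x) ->
  (\int[gam]_x (f (- x))%:E = \int[gam]_x (f x)%:E)%E.
Proof.
move=> mf f0.
have mN : measurable_fun setT (-%R : R -> R) by exact: oppr_measurable.
rewrite !integral_gauss//; last exact: (measurableT_comp mf mN).
pose g x := (f x * phi x)%:E.
have mg : measurable_fun (setT : set (measurableTypeR R)) g.
  by apply/measurable_EFinP; apply: measurable_funM => //; exact: measurable_phi.
have mN' : measurable_fun setT (-%R : measurableTypeR R -> measurableTypeR R) by exact: mN.
pose m : {measure set (measurableTypeR R) -> \bar R} :=
  pushforward mu (-%R : measurableTypeR R -> measurableTypeR R).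
transitivity (\int[m mN']_x g x)%E.
  rewrite ge0_integral_pushforward.
  - by rewrite preimage_setT; apply: eq_integral => x _ /=; rewrite /g phiN.
  - exact: mN'.
  - exact: measurableT.
  - exact: mg.
  - by move=> x _; rewrite lee_fin mulr_ge0// ltW// phi_gt0.
by apply: eq_measure_integral => A mA _; exact: lebesgue_measureN.
Qed.

Lemma gauss_fourth_moment : (\int[gam]_x (x ^+ 4)%:E < +oo)%E.
Proof.
rewrite integral_gauss//; last by move=> x; rewrite exprn_even_ge0.
pose C : R := 64 * (normal_peak 1 / normal_peak (Num.sqrt 2)).
have s2 : Num.sqrt 2 != 0 :> R by rewrite gt_eqF// sqrtr_gt0.
apply: (@le_lt_trans _ _ (\int[mu]_x (C * normal_pdf 0 (Num.sqrt 2) x)%:E)%E).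
  apply: ge0_le_integral => //=.
  - by move=> x _; rewrite lee_fin mulr_ge0 ?exprn_even_ge0// ltW// phi_gt0.
  - apply/measurable_EFinP; apply: measurable_funM; last exact: measurable_phi.
    exact: exprn_measurable.
  - by apply/measurable_EFinP; apply: measurable_funM => //; exact: measurable_normal_pdf.
  move=> x _; rewrite lee_fin /phi !normal_pdfE ?oner_eq0// /normal_fun !subr0 expr1n.
  rewrite sqr_sqrtr// /C.
  have p1 : 0 < normal_peak (1:R) by rewrite normal_peak_gt0 ?oner_eq0.
  have p2 : 0 < normal_peak (Num.sqrt (2:R)) by rewrite normal_peak_gt0.
  rewrite [leRHS](_ : _ = normal_peak 1 * (64 * expR (- x ^+ 2 / (2 *+ 2)))); last first.
    by field; rewrite gt_eqF.
  rewrite mulrCA ler_wpM2l ?(ltW p1)//.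
  have e1 := expR_ge1Dx (x ^+ 2 / 8).
  have e2 : x ^+ 4 <= 64 * expR (x ^+ 2 / 4).
    have -> : x ^+ 2 / 4 = x ^+ 2 / 8 + x ^+ 2 / 8 by field.
    have x2 : 0 <= x ^+ 2 by exact: sqr_ge0.
    rewrite expRD; have -> : x ^+ 4 = x ^+ 2 * x ^+ 2 by ring.
    nra.
  have -> : - x ^+ 2 / (1 *+ 2) = - (x ^+ 2 / 4) - x ^+ 2 / 4 by field.
  have -> : - x ^+ 2 / (2 *+ 2) = - (x ^+ 2 / 4) by field.
  rewrite expRD mulrA ler_wpM2r ?expR_ge0// expRN.
  by rewrite ler_pdivrMr ?expR_gt0.
under eq_integral do rewrite EFinM.
rewrite ge0_integralZl//=; first by rewrite integral_normal_pdf mule1 ltry.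
- by apply/measurable_EFinP; exact: measurable_normal_pdf.
- by move=> x _; rewrite lee_fin normal_pdf_ge0.
- by rewrite lee_fin !mulr_ge0// ?invr_ge0 ?normal_peak_ge0.
Qed.

(** Quartic growth covers every integrand below; it is enough to have a finite
    fourth moment. *)
Lemma integrable_gauss (C : R) (f : R -> R) : measurable_fun setT f ->
  (forall x, `|f x| <= C * (1 + x ^+ 4)) -> gam.-integrable setT (EFin \o f).
Proof.
move=> mf fC.
have mf' : measurable_fun (setT : set (measurableTypeR R)) (EFin \o f).
  by apply/measurable_EFinP; exact: mf.
have m4 : measurable_fun (setT : set (measurableTypeR R)) (fun x : R => x ^+ 4).
  exact: exprn_measurable.
have i4 : gam.-integrable setT (EFin \o (fun x : R => x ^+ 4)).
  apply/integrableP; split; first exact/measurable_EFinP.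
  under eq_integral do rewrite /= ger0_norm ?exprn_even_ge0//.
  exact: gauss_fourth_moment.
have i1 : gam.-integrable setT (EFin \o (fun x : R => 1 + x ^+ 4)).
  have i0 : gam.-integrable setT (EFin \o (fun _ : R => 1 : R)).
    exact: finite_measure_integrable_cst.
  exact: (integrableDR i0 i4).
apply: (le_integrable _ _ _ (integrableZR C i1)) => //.
by move=> x _ /=; rewrite lee_fin (le_trans (fC x))// ler_norm.
Qed.

Definition EG (f : R -> R) : R := \int[gam]_x f x.

Lemma EG_D f g : gam.-integrable setT (EFin \o f) -> gam.-integrable setT (EFin \o g) ->
  EG (fun x => f x + g x) = EG f + EG g.
Proof. by move=> hf hg; rewrite /EG RintegralD. Qed.

Lemma EG_Z c f : gam.-integrable setT (EFin \o f) -> EG (fun x => c * f x) = c * EG f.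
Proof. by move=> hf; rewrite /EG RintegralZl. Qed.

Lemma EG_cst c : EG (fun=> c) = c.
Proof.
rewrite /EG Rintegral_cst//.
exact: (etrans (congr1 (fun z => c * fine z) (probability_setT gam)) (mulr1 c)).
Qed.

Lemma EG_le f g : gam.-integrable setT (EFin \o f) -> gam.-integrable setT (EFin \o g) ->
  (forall x, f x <= g x) -> EG f <= EG g.
Proof. by move=> hf hg fg; apply: le_Rintegral. Qed.

Lemma EG_norm f : gam.-integrable setT (EFin \o f) -> `|EG f| <= EG (fun x => `|f x|).
Proof. by move=> hf; apply: le_normr_Rintegral. Qed.

Lemma EG_id : EG (fun x => x) = 0.
Proof.
have mid : measurable_fun setT (fun x : R => x) by [].
have mN : measurable_fun setT (fun x : R => - x) by exact: oppr_measurable.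
have m1 : measurable_fun setT (fun x : R => Num.max x 0) by apply: measurable_maxr.
have x4 (x : R) : `|x| <= 1 * (1 + x ^+ 4).
  have := sqr_ge0 (x ^+ 2 - 1); have := sqr_ge0 (`|x| - 1).
  have : `|x| ^+ 2 = x ^+ 2 by rewrite real_normK ?num_real.
  have : 0 <= `|x| by [].
  nra.
have b1 (x : R) : `|Num.max x 0| <= 1 * (1 + x ^+ 4).
  apply: le_trans (x4 x); rewrite ger0_norm ?le_max ?lexx ?orbT//.
  by rewrite ge_max normr_ge0 ler_norm.
have b2 (x : R) : `|Num.max (- x) 0| <= 1 * (1 + x ^+ 4).
  have e : (- x) ^+ 4 = x ^+ 4 by ring.
  by have := b1 (- x); rewrite e.
have i1 := integrable_gauss m1 b1.
have i2 := integrable_gauss (measurableT_comp m1 mN) b2.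
have -> : EG (fun x => x) = EG (fun x => Num.max x 0 + (-1) * Num.max (- x) 0).
  congr EG; apply/funext => x.
  by case: (lerP x 0) => hx; [rewrite max_l ?oppr_ge0 //; ring|rewrite max_r ?oppr_le0 1?ltW//; ring].
rewrite EG_D//; last first.
  by apply: (@integrable_gauss 1); [apply: measurable_funM => //; exact: (measurableT_comp m1 mN)|move=> x; rewrite mulN1r normrN].
rewrite EG_Z// /EG /Rintegral.
rewrite (@ge0_integral_gaussN (fun x => Num.max x 0)) ?mulN1r ?subrr//.
by move=> x; rewrite le_max lexx orbT.
Qed.

Lemma EG_sq : EG (fun x => x ^+ 2) = 1.
Proof. by rewrite /EG /Rintegral gauss_second_moment. Qed.

Lemma integrable_bounded (M : R) (f : R -> R) : measurable_fun setT f ->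
  (forall x, `|f x| <= M) -> gam.-integrable setT (EFin \o f).
Proof.
move=> mf fM; apply: (@integrable_gauss M) => // x; apply: le_trans (fM x) _.
have M0 : 0 <= M by exact: le_trans (fM 0).
by rewrite ler_peMr// lerDl exprn_even_ge0.
Qed.

Lemma EG_stable (a b : R) (M : R) (f : R -> R) : 0 < b -> a ^+ 2 + b ^+ 2 = 1 ->
    measurable_fun setT f -> (forall x, `|f x| <= M) ->
  EG (fun x => EG (fun y => f (a * x + b * y))) = EG f.
Proof.
move=> b0 ab mf fM.
pose g x := f x + M.
have mg : measurable_fun setT g by apply: measurable_funD.
have g0 x : 0 <= g x by rewrite /g -lerBlDr add0r; have := fM x; rewrite ler_norml => /andP[].
have gM x : `|g x| <= M + M.
  rewrite ger0_norm// /g lerD2r; exact: le_trans (ler_norm _) (fM x).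
have fin (h : R -> R) : measurable_fun setT h -> (forall x, 0 <= h x) -> (forall x, `|h x| <= M + M) ->
    (EG h)%:E = (\int[gam]_x (h x)%:E)%E.
  move=> mh h0 hM; rewrite /EG /Rintegral fineK//.
  by apply: integrable_fin_num => //; exact: (integrable_bounded mh hM).
have ml x : measurable_fun setT (fun y => a * x + b * y).
  under eq_fun do rewrite addrC; exact: measurable_affine.
have mgl x : measurable_fun setT (fun y => g (a * x + b * y)).
  exact: (measurableT_comp mg (ml x)).
have Eg x : (EG (fun y => g (a * x + b * y)))%:E = (\int[gam]_y (g (a * x + b * y))%:E)%E.
  exact: fin.
have key : EG (fun x => EG (fun y => g (a * x + b * y))) = EG g.
  rewrite /EG /Rintegral -(gauss_stable b0 ab mg g0); congr fine.
  by apply: eq_integral => x _; rewrite -Eg.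
have mgi : measurable_fun setT (fun x => EG (fun y => g (a * x + b * y))).
  apply/measurable_EFinP.
  rewrite (_ : _ \o _ = (fun x => \int[gam]_y (g (a * x + b * y))%:E)%E); last first.
    by apply/funext => x /=; rewrite Eg.
  apply: (@measurable_fun_fubini_tonelli_F _ _ (measurableTypeR R) (measurableTypeR R) _ gam (fun p => (g (a * p.1 + b * p.2))%:E)); last first.
    by move=> p; rewrite lee_fin.
  apply/measurable_EFinP; apply: (measurableT_comp mg); by apply: measurable_funD; apply: measurable_funM.
have shift x : EG (fun y => f (a * x + b * y)) = EG (fun y => g (a * x + b * y)) - M.
  have -> : EG (fun y => g (a * x + b * y)) = EG (fun y => f (a * x + b * y)) + EG (fun=> M).
    rewrite -EG_D //; last by apply: (@integrable_bounded `|M|).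
    by apply: (@integrable_bounded M) => //; exact: (measurableT_comp mf (ml x)).
  by rewrite EG_cst addrK.
have bgi x : `|EG (fun y => g (a * x + b * y))| <= M + M.
  apply: le_trans (EG_norm (integrable_bounded (mgl x) (fun y => gM _))) _.
  rewrite -(EG_cst (M + M)); apply: EG_le => //.
  - apply: (@integrable_bounded (M + M)); first exact: measurableT_comp (mgl x).
    by move=> y; rewrite normr_id.
  - by apply: (@integrable_bounded `|M + M|).
under [X in EG X]eq_fun do rewrite shift.
rewrite -(EG_cst (- M)) EG_D.
- rewrite key -EG_D; first by congr EG; apply/funext => y; rewrite EG_cst /g addrK.
  + exact: (integrable_bounded mg gM).
  + by apply: (@integrable_bounded `|EG (cst (- M))|).
- exact: (integrable_bounded mgi bgi).
- by apply: (@integrable_bounded `|EG (cst (- M))|).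
Qed.

(** Matching of the first two moments: a Gaussian and a Rademacher step of the
    same size agree up to the cubic error of the expansion. *)
Lemma gauss_rademacher_step : exists2 K : R, 0 <= K &
  forall (f : R -> R) (c a b C h M : R), measurable_fun setT f -> (forall x, `|f x| <= M) ->
    0 <= C -> 0 <= h ->
    (forall s, `|f s - (c + a * s + b * s ^+ 2)| <= C * `|s| ^+ 3) ->
  `|EG (fun z => f (h * z)) - (f h + f (- h)) / 2| <= K * C * h ^+ 3.
Proof.
have x4 (x : R) : `|x| ^+ 3 <= 1 * (1 + x ^+ 4).
  have : `|x| ^+ 4 = x ^+ 4 by rewrite -normrX ger0_norm ?exprn_even_ge0.
  have : 0 <= `|x| by []; set y := `|x| => y0 <-.
  rewrite mul1r; case: (lerP y 1) => y1.
    by apply: (@le_trans _ _ 1); [rewrite exprn_ile1|rewrite lerDl exprn_ge0].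
  have : y ^+ 3 <= y ^+ 4 by rewrite [leRHS]exprSr ler_peMr ?exprn_ge0// ltW.
  lra.
have m3 : measurable_fun setT (fun x : R => `|x| ^+ 3) by apply: measurable_funX.
have i3 : gam.-integrable setT (EFin \o (fun x : R => `|x| ^+ 3)).
  by apply: (integrable_gauss m3) => x; rewrite ger0_norm ?exprn_ge0.
pose K := EG (fun x => `|x| ^+ 3).
have K0 : 0 <= K by apply: Rintegral_ge0 => x _; rewrite exprn_ge0.
exists (K + 1); first by rewrite addr_ge0.
move=> f c a b C h M mf fM C0 h0 hf.
pose q (s : R) := c + a * s + b * s ^+ 2.
have mh : measurable_fun setT (fun z : R => h * z) by apply: measurable_funM.
have mfh := measurableT_comp mf mh.
have ifh : gam.-integrable setT (EFin \o (fun z => f (h * z))).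
  by apply: (integrable_bounded mfh) => z; exact: fM.
have i1 : gam.-integrable setT (EFin \o (fun z : R => a * h * z)).
  apply: (@integrable_gauss (`|a * h|)); first by apply: measurable_funM.
  move=> x; rewrite normrM ler_wpM2l//.
  have := sqr_ge0 (x ^+ 2 - 1); have := sqr_ge0 (`|x| - 1).
  have : `|x| ^+ 2 = x ^+ 2 by rewrite real_normK ?num_real.
  nra.
have i2 : gam.-integrable setT (EFin \o (fun z : R => b * h ^+ 2 * z ^+ 2)).
  apply: (@integrable_gauss (`|b * h ^+ 2|)).
    by apply: measurable_funM => //; exact: exprn_measurable.
  move=> x; rewrite normrM ler_wpM2l// ger0_norm ?sqr_ge0//.
  have := sqr_ge0 (x ^+ 2 - 1); nra.
have i0 : gam.-integrable setT (EFin \o (fun z : R => c)).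
  by apply: (@integrable_bounded `|c|).
have i01 : gam.-integrable setT (EFin \o (fun z : R => c + a * h * z)).
  exact: (integrableDR i0 i1).
have iq : gam.-integrable setT (EFin \o (fun z : R => q (h * z))).
  rewrite (_ : (fun z : R => q (h * z)) = (fun z => (c + a * h * z) + b * h ^+ 2 * z ^+ 2)).
    exact: (integrableDR i01 i2).
  by apply/funext => z; rewrite /q; ring.
have Eq : EG (fun z => q (h * z)) = c + b * h ^+ 2.
  transitivity (EG (fun z => (c + a * h * z) + b * h ^+ 2 * z ^+ 2)).
    by congr EG; apply/funext => z; rewrite /q; ring.
  rewrite EG_D// EG_D// EG_cst.
  have -> : EG (fun z => a * h * z) = 0.
    rewrite EG_Z ?EG_id ?mulr0//; apply: (@integrable_gauss 1) => // x; rewrite mul1r.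
    have := sqr_ge0 (x ^+ 2 - 1); have := sqr_ge0 (`|x| - 1).
    have : `|x| ^+ 2 = x ^+ 2 by rewrite real_normK ?num_real.
    nra.
  rewrite EG_Z ?EG_sq ?addr0 ?mulr1//; apply: (@integrable_gauss 1); first exact: exprn_measurable.
  move=> x; rewrite mul1r ger0_norm ?sqr_ge0//.
  have := sqr_ge0 (x ^+ 2 - 1); nra.
have e1 : `|EG (fun z => f (h * z)) - (c + b * h ^+ 2)| <= K * C * h ^+ 3.
  rewrite -Eq -mulN1r -EG_Z// -EG_D//; last exact: (integrableZR (-1) iq).
  have id : gam.-integrable setT (EFin \o (fun z => f (h * z) + -1 * q (h * z))).
    exact: (integrableDR ifh (integrableZR (-1) iq)).
  apply: le_trans (EG_norm id) _.
  have -> : K * C * h ^+ 3 = EG (fun z => (C * h ^+ 3) * `|z| ^+ 3) by rewrite EG_Z// -/K; ring.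
  apply: EG_le.
  - exact: (integrable_norm id).
  - exact: (integrableZR (C * h ^+ 3) i3).
  - move=> z; rewrite mulN1r; apply: le_trans (hf (h * z)) _.
    by rewrite normrM exprMn (ger0_norm h0) mulrA.
have e2 : `|(f h + f (- h)) / 2 - (c + b * h ^+ 2)| <= C * h ^+ 3.
  have := hf h; have := hf (- h); rewrite normrN (ger0_norm h0) !ler_norml.
  move=> /andP[u1 u2] /andP[v1 v2]; apply/andP; split; lra.
apply: le_trans (ler_distD (c + b * h ^+ 2) _ _) _.
rewrite distrC in e2; have -> : (K + 1) * C * h ^+ 3 = K * C * h ^+ 3 + C * h ^+ 3 by ring.
exact: lerD.
Qed.

End GaussExpectation.

(** * Random-sign steps and Gaussian steps *)

Lemma measurable_EG {R : realType} d (T : measurableType d)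
    (g : T -> R -> R) (M : R) :
  measurable_fun (setT : set (T * measurableTypeR R)) (fun p => g p.1 p.2) ->
  (forall w z, `|g w z| <= M) ->
  measurable_fun setT (fun w => EG (g w)).
Proof.
move=> mg gM.
have mgw w : measurable_fun setT (g w).
  exact: (measurableT_comp mg (pair1_measurable w)).
have igw w := integrable_bounded (mgw w) (gM w).
have ig1 : (normal_prob (0:R) 1).-integrable setT (EFin \o (fun _ : R => M)).
  by apply: (@integrable_bounded _ `|M|).
have Eg w : (EG (fun z => g w z + M))%:E = (\int[normal_prob 0 1]_z (g w z + M)%:E)%E.
  rewrite /EG /Rintegral fineK//; apply: integrable_fin_num => //.
  exact: (integrableDR (igw w) ig1).
rewrite (_ : (fun w => EG (g w)) = (fun w => EG (fun z => g w z + M) - M)); last first.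
  by apply/funext => w; rewrite EG_D// EG_cst addrK.
apply: measurable_funB => //; apply/measurable_EFinP.
rewrite (_ : _ \o _ = (fun w => \int[normal_prob 0 1]_z (g w z + M)%:E)%E); last first.
  by apply/funext => w; rewrite /= Eg.
apply: (@measurable_fun_fubini_tonelli_F _ _ T (measurableTypeR R) _ (normal_prob 0 1)
  (fun p => (g p.1 p.2 + M)%:E)); last first.
  by move=> p; rewrite lee_fin -lerBlDr add0r; have := gM p.1 p.2; rewrite ler_norml => /andP[].
by apply/measurable_EFinP; apply: measurable_funD.
Qed.

Section Operators.
Context {R : realType} {J : finType}.
Implicit Types (f g : (J -> R) -> R) (x z : J -> R) (i j : J) (js : seq J).

Definition shift x j (s : R) : J -> R := fun i => x i + s * (i == j)%:R.

Lemma shiftC x i j s t : shift (shift x i s) j t = shift (shift x j t) i s.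
Proof. by apply/funext => k; rewrite /shift addrAC. Qed.

Lemma shift_shift x j s t : shift (shift x j s) j t = shift x j (s + t).
Proof. by apply/funext => k; rewrite /shift mulrDl addrA. Qed.

Lemma shift0 x j : shift x j 0 = x.
Proof. by apply/funext => k; rewrite /shift mul0r addr0. Qed.

(** The transition operators of a random-sign step and, below, of a Gaussian
    step along one coordinate. *)
Definition rad (h : R) j f : (J -> R) -> R :=
  fun x => (f (shift x j h) + f (shift x j (- h))) / 2.

Definition rads h js f := foldr (rad h) f js.

Definition gau (h : R) j f : (J -> R) -> R :=
  fun x => EG (fun z : R => f (shift x j (h * z))).

Lemma radC h i j f : rad h i (rad h j f) = rad h j (rad h i f).
Proof.
apply/funext => x; rewrite /rad !(shiftC x j i); by field.
Qed.

Lemma rads_rad h js j f : rads h js (rad h j f) = rad h j (rads h js f).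
Proof. by elim: js => //= i js ->; rewrite radC. Qed.

Lemma rads_comm h js js' f : rads h js (rads h js' f) = rads h js' (rads h js f).
Proof. by elim: js' => //= i js' IH; rewrite rads_rad IH. Qed.

Lemma iter_comm (T : Type) (F G : T -> T) k (t : T) :
  (forall t, F (G t) = G (F t)) -> iter k F (G t) = G (iter k F t).
Proof. by move=> FG; elim: k => //= k ->. Qed.

Lemma iter_rads_cons h j js k f :
  iter k (rads h (j :: js)) f = iter k (rads h js) (iter k (rad h j) f).
Proof.
elim: k => // k IH; rewrite iterS IH [in RHS]iterS [iter k.+1 (rad h j) f]iterS.
rewrite [rads h (j :: js) _]/=.
rewrite (@iter_comm _ (rads h js) (rad h j) k); last by move=> g; rewrite rads_rad.
by rewrite rads_rad.
Qed.

Lemma rad_le h j f g x : (forall y, f y <= g y) -> rad h j f x <= rad h j g x.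
Proof. by move=> fg; rewrite /rad ler_pM2r// lerD. Qed.

Lemma rads_le h js f g x : (forall y, f y <= g y) -> rads h js f x <= rads h js g x.
Proof. by elim: js x => //= j js IH x fg; apply: rad_le => y; apply: IH. Qed.

Lemma radDc h j f c : rad h j (fun x => f x + c) = (fun x => rad h j f x + c).
Proof. by apply/funext => x; rewrite /rad; field. Qed.

Lemma radsDc h js f c : rads h js (fun x => f x + c) = (fun x => rads h js f x + c).
Proof. by elim: js => //= j js ->; rewrite radDc. Qed.

Lemma rads_norm h js f M x : (forall y, `|f y| <= M) -> `|rads h js f x| <= M.
Proof.
move=> fM; elim: js x => //= j js IH x; rewrite /rad.
have := IH (shift x j h); have := IH (shift x j (- h)); rewrite !ler_norml.
by move=> /andP[? ?] /andP[? ?]; apply/andP; split; lra.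
Qed.

(** Replacing one block of steps by another costs at most the one-block
    discrepancy each time, because the blocks commute and are averages. *)
Lemma iter_rads_compare h js js' f (e : R) k x :
  (forall y, rads h js' f y - e <= rads h js f y) ->
  iter k (rads h js') f x - k%:R * e <= iter k (rads h js) f x.
Proof.
elim: k f x => [|k IH] f x H; first by rewrite mul0r subr0.
rewrite !iterSr; apply: (@le_trans _ _ (iter k (rads h js) (rads h js' f) x - e)).
  have := IH (rads h js' f) x; rewrite -natr1 mulrDl mul1r => IHx.
  rewrite opprD addrA lerB// IHx// => y.
  rewrite (rads_comm h js js').
  have := @rads_le h js' (fun y => rads h js' f y - e) (rads h js f) y H.
  by rewrite radsDc.
have mono n g g' y : (forall y, g y <= g' y) -> iter n (rads h js) g y <= iter n (rads h js) g' y.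
  by move=> gg; elim: n y => //= n IHn y; apply: rads_le.
have addc n g y : iter n (rads h js) (fun y => g y - e) y = iter n (rads h js) g y - e.
  by elim: n y => //= n IHn y; rewrite (_ : iter n _ _ = (fun y => iter n (rads h js) g y - e)) ?radsDc//; apply/funext.
by rewrite -addc; apply: mono.
Qed.

End Operators.

Section GaussianSteps.
Context {R : realType} {J : finType}.
Implicit Types (f g : (J -> R) -> R) (x : J -> R) (i j : J) (js : seq J).

(** Measurability with respect to the product sigma-algebra, phrased without
    it: composing with any measurable family gives a measurable function. *)
Definition natm f := forall d (T : measurableType d) (X : J -> T -> R),
  (forall j, measurable_fun setT (X j)) ->
  measurable_fun setT (fun w => f (fun j => X j w)).

Lemma natm_shift f d (T : measurableType d) (X : J -> T -> R) j (Y : T -> R) :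
  natm f -> (forall j, measurable_fun setT (X j)) -> measurable_fun setT Y ->
  measurable_fun setT (fun w => f (shift (fun j => X j w) j (Y w))).
Proof.
move=> nf mX mY; apply: (nf _ _ (fun i w => X i w + Y w * (i == j)%:R)) => i.
by apply: measurable_funD => //; apply: measurable_funM.
Qed.

Lemma natm_line f x j : natm f -> measurable_fun setT (fun s : R => f (shift x j s)).
Proof. by move=> nf; apply: (@natm_shift f _ R (fun i _ => x i)). Qed.

Lemma natm_scaled_line f x j (t : R) : natm f ->
  measurable_fun setT (fun z : R => f (shift x j (t * z))).
Proof.
by move=> nf; apply: (measurableT_comp (natm_line x j nf)); exact: mulrl_measurable.
Qed.

(** The bounded functions for which a Gaussian step along a coordinate may be
    traded for a Rademacher step at cubic cost, uniformly in the base point. *)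
Record stepping (C M : R) f : Prop := Stepping {
  stepping_natm : natm f;
  stepping_bound : forall x, `|f x| <= M;
  stepping_cubic : forall j h x, 0 <= h -> `|gau h j f x - rad h j f x| <= C * h ^+ 3 }.

Lemma natm_rad h j f : natm f -> natm (rad h j f).
Proof.
move=> nf d T X mX; rewrite /rad; apply: measurable_funM => //.
by apply: measurable_funD; apply: natm_shift.
Qed.

Lemma stepping_rad C M f h j : stepping C M f -> stepping C M (rad h j f).
Proof.
case=> nf bf cf; split; first exact: natm_rad.
- by move=> x; exact: (@rads_norm _ _ h [:: j]).
- move=> i t x t0.
  have gE : gau t i (rad h j f) x = (gau t i f (shift x j h) + gau t i f (shift x j (- h))) / 2.
    have I1 s : (normal_prob (0:R) 1).-integrable setT
        (EFin \o (fun z : R => f (shift (shift x j s) i (t * z)))).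
      apply: (integrable_bounded (M := M)) => //; exact: natm_scaled_line.
    rewrite /gau -EG_D// mulrC -EG_Z; last exact: integrableDR.
    by congr EG; apply/funext => z; rewrite /rad !(shiftC x i j) mulrC.
  rewrite gE; have -> : rad t i (rad h j f) x = (rad t i f (shift x j h) + rad t i f (shift x j (- h))) / 2.
    by rewrite /rad !(shiftC x i j); field.
  have := cf i t (shift x j h) t0; have := cf i t (shift x j (- h)) t0.
  rewrite !ler_norml => /andP[? ?] /andP[? ?]; apply/andP; split; lra.
Qed.

Lemma stepping_iter_rad C M f h j k : stepping C M f -> stepping C M (iter k (rad h j) f).
Proof. by move=> sf; elim: k => //= k; apply: stepping_rad. Qed.

Lemma gau_bound M f h j x : natm f -> (forall y, `|f y| <= M) -> `|gau h j f x| <= M.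
Proof.
move=> nf bf.
apply: le_trans (EG_norm (integrable_bounded (natm_scaled_line _ _ _ nf) (fun z => bf _))) _.
rewrite -(EG_cst M); apply: EG_le => //.
- by apply: (@integrable_bounded _ M) => [|z]; [exact: (measurableT_comp (@normr_measurable _ _) (natm_scaled_line _ _ _ nf))|rewrite normr_id].
- by apply: (@integrable_bounded _ `|M|).
Qed.

Lemma natm_gau M f h j : natm f -> (forall y, `|f y| <= M) -> natm (gau h j f).
Proof.
move=> nf bf d T X mX.
apply: (@measurable_EG R _ T (fun w z => f (shift (fun i => X i w) j (h * z))) M) => //.
apply: (@natm_shift f _ _ (fun i p => X i p.1)) => //.
- by move=> i; exact: (measurableT_comp (mX i) measurable_fst).
- by apply: measurable_funM.
Qed.

(** By stability a Gaussian step splits into [k] small ones, which are traded one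
    at a time for random-sign steps. *)
Lemma gau_pow C M f h j k x : 0 < h -> stepping C M f ->
  `|gau (h * Num.sqrt k%:R) j f x - iter k (rad h j) f x| <= k%:R * C * h ^+ 3.
Proof.
move=> h0; elim: k f x => [|k IH] f x sf.
  rewrite sqrtr0 mulr0 !mul0r /gau /=.
  under [X in EG X]eq_fun do rewrite mul0r shift0.
  by rewrite EG_cst subrr normr0.
have [nf bf cf] := sf.
pose r : R := Num.sqrt k%:R; pose r' : R := Num.sqrt k.+1%:R.
have r'0 : 0 < r' by rewrite sqrtr_gt0 ltr0n.
have rr : r ^+ 2 + 1 = r' ^+ 2 by rewrite !sqr_sqrtr ?ler0n// natr1.
have ml (t : R) : measurable_fun setT (fun z => f (shift x j (t * z))) by exact: natm_scaled_line.
have E : gau (h * r') j f x = EG (fun y => gau h j f (shift x j (h * r * y))).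
  rewrite /gau -(@EG_stable R (r / r') (r'^-1) M (fun z => f (shift x j (h * r' * z)))).
  - congr EG; apply/funext => y; congr EG; apply/funext => z.
    by rewrite shift_shift; congr (f (shift x j _)); field; rewrite gt_eqF.
  - by rewrite invr_gt0.
  - by rewrite expr_div_n exprVn -[X in _ + X]mul1r -mulrDl rr divff// expf_neq0// gt_eqF.
  - exact: ml.
  - by move=> z; exact: bf.
have mg : measurable_fun setT (fun y => gau h j f (shift x j (h * r * y))).
  apply: (@measurable_EG R _ R (fun y z => f (shift (shift x j (h * r * y)) j (h * z))) M) => //.
  apply: (@natm_shift f _ _ (fun i p => shift x j (h * r * p.1) i)) => //.
    move=> i; apply: measurable_funD => //; apply: measurable_funM => //; exact: measurable_funM.
  exact: measurable_funM.
have bg y : `|gau h j f y| <= M by exact: gau_bound.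
have [nr br cr] := stepping_rad h j sf.
have E2 : `|gau (h * r') j f x - gau (h * r) j (rad h j f) x| <= C * h ^+ 3.
  have ig := integrable_bounded mg (fun y => bg _).
  have ir : (normal_prob (0:R) 1).-integrable setT (EFin \o (fun y => rad h j f (shift x j (h * r * y)))).
    by apply: (@integrable_bounded _ M) => //; exact: natm_scaled_line.
  have id := integrableDR ig (integrableZR (-1) ir).
  rewrite E {2}/gau -mulN1r -EG_Z// -EG_D//; last exact: (integrableZR (-1) ir).
  apply: le_trans (EG_norm id) _; rewrite -(EG_cst (C * h ^+ 3)).
  apply: EG_le; first exact: (integrable_norm id).
    by apply: (@integrable_bounded _ `|C * h ^+ 3|).
  by move=> z; rewrite mulN1r; apply: cf; exact: ltW.
have := IH (rad h j f) x (stepping_rad h j sf).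
rewrite -/r' iterSr -natr1 -/r => IHx.
apply: le_trans (ler_distD (gau (h * r) j (rad h j f) x) _ _) _.
have -> : (k%:R + 1) * C * h ^+ 3 = C * h ^+ 3 + k%:R * C * h ^+ 3 by ring.
exact: lerD.
Qed.

End GaussianSteps.

(** * Independent families *)

(** Independence of the listed members only: in the comparison of two Gaussian
    families nothing is asked of their joint law, so they may even overlap. *)
Definition indep_on {R : realType} {d} {T : measurableType d} {P : probability T R}
    {J : finType} (js : seq J) (X : J -> {RV P >-> R}) : Prop :=
  forall (S : {set J}) (A : J -> set R), {subset S <= js} ->
    (forall i, measurable (A i)) ->
    P [set w | forall i, i \in S -> A i (X i w)] = (\prod_(i in S) P (X i @^-1` A i))%E.

Lemma indep_on_sub {R : realType} {d} {T : measurableType d} {P : probability T R}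
    {J : finType} (js js' : seq J) (X : J -> {RV P >-> R}) :
  {subset js' <= js} -> indep_on js X -> indep_on js' X.
Proof. by move=> sub H S A SJ; apply: H => i /SJ/sub. Qed.

Lemma indep_on_comp {R : realType} {d} {T : measurableType d} {P : probability T R}
    {I J : finType} (js : seq J) (phi : J -> I) (X : I -> {RV P >-> R}) :
  {in js &, injective phi} -> mutually_independent X -> indep_on js (fun j => X (phi j)).
Proof.
move=> phiI indX S A Sjs mA.
pose A' i := if [pick j in S | phi j == i] is Some j then A j else setT.
have A'E j : j \in S -> A' (phi j) = A j.
  move=> jS; rewrite /A'; case: pickP => [k /andP[kS /eqP kj]|/(_ j)]; last by rewrite jS eqxx.
  by congr A; apply: phiI; rewrite ?Sjs.
have mA' i : measurable (A' i) by rewrite /A'; case: pickP.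
have := indX (phi @: S)%SET _ mA'.
rewrite (_ : [set w | _] = [set w | forall j, j \in S -> A j (X (phi j) w)]); last first.
  apply/seteqP; split => w /= H.
    by move=> j jS; rewrite -A'E//; apply: H; apply: imset_f.
  by move=> i /imsetP[j jS ->]; rewrite A'E//; exact: H.
move=> ->; rewrite big_imset/=; last first.
  by move=> a b aS bS; apply: phiI; exact: Sjs.
by apply: eq_bigr => j jS; rewrite A'E.
Qed.

Section Independence.
Context {R : realType} {d : measure_display} {T : measurableType d}.
Variable P : probability T R.
Context {J : finType}.
Variable X : J -> {RV P >-> R}.
Variables (js : seq J) (j : J).
Hypothesis indX : indep_on (j :: js) X.
Hypothesis jjs : j \notin js.

Definition cylinders : set (set T) :=
  [set S | exists A : J -> set R, (forall i, measurable (A i)) /\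
     S = [set w | forall i, i \in js -> A i (X i w)]].

Let cylinders_measurable : cylinders `<=` measurable.
Proof.
move=> _ [A [mA ->]].
rewrite (_ : [set w | _] = \bigcap_(i in [set` js]) (X i @^-1` A i)).
  apply: fin_bigcap_measurable; first exact: finite_seq.
  by move=> i _; rewrite -[_ @^-1` _]setTI; exact: measurable_funP.
by apply/seteqP; split => w H i; exact: H.
Qed.

Let cylindersI : setI_closed cylinders.
Proof.
move=> _ _ [A [mA ->]] [B [mB ->]]; exists (fun i => A i `&` B i); split.
  by move=> i; exact: measurableI.
apply/seteqP; split => w /=; first by move=> [HA HB] i ijs; split; [exact: HA|exact: HB].
by move=> H; split => i /H [].
Qed.

Let cylindersT : cylinders setT.
Proof. by exists (fun=> setT); split => //; apply/seteqP; split. Qed.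

(** The cylinders are stable under intersection, so the product rule extends to
    the sigma-algebra that they generate. *)
Lemma cylinder_independent (S : set T) (B : set R) : <<s cylinders >> S -> measurable B ->
  P (S `&` X j @^-1` B) = (P S * P (X j @^-1` B))%E.
Proof.
move=> sS mB.
have mXB : measurable (X j @^-1` B).
  by rewrite -[_ @^-1` _]setTI; exact: measurable_funP.
have c0 : 0 <= fine (P (X j @^-1` B)) by rewrite fine_ge0.
have cE : (fine (P (X j @^-1` B)))%:E = P (X j @^-1` B) by rewrite fineK// fin_num_measure.
pose m2 : {measure set T -> \bar R} := mscale (NngNum c0) P.
rewrite -[LHS]/(mrestr P mXB S) muleC -cE -[RHS]/(m2 S).
apply: (g_sigma_algebra_measure_unique cylinders cylinders_measurable (fun=> setT)) => //.
- by apply/seteqP; split => // w _; exists 0%N.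
- move=> _ [A [mA ->]].
  rewrite /m2 /= /mscale /mrestr /= cE.
  pose A' i := if i == j then B else A i.
  have mA' i : measurable (A' i) by rewrite /A'; case: ifP.
  have sub1 : {subset [set i in js]%SET <= j :: js}.
    by move=> i; rewrite !inE => ->; rewrite orbT.
  have sub2 : {subset (j |: [set i in js])%SET <= j :: js} by move=> i; rewrite !inE.
  have := indX sub1 mA.
  rewrite (_ : [set w | _] = [set w | forall i, i \in js -> A i (X i w)]); last first.
    by apply/seteqP; split => w H i; [move=> ijs; apply: H; rewrite inE|rewrite inE; exact: H].
  move=> ->; have := indX sub2 mA'.
  rewrite (_ : [set w | _] = [set w | forall i, i \in js -> A i (X i w)] `&` X j @^-1` B); last first.
    apply/seteqP; split => w /=.
      move=> H; split; last by have := H j; rewrite /A' eqxx setU11; exact.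
      move=> i ijs; have := H i; rewrite /A' !inE ijs orbT; case: eqP => [ij|_]; last exact.
      by move: jjs; rewrite -ij ijs.
    move=> [H HB] i; rewrite /A' !inE; case: eqP => [->//|_ /=]; exact: H.
  move=> ->; rewrite big_setU1/=; last by rewrite inE.
  rewrite {1}/A' eqxx; congr (_ * _)%E; apply: eq_bigr => i; rewrite inE /A' => ijs.
  by case: eqP => // ij; move: jjs; rewrite -ij ijs.
- by move=> k; rewrite /= /mrestr setTI (le_lt_trans (probability_le1 _ mXB))// ltry.
Qed.

(** The joint law of the earlier coordinates, kept abstractly as the base space
    with their sigma-algebra, and of the coordinate [j] is a product. *)
Lemma ge0_integral_independent (g : T -> R -> \bar R) :
  (forall B, measurable B -> P (X j @^-1` B) = normal_prob 0 1 B) ->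
  measurable_fun (setT : set (g_sigma_algebraType cylinders * measurableTypeR R))
    (fun p => g p.1 p.2) ->
  (forall w z, (0 <= g w z)%E) ->
  (\int[P]_w g w (X j w) = \int[P]_w \int[normal_prob 0 1]_z g w z)%E.
Proof.
move=> lawX mg g0.
pose T' := g_sigma_algebraType cylinders.
have sub : <<s cylinders >> `<=` measurable.
  exact: (smallest_sub (@sigma_algebra_measurable _ T) cylinders_measurable).
have mid : measurable_fun setT (fun w : T => w : T').
  by move=> _ S mS; rewrite setTI; exact: sub.
pose idm : {mfun T >-> T'} := mfun_Sub (mem_set mid).
have mpair : measurable_fun setT (fun w : T => (w : T', X j w : measurableTypeR R)).
  have mXj : measurable_fun setT (X j : T -> R) by [].
  by apply: measurable_fun_pair => //; exact: mXj.
pose pairm : {mfun T >-> (T' * measurableTypeR R)%type} := mfun_Sub (mem_set mpair).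
transitivity (\int[distribution P pairm]_p g p.1 p.2)%E.
  by rewrite ge0_integral_distribution.
transitivity (\int[distribution P idm \x normal_prob 0 1]_p g p.1 p.2)%E.
  apply: eq_measure_integral => S mS _; apply/esym.
  apply: product_measure_unique => // A B mA mB.
  apply: etrans _ (congr1 (fun z => (P A * z)%E) (lawX B mB)).
  rewrite -(cylinder_independent mA mB).
  by congr (P _); apply/seteqP; split.
rewrite fubini_tonelli1// ge0_integral_distribution//.
  by apply: measurable_fun_fubini_tonelli_F.
by move=> w; apply: integral_ge0.
Qed.

End Independence.

Section Peel.
Context {R : realType} {d : measure_display} {T : measurableType d}.
Variable P : probability T R.
Context {J : finType}.
Variable X : J -> {RV P >-> R}.
Definition EP (f : T -> R) : R := \int[P]_w f w.

(** The other coordinates are frozen at 0, so that all subfamilies live on the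
    same index type. *)
Definition partial_family (js : seq J) (w : T) : J -> R :=
  fun i => if i \in js then X i w else 0.

Lemma measurable_partial_family js i : measurable_fun setT (fun w => partial_family js w i).
Proof. by rewrite /partial_family; case: (i \in js). Qed.

Lemma integrable_boundedP (M : R) (f : T -> R) : measurable_fun setT f ->
  (forall x, `|f x| <= M) -> P.-integrable setT (EFin \o f).
Proof.
move=> mf fM.
apply: (@le_integrable _ _ _ P setT measurableT _ (EFin \o fun=> M)).
- exact/measurable_EFinP.
- by move=> x _ /=; rewrite lee_fin (le_trans (fM x))// ler_norm.
- exact: finite_measure_integrable_cst.
Qed.

Lemma EP_D f g : P.-integrable setT (EFin \o f) -> P.-integrable setT (EFin \o g) ->
  EP (fun x => f x + g x) = EP f + EP g.
Proof. by move=> hf hg; rewrite /EP RintegralD. Qed.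

Lemma EP_cst c : EP (fun=> c) = c.
Proof.
rewrite /EP Rintegral_cst//.
exact: (etrans (congr1 (fun z => c * fine z) (probability_setT P)) (mulr1 c)).
Qed.

Lemma EP_le f g : P.-integrable setT (EFin \o f) -> P.-integrable setT (EFin \o g) ->
  (forall x, f x <= g x) -> EP f <= EP g.
Proof. by move=> hf hg fg; apply: le_Rintegral. Qed.

(** Integrating out one coordinate turns it into a Gaussian step. *)
Lemma EP_peel (js : seq J) (j : J) (f : (J -> R) -> R) (M : R) : indep_on (j :: js) X -> j \notin js ->
  (forall B, measurable B -> P (X j @^-1` B) = normal_prob 0 1 B) ->
  natm f -> (forall x, `|f x| <= M) ->
  EP (fun w => f (shift (partial_family js w) j (X j w))) =
  EP (fun w => gau 1 j f (partial_family js w)).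
Proof.
move=> indX jjs lawX nf fM.
have mpf' i : measurable_fun (setT : set (g_sigma_algebraType (cylinders X js)))
    (fun w => partial_family js w i).
  rewrite /partial_family; case ijs : (i \in js) => // _ B mB; rewrite setTI.
  apply: sub_sigma_algebra; exists (fun k => if k == i then B else setT); split.
    by move=> k; case: ifP.
  apply/seteqP; split => w /=; first by move=> H k kjs; case: eqP => // ->.
  by move=> /(_ i ijs); rewrite eqxx.
have mshift : measurable_fun
    (setT : set (g_sigma_algebraType (cylinders X js) * measurableTypeR R))
    (fun p => f (shift (partial_family js p.1) j p.2)).
  apply: (@natm_shift _ _ f _ (g_sigma_algebraType (cylinders X js) * measurableTypeR R)%type
    (fun i p => partial_family js p.1 i) j (fun p => p.2)) => //.
    by move=> i; exact: (measurableT_comp (mpf' i) measurable_fst).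
  exact: measurable_snd.
have mgw w : measurable_fun setT (fun z : R => f (shift (partial_family js w) j z)).
  exact: natm_line.
have EgauE w : (gau 1 j f (partial_family js w) + M)%:E =
    (\int[normal_prob 0 1]_z (f (shift (partial_family js w) j z) + M)%:E)%E.
  rewrite /gau; under [X in EG X]eq_fun do rewrite mul1r.
  rewrite -{1}(EG_cst M) -EG_D; last by apply: (@integrable_bounded _ `|M|).
    rewrite /EG /Rintegral fineK//; apply: integrable_fin_num => //.
    apply: (@integrable_bounded _ (M + `|M|)); first exact: measurable_funD.
    by move=> z; apply: le_trans (ler_normD _ _) _; rewrite lerD2r.
  exact: (integrable_bounded (mgw w)).
have H := ge0_integral_independent indX jjs (g := fun w z => (f (shift (partial_family js w) j z) + M)%:E) lawX.
have i1 : P.-integrable setT (EFin \o fun w => f (shift (partial_family js w) j (X j w))).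
  apply: (@integrable_boundedP M) => //; apply: natm_shift => //.
  exact: measurable_partial_family.
have i2 : P.-integrable setT (EFin \o fun w => gau 1 j f (partial_family js w)).
  apply: (@integrable_boundedP M); last by move=> w; exact: gau_bound.
  exact: (natm_gau 1 j nf fM (measurable_partial_family js)).
have iM : P.-integrable setT (EFin \o fun=> M) by exact: (@integrable_boundedP `|M|).
suff : EP (fun w => f (shift (partial_family js w) j (X j w))) + EP (fun=> M) =
    EP (fun w => gau 1 j f (partial_family js w)) + EP (fun=> M) by move/addIr.
rewrite -!EP_D//.
rewrite /EP /Rintegral; congr fine; rewrite H.
- by apply: eq_integral => w _; rewrite -EgauE.
- apply/measurable_EFinP.
  exact: (measurable_funD mshift (measurable_cst M)).
- by move=> w z; rewrite lee_fin -lerBlDr add0r; have := fM (shift (partial_family js w) j z); rewrite ler_norml => /andP[].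
Qed.

End Peel.

(** * Second-order comparison of Gaussian families *)

Section Lindeberg.
Context {R : realType} {d : measure_display} {T : measurableType d}.
Variable P : probability T R.
Context {J : finType}.
Variable X : J -> {RV P >-> R}.

Lemma natm_partial_family (f : (J -> R) -> R) js : natm f ->
  measurable_fun setT (fun w => f (partial_family X js w)).
Proof. by move=> nf; exact: (nf _ _ _ (measurable_partial_family X js)). Qed.

(** The coordinates are integrated out one at a time, each as [k] steps of size
    [h = 1 / sqrt k]. *)
Lemma gauss_to_rademacher (js : seq J) (C M h : R) (k : nat) (f : (J -> R) -> R) :
  uniq js -> indep_on js X ->
  (forall j B, j \in js -> measurable B -> P (X j @^-1` B) = normal_prob 0 1 B) ->
  stepping C M f -> 0 < h -> h * Num.sqrt k%:R = 1 ->
  `|EP P (fun w => f (partial_family X js w)) - iter k (rads h js) f (fun=> 0)|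
    <= (size js)%:R * (k%:R * C * h ^+ 3).
Proof.
elim: js f => [|j js IH] f /=.
  move=> _ _ _ _ _ _.
  rewrite (_ : (fun w => _) = fun=> f (fun=> 0)) ?EP_cst; last first.
    by apply/funext => w; congr f; apply/funext.
  by rewrite (_ : iter k _ _ = f) ?subrr ?normr0 ?mul0r//; elim: k => //= k ->.
move=> /andP[jjs ujs] ind law sf h0 hk.
have [nf bf cf] := sf.
have ind' : indep_on js X by apply: indep_on_sub ind => i ijs; rewrite inE ijs orbT.
have law' i B : i \in js -> measurable B -> P (X i @^-1` B) = normal_prob 0 1 B.
  by move=> ijs; apply: law; rewrite inE ijs orbT.
pose g := iter k (rad h j) f.
have sg : stepping C M g by exact: stepping_iter_rad.
have := IH g ujs ind' law' sg h0 hk.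
rewrite -iter_rads_cons => IHg.
have E : EP P (fun w => f (partial_family X (j :: js) w)) =
         EP P (fun w => gau 1 j f (partial_family X js w)).
  rewrite -(EP_peel ind jjs (M := M))//.
  - congr EP; apply/funext => w; congr f; apply/funext => i.
    rewrite /shift /partial_family inE; case: eqP => [->|_] /=.
      by rewrite (negbTE jjs) add0r mulr1.
    by rewrite mulr0 addr0.
  - by move=> B; apply: law; rewrite inE eqxx.
have [ng bg _] := sg.
have i1 : P.-integrable setT (EFin \o (fun w => gau 1 j f (partial_family X js w))).
  apply: (@integrable_boundedP _ _ _ _ M); last by move=> w; exact: gau_bound.
  by apply: natm_partial_family; exact: (natm_gau _ _ nf bf).
have i2 : P.-integrable setT (EFin \o (fun w => g (partial_family X js w))).
  apply: (@integrable_boundedP _ _ _ _ M); last by move=> w; exact: bg.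
  exact: natm_partial_family.
have step : `|EP P (fun w => f (partial_family X (j :: js) w)) -
              EP P (fun w => g (partial_family X js w))| <= k%:R * C * h ^+ 3.
  have hp w : `|gau 1 j f (partial_family X js w) - g (partial_family X js w)| <= k%:R * C * h ^+ 3.
    by have := gau_pow j k (partial_family X js w) h0 sf; rewrite hk.
  set e := k%:R * C * h ^+ 3 in hp *.
  have ie (c : R) : P.-integrable setT (EFin \o (fun _ : T => c)).
    by apply: (@integrable_boundedP _ _ _ _ `|c|).
  rewrite E ler_norml; apply/andP; split.
    rewrite lerBrDl -(EP_cst P (- e)) -EP_D//; apply: EP_le => //; first exact: integrableDR.
    by move=> w; have := hp w; rewrite ler_norml => /andP[? ?]; lra.
  rewrite lerBlDl -(EP_cst P e) -EP_D//; apply: EP_le => //; first exact: integrableDR.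
  by move=> w; have := hp w; rewrite ler_norml => /andP[? ?]; lra.
apply: le_trans (ler_distD (EP P (fun w => g (partial_family X js w))) _ _) _.
by rewrite -natr1 mulrDl mul1r addrC lerD.
Qed.

End Lindeberg.

Section Jets.
Context {R : realType} {J : finType}.
Implicit Types (f g : (J -> R) -> R) (x z : J -> R).

Definition n1 z : R := \sum_i `|z i|.

Definition qpoly (c : R) (a : J -> R) (q : J -> J -> R) z : R :=
  c + \sum_i a i * z i + \sum_i \sum_j q i j * z i * z j.

(** A second-order expansion at [x] with cubic remainder on the unit ball; the
    constant also bounds the coefficients, which makes jets multiply. *)
Record jet (C : R) f x c a q : Prop := Jet {
  jet0 : `|c| <= C;
  jet1 : forall i, `|a i| <= C;
  jet2 : forall i j, `|q i j| <= C;
  jet_err : forall z, n1 z <= 1 ->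
    `|f (fun i => x i + z i) - qpoly c a q z| <= C * n1 z ^+ 3 }.

Lemma n1_ge0 z : 0 <= n1 z.
Proof. by apply: sumr_ge0. Qed.

Lemma n1_shift (y : J -> R) j s : n1 (shift y j s) <= n1 y + `|s|.
Proof.
rewrite /n1 /shift; apply: (@le_trans _ _ (\sum_i (`|y i| + `|s * (i == j)%:R|))).
  by apply: ler_sum => i _; exact: ler_normD.
rewrite big_split/= lerD2l (bigD1 j)//= eqxx mulr1 big1 ?addr0// => i /negbTE ->.
by rewrite mulr0 normr0.
Qed.

Lemma sum_delta (F : J -> R) j (s : R) : \sum_i F i * (s * (i == j)%:R) = F j * s.
Proof.
rewrite (bigD1 j)//= eqxx mulr1 big1 ?addr0// => i /negbTE ->.
by rewrite mulr0 mulr0.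
Qed.

Lemma qpoly_shift c a q y j s : qpoly c a q (shift y j s) =
  qpoly c a q y + s * (a j + \sum_i q i j * y i + \sum_i q j i * y i) + s ^+ 2 * q j j.
Proof.
rewrite /qpoly.
have -> : \sum_i a i * shift y j s i = \sum_i a i * y i + a j * s.
  by under eq_bigr do rewrite /shift mulrDr; rewrite big_split/= sum_delta.
have -> : \sum_i \sum_k q i k * shift y j s i * shift y j s k =
    \sum_i \sum_k q i k * y i * y k + (\sum_i q i j * y i) * s
    + (\sum_k q j k * y k) * s + q j j * s * s.
  transitivity (\sum_i (\sum_k q i k * y i * y k + q i j * y i * s +
     (\sum_k q i k * y k) * (s * (i == j)%:R) + (q i j * s) * (s * (i == j)%:R))).
    apply: eq_bigr => i _.
    transitivity (\sum_k (q i k * y i * y k + (q i k * y i) * (s * (k == j)%:R)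
       + q i k * y k * (s * (i == j)%:R) + (q i k * (s * (i == j)%:R)) * (s * (k == j)%:R))).
      by apply: eq_bigr => k _; rewrite /shift; ring.
    rewrite !big_split/= !sum_delta mulr_suml; congr (_ + _ ); ring.
  by rewrite !big_split/= !sum_delta -mulr_suml.
ring.
Qed.

(** Averaging over a sign cancels the terms that are odd in the step, the mixed
    second-order terms included. *)
Lemma rad_qpoly h j c a q : rad h j (qpoly c a q) = qpoly (c + h ^+ 2 * q j j) a q.
Proof.
by apply/funext => y; rewrite /rad !qpoly_shift /qpoly; field.
Qed.

Lemma rads_qpoly h js c a q :
  rads h js (qpoly c a q) = qpoly (c + h ^+ 2 * \sum_(j <- js) q j j) a q.
Proof.
elim: js => [|j js /= ->]; first by rewrite big_nil mulr0 addr0.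
by rewrite rad_qpoly big_cons; congr qpoly; ring.
Qed.

(** One block of steps explores only a bounded neighbourhood of the base point,
    where the expansion is available. *)
Lemma rads_local h js f g x y e : 0 <= h ->
  (forall z, n1 z <= n1 y + h * (size js)%:R -> `|f (fun i => x i + z i) - g z| <= e) ->
  `|rads h js f (fun i => x i + y i) - rads h js g y| <= e.
Proof.
move=> h0; elim: js y => [|j js IH] y H /=.
  by apply: H; rewrite mulr0 addr0.
have sh s : shift (fun i => x i + y i) j s = (fun i => x i + shift y j s i).
  by apply/funext => i; rewrite /shift addrA.
have I s : `|s| = h -> `|rads h js f (fun i => x i + shift y j s i) - rads h js g (shift y j s)| <= e.
  move=> hs; apply: IH => z hz; apply: H; apply: le_trans hz _.
  by rewrite -natr1 mulrDr mulr1 addrA [leRHS]addrAC lerD2r -hs n1_shift.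
rewrite /rad !sh.
have := I h (ger0_norm h0); have := I (- h); rewrite normrN ger0_norm// => /(_ erefl).
rewrite !ler_norml => /andP[? ?] /andP[? ?]; apply/andP; split; lra.
Qed.

End Jets.

Section JetAlgebra.
Context {R : realType} {J : finType}.
Implicit Types (f g : (J -> R) -> R) (x z : J -> R).

Lemma linear_bound (C : R) (a : J -> R) z : (forall i, `|a i| <= C) ->
  `|\sum_i a i * z i| <= C * n1 z.
Proof.
move=> aC; apply: le_trans (ler_norm_sum _ _ _) _.
by rewrite mulr_sumr; apply: ler_sum => i _; rewrite normrM ler_wpM2r.
Qed.

Lemma quadratic_bound (C : R) (q : J -> J -> R) z : (forall i j, `|q i j| <= C) ->
  `|\sum_i \sum_j q i j * z i * z j| <= C * n1 z ^+ 2.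
Proof.
move=> qC.
rewrite (_ : \sum_i _ = \sum_i (\sum_j q i j * z j) * z i); last first.
  by apply: eq_bigr => i _; rewrite mulr_suml; apply: eq_bigr => j _; rewrite mulrAC.
by rewrite expr2 mulrA; apply: linear_bound => i; exact: linear_bound.
Qed.

Lemma qpoly_mul (c c' : R) (a a' : J -> R) (q q' : J -> J -> R) z :
  let L := \sum_i a i * z i in let L' := \sum_i a' i * z i in
  let Q := \sum_i \sum_j q i j * z i * z j in
  let Q' := \sum_i \sum_j q' i j * z i * z j in
  qpoly (c * c') (fun i => c * a' i + c' * a i)
    (fun i j => c * q' i j + c' * q i j + a i * a' j) z =
  c * c' + (c * L' + c' * L) + (c * Q' + c' * Q + L * L').
Proof.
move=> L L' Q Q'; rewrite /qpoly; congr (_ + _ + _).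
  rewrite /L /L' !mulr_sumr -big_split/=; apply: eq_bigr => i _; ring.
rewrite /Q /Q' /L mulr_suml !mulr_sumr -!big_split/=; apply: eq_bigr => i _.
rewrite /L' !mulr_sumr -!big_split/=; apply: eq_bigr => j _; ring.
Qed.

Lemma qpoly0 c a q : qpoly c a q (fun _ : J => 0 : R) = c.
Proof.
rewrite /qpoly !big1 ?addr0// => i _; last by rewrite mulr0.
by apply: big1 => k _; rewrite mulr0.
Qed.

Lemma jet_mul (C : R) f g x c a q c' a' q' : 1 <= C -> jet C f x c a q -> jet C g x c' a' q' ->
  jet (10 * C ^+ 2) (fun x => f x * g x) x (c * c') (fun i => c * a' i + c' * a i)
    (fun i j => c * q' i j + c' * q i j + a i * a' j).
Proof.
move=> C1 [c0 a0 q0 f0] [c0' a0' q0' g0].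
have C0 : 0 <= C by lra.
have M (u v : R) : `|u| <= C -> `|v| <= C -> `|u * v| <= C ^+ 2.
  by move=> ? ?; rewrite normrM expr2 ler_pM.
have C20 : 0 <= C ^+ 2 by exact: sqr_ge0.
split.
- by apply: le_trans (M _ _ c0 c0') _; lra.
- move=> i; apply: le_trans (ler_normD _ _) _.
  by have := M _ _ c0 (a0' i); have := M _ _ c0' (a0 i); lra.
- move=> i j; apply: le_trans (ler_normD _ _) _; apply: le_trans (lerD (ler_normD _ _) (lexx _)) _.
  by have := M _ _ c0 (q0' i j); have := M _ _ c0' (q0 i j); have := M _ _ (a0 i) (a0' j); lra.
move=> z z1; rewrite qpoly_mul.
have := f0 z z1; have := g0 z z1.
set n := n1 z; set e := f _ - _; set e' := g _ - _ => he' he.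
have n0 : 0 <= n by exact: n1_ge0.
set L := \sum_i a i * z i; set L' := \sum_i a' i * z i.
set Q := \sum_i \sum_j q i j * z i * z j; set Q' := \sum_i \sum_j q' i j * z i * z j.
have hL : `|L| <= C * n by exact: linear_bound.
have hL' : `|L'| <= C * n by exact: linear_bound.
have hQ : `|Q| <= C * n ^+ 2 by exact: quadratic_bound.
have hQ' : `|Q'| <= C * n ^+ 2 by exact: quadratic_bound.
rewrite (_ : _ - _ = L * Q' + Q * L' + Q * Q' + e * (c' + L' + Q' + e') + e' * (c + L + Q)); last first.
  by rewrite /e /e' /qpoly -/L -/L' -/Q -/Q'; ring.
have n2 : n ^+ 2 <= 1 by rewrite exprn_ile1.
have n3 : n ^+ 3 <= 1 by rewrite exprn_ile1.
have n20 : 0 <= n ^+ 2 by rewrite exprn_ge0.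
have n30 : 0 <= n ^+ 3 by rewrite exprn_ge0.
have B1 : `|L * Q'| <= C ^+ 2 * n ^+ 3.
  by rewrite normrM (_ : C ^+ 2 * n ^+ 3 = (C * n) * (C * n ^+ 2)) ?ler_pM//; ring.
have B2 : `|Q * L'| <= C ^+ 2 * n ^+ 3.
  by rewrite normrM (_ : C ^+ 2 * n ^+ 3 = (C * n ^+ 2) * (C * n)) ?ler_pM//; ring.
have CnC : C * n <= C by rewrite ler_piMr.
have CnC2 : C * n ^+ 2 <= C by rewrite ler_piMr.
have CnC3 : C * n ^+ 3 <= C by rewrite ler_piMr.
have B3 : `|Q * Q'| <= C ^+ 2 * n ^+ 3.
  rewrite normrM (_ : C ^+ 2 * n ^+ 3 = (C * n ^+ 2) * (C * n)); last by ring.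
  rewrite ler_pM//; apply: le_trans hQ' _.
  by rewrite ler_wpM2l// expr2 ler_piMr.
have B4 : `|e * (c' + L' + Q' + e')| <= (C * n ^+ 3) * (4 * C).
  rewrite normrM ler_pM//; apply: le_trans (ler_normD _ _) _.
  apply: le_trans (lerD (ler_normD _ _) (lexx _)) _.
  apply: le_trans (lerD (lerD (ler_normD _ _) (lexx _)) (lexx _)) _; lra.
have B5 : `|e' * (c + L + Q)| <= (C * n ^+ 3) * (3 * C).
  rewrite normrM ler_pM//; apply: le_trans (ler_normD _ _) _.
  apply: le_trans (lerD (ler_normD _ _) (lexx _)) _; lra.
apply: (@le_trans _ _ (`|L * Q'| + `|Q * L'| + `|Q * Q'| + `|e * (c' + L' + Q' + e')| + `|e' * (c + L + Q)|)).
  do 3 apply: le_trans (ler_normD _ _) (lerD _ (lexx _)).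
  exact: ler_normD.
rewrite (_ : 10 * C ^+ 2 * n ^+ 3 = C ^+ 2 * n ^+ 3 + C ^+ 2 * n ^+ 3 + C ^+ 2 * n ^+ 3
  + C * n ^+ 3 * (4 * C) + C * n ^+ 3 * (3 * C)); last by ring.
by do 4 (apply: lerD => //).
Qed.

Lemma jet_le (C D : R) f x c a q : C <= D -> jet C f x c a q -> jet D f x c a q.
Proof.
move=> CD [h0 h1 h2 h3]; split.
- exact: le_trans CD.
- by move=> i; exact: le_trans CD.
- by move=> i j; exact: le_trans CD.
- by move=> z z1; apply: le_trans (h3 z z1) _; rewrite ler_wpM2r// exprn_ge0// n1_ge0.
Qed.

Definition ujet f (c : (J -> R) -> R) (a : (J -> R) -> J -> R)
    (q : (J -> R) -> J -> J -> R) : Prop :=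
  exists C : R, 1 <= C /\ forall x, jet C f x (c x) (a x) (q x).

Lemma ujet_mul f g c a q c' a' q' : ujet f c a q -> ujet g c' a' q' ->
  ujet (fun x => f x * g x) (fun x => c x * c' x)
    (fun x i => c x * a' x i + c' x * a x i)
    (fun x i j => c x * q' x i j + c' x * q x i j + a x i * a' x j).
Proof.
move=> [C [C1 H]] [C' [C1' H']]; exists (10 * (Num.max C C') ^+ 2).
have m1 : 1 <= Num.max C C' by rewrite le_max C1.
split; first by have := ler_pM ler01 ler01 m1 m1; rewrite -expr2; lra.
move=> x; apply: jet_mul => //; [apply: jet_le (H x)|apply: jet_le (H' x)].
  by rewrite le_max lexx.
by rewrite le_max lexx orbT.
Qed.

Lemma ujet1 : ujet (fun=> 1) (fun=> 1) (fun _ _ => 0) (fun _ _ _ => 0).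
Proof.
exists 1; split => // x; split; rewrite ?normr1 ?normr0// => z z1; rewrite ?normr0//.
rewrite /qpoly !big1 ?addr0 ?subrr ?normr0 ?mul1r ?exprn_ge0 ?n1_ge0// => i _.
  by apply: big1 => j _; rewrite !mul0r.
by rewrite mul0r.
Qed.

Variables JX JY : seq J.

Definition trace_gap (q : J -> J -> R) : R := \sum_(i <- JX) q i i - \sum_(i <- JY) q i i.

Lemma trace_gap_eq (q q' : J -> J -> R) : (forall i, q i i = q' i i) -> trace_gap q = trace_gap q'.
Proof. by move=> qq; rewrite /trace_gap; congr (_ - _); apply: eq_bigr => i _. Qed.

Lemma trace_gapZ (k : R) (q : J -> J -> R) : trace_gap (fun i j => k * q i j) = k * trace_gap q.
Proof. by rewrite /trace_gap mulrBr !mulr_sumr. Qed.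

Lemma trace_gapD (q q' : J -> J -> R) :
  trace_gap (fun i j => q i j + q' i j) = trace_gap q + trace_gap q'.
Proof. by rewrite /trace_gap !big_split/= opprD addrACA. Qed.

(** In the jet of a product the cross terms pair the gradients of two different
    factors. The induction therefore carries the sign condition for the pairs
    made of the partial product and a further factor. *)
Lemma prod_ujet (I : eqType) (us : seq I) (F : I -> (J -> R) -> R) c a q :
  (forall u, u \in us -> ujet (F u) (c u) (a u) (q u)) ->
  (forall u x, u \in us -> 0 <= c u x) ->
  (forall u v x, u \in us -> v \in us -> 0 <= trace_gap (fun i j => a u x i * a v x j)) ->
  (forall u x, u \in us -> 0 <= trace_gap (q u x)) ->
  exists c' a' q', [/\ ujet (fun x => \prod_(u <- us) F u x) c' a' q',
    (forall x, 0 <= c' x),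
    (forall v x, v \in us -> 0 <= trace_gap (fun i j => a' x i * a v x j)) &
    forall x, 0 <= trace_gap (q' x)].
Proof.
move=> uF c0 aa q0.
suff H vs : {subset vs <= us} ->
  exists c' a' q', [/\ ujet (fun x => \prod_(u <- vs) F u x) c' a' q',
    (forall x, 0 <= c' x),
    (forall v x, v \in us -> 0 <= trace_gap (fun i j => a' x i * a v x j)) &
    forall x, 0 <= trace_gap (q' x)] by exact: H.
elim: vs => [|v vs IH] sub.
  exists (fun=> 1), (fun _ _ => 0), (fun _ _ _ => 0); split => //.
  - under [X in ujet X]eq_fun do rewrite big_nil; exact: ujet1.
  - by move=> v x _; rewrite /trace_gap !big1 ?subrr// => i _; rewrite mul0r.
  - by move=> x; rewrite /trace_gap !big1 ?subrr.
have [|c' [a' [q' [u' c0' a0' q0']]]] := IH.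
  by move=> w wvs; apply: sub; rewrite inE wvs orbT.
have vus : v \in us by apply: sub; rewrite inE eqxx.
exists (fun x => c v x * c' x), (fun x i => c v x * a' x i + c' x * a v x i),
  (fun x i j => c v x * q' x i j + c' x * q v x i j + a v x i * a' x j); split.
- under [X in ujet X]eq_fun do rewrite big_cons; apply: ujet_mul => //; exact: uF.
- by move=> x; rewrite mulr_ge0// c0.
- move=> w x wus.
  rewrite (_ : trace_gap _ = c v x * trace_gap (fun i j => a' x i * a w x j) +
      c' x * trace_gap (fun i j => a v x i * a w x j)).
    by rewrite addr_ge0// mulr_ge0// ?c0 ?a0' ?aa.
  by rewrite -!trace_gapZ -trace_gapD; apply: trace_gap_eq => i; ring.
- move=> x.
  rewrite (_ : trace_gap _ = c v x * trace_gap (q' x) + c' x * trace_gap (q v x) +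
      trace_gap (fun i j => a' x i * a v x j)).
    apply: addr_ge0; last exact: a0'.
    by apply: addr_ge0; apply: mulr_ge0; [exact: c0|exact: q0'|exact: c0'|exact: q0].
  by rewrite -!trace_gapZ -!trace_gapD; apply: trace_gap_eq => i; ring.
Qed.

Lemma jet_stepping M f c a q : natm f -> (forall x, `|f x| <= M) -> ujet f c a q ->
  exists2 C, 0 <= C & stepping C M f.
Proof.
move=> nf fM [C [C1 H]].
have [K K0 HK] := @gauss_rademacher_step R.
have M0 : 0 <= M by exact: le_trans (fM (fun=> 0)).
exists (K * (M + 3 * C)); first by rewrite mulr_ge0// addr_ge0//; lra.
split => // j h x h0.
have := HK (fun s => f (shift x j s)) (c x) (a x j) (q x j j) (M + 3 * C) h M.
apply => //; [exact: natm_line|lra|move=> s].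
have [hc ha hq he] := H x.
pose z := shift (fun _ : J => 0 : R) j s.
have zE : n1 z = `|s|.
  rewrite /n1 /z /shift (bigD1 j)//= eqxx mulr1 /= add0r big1 ?addr0// => i /negbTE ->.
  by rewrite mulr0 addr0 normr0.
have E : shift x j s = (fun i => x i + z i).
  by apply/funext => i; rewrite /z /shift add0r.
have Eq : qpoly (c x) (a x) (q x) z = c x + a x j * s + q x j j * s ^+ 2.
  rewrite /z qpoly_shift /qpoly !big1.
  - by ring.
  - by move=> i _; rewrite mulr0.
  - by move=> i _; rewrite mulr0.
  - by move=> i _; apply: big1 => k _; rewrite mulr0.
  - by move=> i _; rewrite mulr0.
case: (lerP `|s| 1) => s1.
  rewrite E -Eq; apply: le_trans (he z _) _; rewrite ?zE// ler_wpM2r ?exprn_ge0//; lra.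
set t := `|s| in s1 *.
have t3 : 1 <= t ^+ 3 by rewrite exprn_ege1// ltW.
have t13 : t <= t ^+ 3 by rewrite -{1}(expr1 t) ler_weXn2l// ltW.
have t23 : t ^+ 2 <= t ^+ 3 by rewrite ler_weXn2l// ltW.
apply: le_trans (ler_normB _ _) _.
have b1 : `|a x j * s| <= C * t ^+ 3 by rewrite normrM ler_pM.
have b2 : `|q x j j * s ^+ 2| <= C * t ^+ 3 by rewrite normrM normrX ler_pM.
have b0 : `|c x| <= C * t ^+ 3 by apply: le_trans hc _; rewrite ler_peMr//; lra.
have bM : `|f (shift x j s)| <= M * t ^+ 3 by apply: le_trans (fM _) _; rewrite ler_peMr.
have := ler_normD (c x + a x j * s) (q x j j * s ^+ 2).
have := ler_normD (c x) (a x j * s).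
rewrite mulrDl; lra.
Qed.

End JetAlgebra.

Section Comparison.
Context {R : realType} {d : measure_display} {T : measurableType d}.
Variable P : probability T R.
Context {J : finType}.
Variable X : J -> {RV P >-> R}.

(** Both expectations are limits of walks with [k] random-sign steps of size
    [1 / sqrt k] in every coordinate. Trading one block of steps over [JY] for
    one over [JX] gains the trace gap and loses [O(k^(-3/2))], and [k] such
    trades are made. *)
Theorem gauss_comparison (JX JY : seq J) (M : R) (f : (J -> R) -> R) c a q :
  uniq JX -> uniq JY -> indep_on JX X -> indep_on JY X ->
  (forall j B, measurable B -> P (X j @^-1` B) = normal_prob 0 1 B) ->
  natm f -> (forall x, `|f x| <= M) -> ujet f c a q ->
  (forall x, 0 <= trace_gap JX JY (q x)) ->
  EP P (fun w => f (partial_family X JY w)) <= EP P (fun w => f (partial_family X JX w)).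
Proof.
move=> uX uY iX iY law nf fM uf gap.
have [C C0 sf] := jet_stepping nf fM uf.
have [D [D1 jD]] := uf.
set EY := EP P _; set EX := EP P _.
pose m := (size JX + size JY).+1.
pose K : R := (size JX)%:R * C + (size JY)%:R * C + 2 * D * m%:R ^+ 3.
have K0 : 0 <= K by rewrite !addr_ge0// !mulr_ge0//; lra.
have main n : (m <= n)%N -> EY - EX <= K / n%:R.
  move=> mn.
  have n0 : 0 < n%:R :> R by rewrite ltr0n; apply: leq_trans mn.
  have h0 : 0 < n%:R^-1 :> R by rewrite invr_gt0.
  have hk : n%:R^-1 * Num.sqrt (n ^ 2)%:R = 1 :> R.
    by rewrite natrX sqrtr_sqr ger0_norm ?ltW// mulVf// gt_eqF.
  have HX := gauss_to_rademacher uX iX (fun j B _ => law j B) sf h0 hk.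
  have HY := gauss_to_rademacher uY iY (fun j B _ => law j B) sf h0 hk.
  have mh : n%:R^-1 * m%:R <= 1 :> R by rewrite mulrC ler_pdivrMr// mul1r ler_nat.
  pose e : R := 2 * (D * (n%:R^-1 * m%:R) ^+ 3).
  have step y : rads n%:R^-1 JY f y - e <= rads n%:R^-1 JX f y.
    have [j0 j1 j2 je] := jD y.
    have loc js : (size js <= m)%N ->
        `|rads n%:R^-1 js f y - (c y + n%:R^-1 ^+ 2 * \sum_(j <- js) q y j j)|
           <= D * (n%:R^-1 * m%:R) ^+ 3.
      move=> jm.
      have y0 : y = (fun i => y i + (fun=> 0) i) by apply/funext => i; rewrite addr0.
      have := @rads_local _ _ n%:R^-1 js f (qpoly (c y) (a y) (q y)) y (fun=> 0)
        (D * (n%:R^-1 * m%:R) ^+ 3) (ltW h0).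
      rewrite -y0 rads_qpoly [X in _ - X](_ : _ = c y + n%:R^-1 ^+ 2 * \sum_(j <- js) q y j j); last first.
        exact: qpoly0.
      apply; move=> z; rewrite {2}/n1 big1; last by move=> i _; rewrite normr0.
      rewrite add0r => hz.
      have hz' : n1 z <= n%:R^-1 * m%:R.
        by apply: le_trans hz _; rewrite ler_wpM2l ?(ltW h0)// ler_nat.
      apply: le_trans (je z (le_trans hz' mh)) _.
      rewrite ler_wpM2l//; first lra.
      by rewrite lerXn2r// nnegrE ?n1_ge0// mulr_ge0// ltW.
    have hX := loc JX (leq_trans (leq_addr _ _) (leqnSn _)).
    have hY := loc JY (leq_trans (leq_addl _ _) (leqnSn _)).
    have := gap y; rewrite /trace_gap subr_ge0 => g.
    have : n%:R^-1 ^+ 2 * \sum_(j <- JY) q y j j <= n%:R^-1 ^+ 2 * \sum_(j <- JX) q y j j.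
      by rewrite ler_wpM2l// sqr_ge0.
    move: hX hY; rewrite !ler_norml /e => /andP[? ?] /andP[? ?]; lra.
  have := @iter_rads_compare _ _ n%:R^-1 JX JY f e (n ^ 2) (fun=> 0) step.
  move: HX HY; rewrite -/EX -/EY !ler_norml.
  have nn : (n ^ 2)%:R * n%:R^-1 ^+ 3 = n%:R^-1 :> R.
    by rewrite natrX; field; rewrite gt_eqF.
  have -> : (n ^ 2)%:R * C * n%:R^-1 ^+ 3 = C * n%:R^-1.
    by rewrite mulrAC nn mulrC.
  have -> : (n ^ 2)%:R * e = 2 * D * m%:R ^+ 3 * n%:R^-1.
    by rewrite -[in RHS]nn /e exprMn; ring.
  have -> : K / n%:R = (size JX)%:R * (C / n%:R) + (size JY)%:R * (C / n%:R) + 2 * D * m%:R ^+ 3 / n%:R.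
    by rewrite /K; ring.
  move=> /andP[? ?] /andP[? ?]; lra.
rewrite leNgt; apply/negP => lt; have d0 : 0 < EY - EX by rewrite subr_gt0.
pose n := maxn m (Num.bound (K / (EY - EX))).
have := main n (leq_maxl _ _).
have n0 : 0 < n%:R :> R by rewrite ltr0n; apply: leq_trans (leq_maxl _ _).
rewrite ler_pdivlMr// leNgt => /negP; apply.
rewrite mulrC -ltr_pdivrMr//; apply: lt_le_trans (archi_boundP _) _.
  by rewrite divr_ge0// ltW.
by rewrite ler_nat leq_maxr.
Qed.

End Comparison.

(** * Smooth functions of the process *)

Section Taylor.
Context {R : realType}.
Implicit Types (f g : R -> R).

Lemma mean_value_bound g dg (K s : R) : (forall y, is_derive y (1:R) g (dg y)) ->
  (forall y, `|y| <= `|s| -> `|dg y| <= K) -> `|g s - g 0| <= K * `|s|.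
Proof.
move=> gd dK.
have cg : continuous g.
  by move=> y; apply/differentiable_continuous/derivable1_diffP; case: (gd y).
case: (lerP 0 s) => s0.
  have [c] := MVT_segment s0 (fun y _ => gd y) (continuous_subspaceT cg).
  rewrite in_itv/= => /andP[c0 cs] ->; rewrite subr0 normrM ler_wpM2r// dK//.
  by rewrite !ger0_norm.
have [c] := MVT_segment (ltW s0) (fun y _ => gd y) (continuous_subspaceT cg).
rewrite in_itv/= => /andP[c0 cs]; rewrite distrC => ->; rewrite sub0r normrM normrN ler_wpM2r// dK//.
by rewrite !ler0_norm ?lerN2// ltW.
Qed.

Lemma taylor_cubic f f1 f2 f3 (B t s : R) :
  (forall y, is_derive y (1:R) f (f1 y)) -> (forall y, is_derive y (1:R) f1 (f2 y)) ->
  (forall y, is_derive y (1:R) f2 (f3 y)) -> (forall y, `|f3 y| <= B) ->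
  `|f (t + s) - (f t + f1 t * s + f2 t / 2 * s ^+ 2)| <= B * `|s| ^+ 3.
Proof.
move=> d1 d2 d3 b3.
have dt (g dg : R -> R) (y : R) : (forall y, is_derive y (1:R) g (dg y)) ->
    is_derive y (1:R) (fun y => g (t + y)) (dg (t + y)).
  move=> H; have D : is_derive y (1:R) (fun y => t + y) 1.
    by apply: is_derive_eq; rewrite add0r mulr1.
  have := @is_derive1_comp R g (fun y => t + y) y _ _ (H _) D.
  by rewrite mulr1.
have B0 : 0 <= B by exact: le_trans (b3 0).
have r2 y : `|f2 (t + y) - f2 t| <= B * `|y|.
  have := @mean_value_bound (fun y => f2 (t + y)) _ B y (fun y => dt _ _ y d3) (fun y _ => b3 _).
  by rewrite addr0.
have r1 y : `|f1 (t + y) - (f1 t + f2 t * y)| <= B * `|y| ^+ 2.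
  pose g (y : R) := f1 (t + y) + (- f2 t) * y.
  have dg z : is_derive z (1:R) g (f2 (t + z) - f2 t).
    have H := dt _ _ z d2; rewrite /g.
    by apply: is_derive_eq; rewrite /GRing.scale /=; ring.
  have := @mean_value_bound g _ (B * `|y|) y dg.
  rewrite /g mulr0 !addr0 (_ : _ - _ = f1 (t + y) - (f1 t + f2 t * y)); last by ring.
  have -> : B * `|y| ^+ 2 = B * `|y| * `|y| by ring.
  by apply; move=> z zy; apply: le_trans (r2 z) _; exact: ler_wpM2l.
pose g (y : R) := f (t + y) + (- f1 t) * y + (- (f2 t / 2)) * y ^+ 2.
have dg z : is_derive z (1:R) g (f1 (t + z) - (f1 t + f2 t * z)).
  have H := dt _ _ z d1; rewrite /g.
  by apply: is_derive_eq; rewrite /GRing.scale /=; field.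
have := @mean_value_bound g _ (B * `|s| ^+ 2) s dg.
rewrite /g mulr0 expr0n mulr0 !addr0.
rewrite (_ : _ - _ = f (t + s) - (f t + f1 t * s + f2 t / 2 * s ^+ 2)); last by ring.
have -> : B * `|s| ^+ 3 = B * `|s| ^+ 2 * `|s| by ring.
apply; move=> z zy; apply: le_trans (r1 z) _; apply: ler_wpM2l => //.
by rewrite lerXn2r.
Qed.

Definition logistic (t : R) : R := (1 + expR (- t))^-1.

Lemma logistic_gt0 t : 0 < logistic t.
Proof. by rewrite invr_gt0 addr_gt0// expR_gt0. Qed.

Lemma logistic_lt1 t : logistic t < 1.
Proof. by rewrite invf_lt1 ?addr_gt0 ?expR_gt0// ltrDl expR_gt0. Qed.

Lemma logistic_hi t : 0 < t -> 1 - logistic t <= t^-1.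
Proof.
move=> t0; have e0 := expR_gt0 (- t); have E := expR_ge1Dx t.
have et : expR (- t) * expR t = 1 by rewrite -expRD addNr expR0.
have : expR (- t) <= t^-1 by rewrite expRN lef_pV2 ?posrE ?expR_gt0//; lra.
apply: le_trans; rewrite /logistic.
have -> : 1 - (1 + expR (- t))^-1 = expR (- t) * (1 + expR (- t))^-1.
  by field; rewrite gt_eqF// addr_gt0.
by rewrite ler_piMr ?ltW// invf_lt1 ?addr_gt0//; lra.
Qed.

Lemma logistic_lo t : 0 < t -> logistic (- t) <= t^-1.
Proof.
move=> t0; have -> : logistic (- t) = 1 - logistic t.
  rewrite /logistic opprK expRN; have := expR_gt0 t => e0.
  by field; rewrite !gt_eqF// addr_gt0.
exact: logistic_hi.
Qed.

Lemma is_derive_logistic t : is_derive t (1:R) logistic (logistic t * (1 - logistic t)).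
Proof.
have D : is_derive t (1:R) (fun t => 1 + expR (- t)) (- expR (- t)).
  have D0 := @is_derive1_comp R expR -%R t _ _ (is_derive_expR (- t)) (is_deriveNid t 1).
  rewrite (_ : (fun t => _) = cst 1 \+ (expR \o -%R))//.
  by apply: is_derive_eq; rewrite add0r mulrN1.
have n0 : 1 + expR (- t) != 0 by rewrite gt_eqF// addr_gt0// expR_gt0.
have DV := @is_deriveV R (fun t => 1 + expR (- t)) t _ _ n0 D.
apply: (is_derive_eq DV).
by rewrite /logistic /GRing.scale /=; field.
Qed.

Lemma logistic_taylor (t s : R) :
  let l := logistic t in
  `|logistic (t + s) - (l + l * (1 - l) * s + l * (1 - l) * (1 - 2 * l) / 2 * s ^+ 2)|
    <= `|s| ^+ 3.
Proof.
pose l1 (y : R) := logistic y * (1 - logistic y).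
pose l2 (y : R) := logistic y * (1 - logistic y) * (1 - 2 * logistic y).
pose l3 (y : R) := l2 y * (1 - 2 * logistic y) - 2 * l1 y ^+ 2.
have D0 y := is_derive_logistic y.
have D1 y : is_derive y (1:R) l1 (l2 y).
  have H := D0 y; rewrite /l1.
  by apply: is_derive_eq; rewrite /GRing.scale /= /l2; ring.
have D2 y : is_derive y (1:R) l2 (l3 y).
  have H := D1 y; have H0 := D0 y; rewrite /l2.
  by apply: is_derive_eq; rewrite /GRing.scale /= /l3 /l2 /l1; ring.
have b3 y : `|l3 y| <= 1.
  have := logistic_gt0 y; have := logistic_lt1 y; rewrite /l3 /l2 /l1.
  set l := logistic y => h1 h0.
  have p : 0 <= l * (1 - l) by rewrite mulr_ge0//; lra.
  have p4 : l * (1 - l) <= 1 / 4 by have := sqr_ge0 (l - 1 / 2); nra.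
  rewrite ler_norml; apply/andP; split; nra.
rewrite /=; have := taylor_cubic t s D0 D1 D2 b3; rewrite mul1r; exact.
Qed.

End Taylor.

Section SqrtJet.
Context {R : realType}.

(** Second-order expansion of a square root, algebraically: with [D = N' - N],
    the relation [D ^+ 2 + 2 N D = 2 B + E] determines [D] up to cubic order. *)
Lemma sqrt_expand (N N' B E r : R) : 1 <= N -> 1 <= N' -> 0 <= r ->
  N' ^+ 2 = N ^+ 2 + 2 * B + E -> `|B| <= N * r -> 0 <= E -> E <= r ^+ 2 ->
  `|N' - N - (B / N + E / (2 * N) - B ^+ 2 / (2 * N ^+ 3))|
    <= r ^+ 3 * ((2 + r) ^+ 2 + 1) * (3 + r).
Proof.
move=> N1 N1' r0 NN BN E0 Er.
have N0 : 0 < N by lra.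
pose D := N' - N; pose b := B / N.
have bE : B = b * N by rewrite /b divfK// gt_eqF.
have br : `|b| <= r by rewrite /b normrM normfV (gtr0_norm N0) ler_pdivrMr// mulrC.
have DE : D ^+ 2 + 2 * N * D = 2 * B + E.
  have e0 : 2 * B + E = N' ^+ 2 - N ^+ 2 by rewrite NN; ring.
  by rewrite e0 /D; ring.
have Dr : `|D| <= 2 * r + r ^+ 2.
  have D1 : D * (N' + N) = 2 * B + E by rewrite -DE /D; ring.
  have NN0 : 0 < N' + N by lra.
  rewrite -(ler_pM2r NN0) -{1}(gtr0_norm NN0) -normrM D1.
  apply: le_trans (ler_normD _ _) _; rewrite normrM (ger0_norm E0) (ger0_norm (ler0n _ 2)).
  have r20 : 0 <= r ^+ 2 by exact: sqr_ge0.
  nra.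
have P : N' - N - (B / N + E / (2 * N) - B ^+ 2 / (2 * N ^+ 3)) = (b - D) * (b + D) / (2 * N).
  have e : E = D ^+ 2 + 2 * N * D - 2 * B by lra.
  by rewrite e -/D bE; field; rewrite gt_eqF.
have bD : b - D = (D ^+ 2 - E) / (2 * N).
  have e : E = D ^+ 2 + 2 * N * D - 2 * B by lra.
  by rewrite e bE; field; rewrite gt_eqF.
have iN : `|(2 * N)^-1| <= 2^-1.
  by rewrite gtr0_norm ?invr_gt0 ?mulr_gt0// lef_pV2 ?posrE ?mulr_gt0//; lra.
have D2 : D ^+ 2 <= (2 * r + r ^+ 2) ^+ 2.
  by rewrite -(real_normK (num_real D)) lerXn2r// nnegrE; nra.
have bD' : `|b - D| <= ((2 * r + r ^+ 2) ^+ 2 + r ^+ 2) * 2^-1.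
  rewrite bD normrM ler_pM//; apply: le_trans (ler_normB _ _) _.
  by rewrite ger0_norm ?sqr_ge0// ger0_norm// lerD.
have bD'' : `|b + D| <= 3 * r + r ^+ 2.
  by apply: le_trans (ler_normD _ _) _; lra.
rewrite P normrM normrM.
apply: (@le_trans _ _ (((2 * r + r ^+ 2) ^+ 2 + r ^+ 2) * 2^-1 * (3 * r + r ^+ 2) * 2^-1)).
  by do 2 apply: ler_pM => //.
have -> : ((2 * r + r ^+ 2) ^+ 2 + r ^+ 2) * 2^-1 * (3 * r + r ^+ 2) * 2^-1
  = r ^+ 3 * ((2 + r) ^+ 2 + 1) * (3 + r) / 4 by field.
rewrite ler_pdivrMr// ler_peMr//; last lra.
rewrite !mulr_ge0// ?exprn_ge0//; last lra.
by rewrite addr_ge0 ?sqr_ge0.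
Qed.

Context {J : finType}.

(** The logistic function has three bounded derivatives, so the cubic remainder
    survives composition. *)
Lemma ujet_logistic (y : (J -> R) -> R) (a : (J -> R) -> J -> R)
    (q : (J -> R) -> J -> J -> R) (C b a0 : R) : 1 <= C -> 0 < b ->
  (forall x i, `|a x i| <= C) -> (forall x i j, `|q x i j| <= C) ->
  (forall x z, n1 z <= 1 ->
    `|y (fun i => x i + z i) - y x - (\sum_i a x i * z i + \sum_i \sum_j q x i j * z i * z j)|
      <= C * n1 z ^+ 3) ->
  let l x := logistic (b * (y x - a0)) in
  let l1 x := l x * (1 - l x) in
  let l2 x := l x * (1 - l x) * (1 - 2 * l x) in
  ujet (fun x => logistic (b * (y x - a0))) l (fun x i => l1 x * b * a x i)
    (fun x i j => l1 x * b * q x i j + l2 x / 2 * b ^+ 2 * (a x i * a x j)).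
Proof.
move=> C1 b0 aC qC yC l l1 l2.
have lb x : 0 < l x < 1 by rewrite logistic_gt0 logistic_lt1.
have l1b x : 0 <= l1 x <= 1.
  by have /andP[h1 h2] := lb x; rewrite /l1; apply/andP; split; nra.
have l2b x : `|l2 x| <= 1.
  have /andP[h1 h2] := lb x; have /andP[h3 h4] := l1b x; rewrite /l2 -/(l1 x) normrM (ger0_norm h3).
  rewrite mulr_ile1//; rewrite ler_norml; apply/andP; split; lra.
have C0 : 0 <= C by lra.
have b0' : 0 <= b by lra.
have p1 : 0 <= b * C by rewrite mulr_ge0.
have p2 : 0 <= b ^+ 2 * C ^+ 2 by rewrite mulr_ge0// exprn_ge0.
have p3 : 0 <= b ^+ 3 * C ^+ 3 by rewrite mulr_ge0// exprn_ge0.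
exists (27 * (b ^+ 3 * C ^+ 3) + b * C + 5 * (b ^+ 2 * C ^+ 2) + 1); split; first lra.
move=> x; have /andP[h1 h2] := l1b x; have h3 := l2b x.
have lbC (u v : R) : `|u| <= 1 -> `|v| <= C -> `|u * b * v| <= b * C.
  move=> hu hv; rewrite !normrM (ger0_norm b0') -[leRHS]mul1r -mulrA.
  by rewrite ler_pM// ?ler_pM// mulr_ge0.
split.
- by have /andP[? ?] := lb x; rewrite ger0_norm; lra.
- move=> i; apply: le_trans (lbC _ _ _ (aC x i)) _; first by rewrite ger0_norm.
  lra.
- move=> i j; apply: le_trans (ler_normD _ _) _.
  have e1 : `|l1 x * b * q x i j| <= b * C by apply: lbC => //; rewrite ger0_norm.
  have e2 : `|l2 x / 2 * b ^+ 2 * (a x i * a x j)| <= b ^+ 2 * C ^+ 2.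
    rewrite (_ : _ * _ = l2 x / 2 * (b ^+ 2 * (a x i * a x j))); last by ring.
    rewrite normrM -[leRHS]mul1r ler_pM//.
      by rewrite normrM [X in _ * X]ger0_norm ?invr_ge0//; lra.
    rewrite normrM normrX normrM (ger0_norm b0') ler_wpM2l ?exprn_ge0//.
    by rewrite [leRHS]expr2 ler_pM.
  lra.
move=> z z1; have hz := yC x z z1.
pose dl (x' : J -> R) := y x' - y x.
have jd : jet C dl x 0 (a x) (q x).
  split => //; first by rewrite normr0.
  by move=> z' z1'; rewrite /dl /qpoly add0r; exact: yC.
have [_ _ _ /(_ z z1)] := jet_mul C1 jd jd.
set t := n1 z in hz *; have t0 : 0 <= t by exact: n1_ge0.
rewrite qpoly_mul !mul0r !addr0 !add0r.
set L := \sum_i a x i * z i in hz *; set Q := \sum_i \sum_j q x i j * z i * z j in hz *.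
pose D := dl (fun i => x i + z i); rewrite -/D => hD2.
have hD : `|D - (L + Q)| <= C * t ^+ 3 by exact: hz.
have hL : `|L| <= C * t by exact: linear_bound.
have hQ : `|Q| <= C * t ^+ 2 by exact: quadratic_bound.
have t3 : t ^+ 3 <= t by rewrite -[leRHS]expr1 ler_wiXn2l.
have t2 : t ^+ 2 <= t by rewrite -[leRHS]expr1 ler_wiXn2l.
have DD : `|D| <= 3 * C * t.
  have -> : D = (D - (L + Q)) + L + Q by ring.
  apply: le_trans (ler_normD _ _) _; apply: le_trans (lerD (ler_normD _ _) (lexx _)) _.
  have : C * t ^+ 3 <= C * t by rewrite ler_wpM2l.
  have : C * t ^+ 2 <= C * t by rewrite ler_wpM2l.
  lra.
have := logistic_taylor (b * (y x - a0)) (b * D); rewrite /= -/(l x) -/(l2 x) -/(l1 x).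
have -> : b * (y x - a0) + b * D = b * (y (fun i => x i + z i) - a0) by rewrite /D /dl; ring.
set F := logistic _ => hF.
have bD3 : `|b * D| ^+ 3 <= 27 * (b ^+ 3 * C ^+ 3) * t ^+ 3.
  have -> : 27 * (b ^+ 3 * C ^+ 3) * t ^+ 3 = (b * (3 * C * t)) ^+ 3 by ring.
  rewrite lerXn2r ?nnegrE ?mulr_ge0// normrM (ger0_norm b0') ler_wpM2l//.
have -> : qpoly (l x) (fun i => l1 x * b * a x i)
     (fun i j => l1 x * b * q x i j + l2 x / 2 * b ^+ 2 * (a x i * a x j)) z =
   l x + l1 x * b * (L + Q) + l2 x / 2 * b ^+ 2 * (L * L).
  rewrite /qpoly mulrDr addrA -!addrA; congr (_ + _).
  congr (_ + _); first by rewrite /L mulr_sumr; apply: eq_bigr => i _; ring.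
  rewrite /Q /L mulr_suml !mulr_sumr -big_split/=; apply: eq_bigr => i _.
  rewrite !mulr_sumr -big_split/=; apply: eq_bigr => j _; ring.
have -> : F - (l x + l1 x * b * (L + Q) + l2 x / 2 * b ^+ 2 * (L * L)) =
  (F - (l x + l1 x * (b * D) + l2 x / 2 * (b * D) ^+ 2)) + l1 x * b * (D - (L + Q))
  + l2 x / 2 * b ^+ 2 * (D * D - L * L) by ring.
apply: le_trans (ler_normD _ _) _; apply: le_trans (lerD (ler_normD _ _) (lexx _)) _.
have t30 : 0 <= t ^+ 3 by rewrite exprn_ge0.
have e1 : `|l1 x * b * (D - (L + Q))| <= b * C * t ^+ 3.
  rewrite 2!normrM (ger0_norm h1) (ger0_norm b0').
  have -> : b * C * t ^+ 3 = 1 * (b * (C * t ^+ 3)) by ring.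
  rewrite -[l1 x * b * _]mulrA; apply: ler_pM => //; first by rewrite mulr_ge0.
  by rewrite ler_wpM2l.
have e2 : `|l2 x / 2 * b ^+ 2 * (D * D - L * L)| <= 5 * (b ^+ 2 * C ^+ 2) * t ^+ 3.
  have -> : 5 * (b ^+ 2 * C ^+ 2) * t ^+ 3 = 2^-1 * b ^+ 2 * (10 * C ^+ 2 * t ^+ 3) by field.
  rewrite normrM ler_pM// normrM normrX (ger0_norm b0') ler_wpM2r ?exprn_ge0//.
  by rewrite normrM [X in _ * X]ger0_norm ?invr_ge0//; lra.
have := le_trans hF bD3; lra.
Qed.

End SqrtJet.

Section NormPlusLinear.
Context {R : realType} {J : finType} {n : nat}.
Variables (wc : 'I_n -> J -> R) (rc : J -> R).
Hypothesis wc1 : forall i k, `|wc i k| <= 1.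
Hypothesis rc1 : forall k, `|rc k| <= 1.

Definition wval i (x : J -> R) : R := \sum_k wc i k * x k.
Definition rval (x : J -> R) : R := \sum_k rc k * x k.
(** The constant 1 under the root keeps the norm smooth at the origin. *)
Definition nval (x : J -> R) : R := Num.sqrt (1 + \sum_i wval i x ^+ 2).
Definition yval x := nval x + rval x.

Let bval x k : R := \sum_i wval i x * wc i k.

Definition ygrad x k : R := bval x k / nval x + rc k.
Definition yhess x k l : R :=
  (\sum_i wc i k * wc i l) / (2 * nval x) - bval x k * bval x l / (2 * nval x ^+ 3).

Lemma nval_sq x : nval x ^+ 2 = 1 + \sum_i wval i x ^+ 2.
Proof. by rewrite sqr_sqrtr// addr_ge0// sumr_ge0// => i _; rewrite sqr_ge0. Qed.

Lemma nval_ge1 x : 1 <= nval x.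
Proof.
rewrite -[leLHS]sqrtr1 ler_wsqrtr// lerDl sumr_ge0// => i _; exact: sqr_ge0.
Qed.

Lemma wval_le_nval i x : `|wval i x| <= nval x.
Proof.
rewrite -ler_sqr ?nnegrE ?(le_trans ler01 (nval_ge1 x))// nval_sq real_normK ?num_real//.
rewrite (bigD1 i)//= addrCA lerDl addr_ge0// sumr_ge0// => k _; exact: sqr_ge0.
Qed.

Let bval_le x k : `|bval x k| <= n%:R * nval x.
Proof.
apply: le_trans (ler_norm_sum _ _ _) _.
rewrite -[n in n%:R]card_ord -sumr_const mulr_suml; apply: ler_sum => i _.
by rewrite mul1r normrM -[leRHS]mulr1 ler_pM// wval_le_nval.
Qed.

Lemma ygrad_le x k : `|ygrad x k| <= n%:R + 1.
Proof.
apply: le_trans (ler_normD _ _) _; rewrite lerD// normrM normfV.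
have N1 := nval_ge1 x; rewrite (ger0_norm (le_trans ler01 N1)).
by rewrite ler_pdivrMr ?bval_le// (lt_le_trans ltr01).
Qed.

Lemma yhess_le x k l : `|yhess x k l| <= n%:R + n%:R ^+ 2.
Proof.
have N1 := nval_ge1 x; have N0 : 0 < nval x by exact: lt_le_trans N1.
have n0 : 0 <= n%:R :> R by [].
apply: le_trans (ler_normB _ _) _; apply: lerD.
  rewrite normrM normfV (ger0_norm (_ : 0 <= 2 * nval x)); last by rewrite mulr_ge0// ltW.
  rewrite ler_pdivrMr ?mulr_gt0//; apply: (@le_trans _ _ n%:R); last by rewrite ler_peMr//; lra.
  apply: le_trans (ler_norm_sum _ _ _) _.
  rewrite -[n in n%:R]card_ord -sumr_const; apply: ler_sum => i _.
  by rewrite normrM mulr_ile1.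
have p : 0 < 2 * nval x ^+ 3 by rewrite mulr_gt0// exprn_gt0.
rewrite normrM normfV (ger0_norm (ltW p)) ler_pdivrMr// normrM.
apply: (@le_trans _ _ ((n%:R * nval x) * (n%:R * nval x))); first by rewrite ler_pM.
have -> : n%:R * nval x * (n%:R * nval x) = n%:R ^+ 2 * nval x ^+ 2 by ring.
rewrite ler_wpM2l ?sqr_ge0//.
have : nval x ^+ 2 <= nval x ^+ 3 by rewrite ler_weXn2l.
have : 0 <= nval x ^+ 3 by rewrite exprn_ge0// ltW.
lra.
Qed.

Lemma yval_expand : exists2 C : R, 1 <= C & forall x z, n1 z <= 1 ->
  `|yval (fun i => x i + z i) - yval x - (\sum_i ygrad x i * z i + \sum_i \sum_j yhess x i j * z i * z j)|
      <= C * n1 z ^+ 3.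
Proof.
exists (n%:R ^+ 3 * ((2 + n%:R) ^+ 2 + 1) * (3 + n%:R) + 1).
  by rewrite lerDr !mulr_ge0// ?exprn_ge0// addr_ge0// sqr_ge0.
move=> x z z1; set t := n1 z in z1 *.
have t0 : 0 <= t by exact: n1_ge0.
set x' := fun i => x i + z i.
have wD i : wval i x' = wval i x + wval i z.
  by rewrite /wval -big_split/=; apply: eq_bigr => k _; rewrite mulrDr.
have rD : rval x' = rval x + rval z.
  by rewrite /rval -big_split/=; apply: eq_bigr => k _; rewrite mulrDr.
pose B := \sum_i wval i x * wval i z.
pose E := \sum_i wval i z ^+ 2.
have wz i : `|wval i z| <= t by rewrite -[leRHS]mul1r; exact: linear_bound.
have BE : B = \sum_k bval x k * z k.
  rewrite /B /wval; under eq_bigr do rewrite mulr_sumr.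
  rewrite exchange_big/=; apply: eq_bigr => k _; rewrite /bval mulr_suml.
  by apply: eq_bigr => i _; rewrite mulrA.
have EE : E = \sum_k \sum_l (\sum_i wc i k * wc i l) * z k * z l.
  rewrite /E; under eq_bigr => i _.
    rewrite expr2 {1}/wval mulr_suml; under eq_bigr => k _ do rewrite /wval mulr_sumr.
  over.
  rewrite exchange_big/=; apply: eq_bigr => k _.
  rewrite exchange_big/=; apply: eq_bigr => l _.
  by rewrite !mulr_suml; apply: eq_bigr => i _; ring.
have B2 : B ^+ 2 = \sum_k \sum_l bval x k * bval x l * z k * z l.
  rewrite expr2 BE mulr_suml; apply: eq_bigr => k _.
  by rewrite mulr_sumr; apply: eq_bigr => l _; ring.
have NN : nval x' ^+ 2 = nval x ^+ 2 + 2 * B + E.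
  rewrite !nval_sq -!addrA; congr (_ + _); rewrite /B /E mulr_sumr -!big_split/=.
  by apply: eq_bigr => i _; rewrite wD; ring.
pose r := n%:R * t.
have r0 : 0 <= r by rewrite mulr_ge0.
have Br : `|B| <= nval x * r.
  apply: le_trans (ler_norm_sum _ _ _) _.
  rewrite /r mulrCA -[n in n%:R]card_ord -sumr_const mulr_suml; apply: ler_sum => i _.
  by rewrite mul1r normrM ler_pM// wval_le_nval.
have E0 : 0 <= E by rewrite sumr_ge0// => i _; exact: sqr_ge0.
have Er : E <= r ^+ 2.
  apply: (@le_trans _ _ (\sum_(i < n) t ^+ 2)).
    by apply: ler_sum => i _; rewrite -(real_normK (num_real _)) lerXn2r// nnegrE.
  rewrite sumr_const card_ord -mulr_natl /r exprMn ler_wpM2r ?sqr_ge0//.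
  by rewrite -natrX ler_nat; case: (n) => // m; rewrite expnS leq_pmulr// expn_gt0.
have := sqrt_expand (nval_ge1 x) (nval_ge1 x') r0 NN Br E0 Er.
have -> : yval x' - yval x - (\sum_i ygrad x i * z i + \sum_i \sum_j yhess x i j * z i * z j) =
  nval x' - nval x - (B / nval x + E / (2 * nval x) - B ^+ 2 / (2 * nval x ^+ 3)).
  have -> : \sum_i ygrad x i * z i = B / nval x + rval z.
    rewrite BE mulr_suml /rval -big_split/=; apply: eq_bigr => i _; rewrite /ygrad; ring.
  have -> : \sum_i \sum_j yhess x i j * z i * z j = E / (2 * nval x) - B ^+ 2 / (2 * nval x ^+ 3).
    rewrite EE B2 !mulr_suml -sumrB; apply: eq_bigr => k _.
    rewrite !mulr_suml -sumrB; apply: eq_bigr => l _; rewrite /yhess; ring.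
  rewrite /yval rD; ring.
move=> /le_trans; apply.
have rn : r <= n%:R by rewrite /r ler_piMr.
have n0 : 0 <= n%:R :> R by [].
rewrite mulrDl mul1r; apply: (@le_trans _ _ (n%:R ^+ 3 * ((2 + n%:R) ^+ 2 + 1) * (3 + n%:R) * t ^+ 3)); last first.
  by rewrite lerDl exprn_ge0.
have -> : n%:R ^+ 3 * ((2 + n%:R) ^+ 2 + 1) * (3 + n%:R) * t ^+ 3 =
  r ^+ 3 * ((2 + n%:R) ^+ 2 + 1) * (3 + n%:R) by rewrite /r; ring.
have r30 : 0 <= r ^+ 3 by rewrite exprn_ge0.
apply: ler_pM; rewrite ?mulr_ge0 ?addr_ge0 ?sqr_ge0//; last by rewrite lerD2l.
rewrite ler_wpM2l// lerD2r lerXn2r ?nnegrE ?lerD2l//; lra.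
Qed.

Lemma natm_yval : natm yval.
Proof.
move=> d T X mX; rewrite /yval /nval /rval.
have mlin (c : J -> R) : measurable_fun setT (fun w => \sum_k c k * X k w).
  by apply: measurable_sum => k; apply: measurable_funM.
apply: measurable_funD; last exact: mlin.
apply: (measurableT_comp (continuous_measurable_fun (@sqrt_continuous R))).
apply: measurable_funD => //; apply: measurable_sum => i; apply: measurable_funX; exact: mlin.
Qed.

End NormPlusLinear.

(** * Gordon's comparison *)

Section Gordon.
Context {R : realType} {n N : nat}.

(** The left summand carries the process built on a matrix [G] and a scalar
    [gamma], the right one the process built on vectors [g] and [h]. *)
Definition gordon_index : finType := (('I_n * 'I_N + unit) + ('I_n + 'I_N))%type.
Local Notation J := gordon_index.

Definition Jmat : seq J := [seq inl k | k <- enum (('I_n * 'I_N + unit)%type : finType)].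
Definition Jvec : seq J := [seq inr k | k <- enum (('I_n + 'I_N)%type : finType)].

Lemma uniq_Jmat : uniq Jmat.
Proof. by rewrite map_inj_uniq ?enum_uniq// => a b []. Qed.

Lemma uniq_Jvec : uniq Jvec.
Proof. by rewrite map_inj_uniq ?enum_uniq// => a b []. Qed.

Lemma sum_Jmat (F : J -> R) : \sum_(k <- Jmat) F k =
  \sum_i \sum_j F (inl (inl (i, j))) + F (inl (inr tt)).
Proof.
rewrite /Jmat big_map big_enum/= big_sumType/= pair_big/=; congr (_ + _).
  by apply: eq_bigr => -[].
by rewrite (big_pred1 tt) => // -[].
Qed.

Lemma sum_Jvec (F : J -> R) : \sum_(k <- Jvec) F k =
  \sum_i F (inr (inl i)) + \sum_j F (inr (inr j)).
Proof. by rewrite /Jvec big_map big_enum/= big_sumType. Qed.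

Section Vector.
Variable u : {ffun 'I_N -> R}.

(** With these coefficients [wval] gives the coordinates of [G u + g] and [rval]
    is [gamma + <h, u>], so that the two processes are the same function [gy u]
    of two restricted families. *)
Definition wcoef (i : 'I_n) (k : J) : R :=
  match k with
  | inl (inl ij) => (ij.1 == i)%:R * u ij.2
  | inl (inr _) => 0
  | inr (inl i') => (i' == i)%:R
  | inr (inr _) => 0
  end.

Definition rcoef (k : J) : R :=
  match k with
  | inl (inl _) => 0
  | inl (inr _) => 1
  | inr (inl _) => 0
  | inr (inr j) => u j
  end.

End Vector.

Definition unit_vec (u : {ffun 'I_N -> R}) : Prop := \sum_j u j ^+ 2 = 1.

Lemma unit_vec_le1 u j : unit_vec u -> `|u j| <= 1.
Proof.
move=> u1; rewrite -[leRHS]normr1 -ler_sqr ?nnegrE// !real_normK ?num_real// expr1n -u1.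
by rewrite (bigD1 j)//= lerDl sumr_ge0// => i _; exact: sqr_ge0.
Qed.

Lemma unit_vec_dot (u v : {ffun 'I_N -> R}) : unit_vec u -> unit_vec v -> \sum_j u j * v j <= 1.
Proof.
move=> u1 v1; have : 0 <= \sum_j (u j - v j) ^+ 2 by apply: sumr_ge0 => j _; exact: sqr_ge0.
have -> : \sum_j (u j - v j) ^+ 2 = \sum_j u j ^+ 2 + \sum_j v j ^+ 2 - 2 * \sum_j u j * v j.
  by rewrite mulr_sumr -big_split/= -sumrB; apply: eq_bigr => j _; ring.
rewrite u1 v1; lra.
Qed.

Lemma wcoef_le1 u i k : unit_vec u -> `|wcoef u i k| <= 1.
Proof.
move=> u1; case: k => [[[i' j]|t]|[i'|j]] /=; rewrite ?normr0 ?ler01//.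
  by case: eqP => _; rewrite ?mul1r ?mul0r ?normr0//; exact: unit_vec_le1.
by case: eqP => _; rewrite ?normr0 ?normr1.
Qed.

Lemma rcoef_le1 u k : unit_vec u -> `|rcoef u k| <= 1.
Proof.
move=> u1; case: k => [[[i' j]|t]|[i'|j]] /=; rewrite ?normr0 ?ler01 ?normr1//.
exact: unit_vec_le1.
Qed.

Definition gy u := @yval R J n (wcoef u) (rcoef u).

Lemma delta_sum (F : 'I_n -> R) i : \sum_k F k * (i == k)%:R = F i.
Proof.
rewrite (bigD1 i)//= eqxx mulr1 big1 ?addr0// => k; rewrite eq_sym => /negbTE ->.
by rewrite mulr0.
Qed.

(** The generator of the comparison: the two Gaussian families differ, on the
    gradients of the processes at [u] and [v], by a product of two nonnegative
    defects, which vanishes when [u = v]. *)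
Lemma gordon_gap_grad u v x : unit_vec u -> unit_vec v ->
  exists2 S : R, S <= 1 & trace_gap Jmat Jvec
    (fun i j => ygrad (wcoef u) (rcoef u) x i * ygrad (wcoef v) (rcoef v) x j)
  = (1 - S) * (1 - \sum_j u j * v j).
Proof.
move=> u1 v1.
pose a (u : {ffun 'I_N -> R}) i := @wval R J n (wcoef u) i x / nval (wcoef u) x.
have aN (w : {ffun 'I_N -> R}) : \sum_i a w i ^+ 2 <= 1.
  have N1 := nval_ge1 (wcoef w) x.
  have N0 : 0 < nval (wcoef w) x ^+ 2 by rewrite exprn_gt0// (lt_le_trans ltr01).
  under eq_bigr do rewrite /a expr_div_n.
  by rewrite -mulr_suml ler_pdivrMr// mul1r nval_sq lerDr.
exists (\sum_i a u i * a v i).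
  have : 0 <= \sum_j (a u j - a v j) ^+ 2 by apply: sumr_ge0 => j _; exact: sqr_ge0.
  have -> : \sum_j (a u j - a v j) ^+ 2 = \sum_j a u j ^+ 2 + \sum_j a v j ^+ 2 - 2 * \sum_j a u j * a v j.
    by rewrite mulr_sumr -big_split/= -sumrB; apply: eq_bigr => j _; ring.
  have := aN u; have := aN v; lra.
have gmat w i j : ygrad (wcoef w) (rcoef w) x (inl (inl (i, j))) = a w i * w j.
  rewrite /ygrad /= addr0 /a [RHS]mulrAC; congr (_ / _).
  under eq_bigr => k _ do rewrite mulrA mulrAC.
  by rewrite (delta_sum (fun k => _ * w j)).
have gsc w : ygrad (wcoef w) (rcoef w) x (inl (inr tt)) = 1.
  by rewrite /ygrad /= big1 ?mul0r ?add0r// => i _; rewrite mulr0.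
have gcol w i : ygrad (wcoef w) (rcoef w) x (inr (inl i)) = a w i.
  by rewrite /ygrad /= addr0 delta_sum.
have grow w j : ygrad (wcoef w) (rcoef w) x (inr (inr j)) = w j.
  by rewrite /ygrad /= big1 ?mul0r ?add0r// => i _; rewrite mulr0.
rewrite /trace_gap sum_Jmat sum_Jvec !gsc.
have -> : \sum_i \sum_j ygrad (wcoef u) (rcoef u) x (inl (inl (i, j))) *
     ygrad (wcoef v) (rcoef v) x (inl (inl (i, j))) = (\sum_i a u i * a v i) * \sum_j u j * v j.
  rewrite mulr_suml; apply: eq_bigr => i _; rewrite mulr_sumr; apply: eq_bigr => j _.
  rewrite !gmat; ring.
have -> : \sum_i ygrad (wcoef u) (rcoef u) x (inr (inl i)) * ygrad (wcoef v) (rcoef v) x (inr (inl i))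
  = \sum_i a u i * a v i by apply: eq_bigr => i _; rewrite !gcol.
have -> : \sum_j ygrad (wcoef u) (rcoef u) x (inr (inr j)) * ygrad (wcoef v) (rcoef v) x (inr (inr j))
  = \sum_j u j * v j by apply: eq_bigr => i _; rewrite !grow.
ring.
Qed.

(** The Hessian of the norm has the same trace over the matrix [G], where it is
    weighted by the squared coordinates of [u], and over the vector [g]. *)
Lemma gordon_gap_hess u x : unit_vec u ->
  trace_gap Jmat Jvec (yhess (wcoef u) x) = 0.
Proof.
move=> u1; set w := fun i => @wval R J n (wcoef u) i x; set N0 := nval (wcoef u) x.
have hmat i j : yhess (wcoef u) x (inl (inl (i, j))) (inl (inl (i, j))) =
    (1 / (2 * N0) - w i ^+ 2 / (2 * N0 ^+ 3)) * u j ^+ 2.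
  rewrite /yhess /=.
  have -> : \sum_k (i == k)%:R * u j * ((i == k)%:R * u j) = u j ^+ 2.
    under eq_bigr => k _ do rewrite mulrC -mulrA mulrC -mulrA.
    by rewrite (bigD1 i)//= eqxx mul1r mulr1 -expr2 big1 ?addr0// => k; rewrite eq_sym => /negbTE ->; rewrite ?mul0r ?mulr0.
  have -> : \sum_k wval (wcoef u) k x * ((i == k)%:R * u j) = w i * u j.
    under eq_bigr => k _ do rewrite mulrA mulrAC.
    by rewrite (delta_sum (fun k => _ * u j)).
  by rewrite -/N0; ring.
have hsc : yhess (wcoef u) x (inl (inr tt)) (inl (inr tt)) = 0.
  rewrite /yhess /= !big1 ?mul0r ?subr0// => i _; by rewrite mulr0.
have hcol i : yhess (wcoef u) x (inr (inl i)) (inr (inl i)) =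
    1 / (2 * N0) - w i ^+ 2 / (2 * N0 ^+ 3).
  rewrite /yhess /= (delta_sum (fun k => (i == k)%:R)) eqxx delta_sum.
  by rewrite -/N0 -/(w i) -expr2.
have hrow j : yhess (wcoef u) x (inr (inr j)) (inr (inr j)) = 0.
  rewrite /yhess /= !big1 ?mul0r ?subr0// => i _; by rewrite mulr0.
rewrite /trace_gap sum_Jmat sum_Jvec hsc.
under eq_bigr => i _ do (under eq_bigr => j _ do rewrite hmat).
under [X in _ - (X + _)]eq_bigr do rewrite hcol.
under [X in _ - (_ + X)]eq_bigr do rewrite hrow.
rewrite big1_eq !addr0; apply/eqP; rewrite subr_eq0; apply/eqP; apply: eq_bigr => i _.
by rewrite -mulr_sumr u1 mulr1.
Qed.

Variables (us : seq {ffun 'I_N -> R}) (b a0 : R).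
Hypothesis us1 : forall u, u \in us -> unit_vec u.
Hypothesis b0 : 0 < b.

Definition gordon_fun (x : J -> R) : R := \prod_(u <- us) logistic (b * (gy u x - a0)).

Lemma natm_gordon_fun : natm gordon_fun.
Proof.
move=> d T X mX; rewrite /gordon_fun.
elim: us => [|u vs IH].
  by under eq_fun do rewrite big_nil; exact: measurable_cst.
under eq_fun do rewrite big_cons; apply: measurable_funM => //.
have ml : measurable_fun setT (@logistic R).
  apply: continuous_measurable_fun => t.
  by apply/differentiable_continuous/derivable1_diffP; case: (is_derive_logistic t).
apply: (measurableT_comp ml); apply: measurable_funM => //; apply: measurable_funB => //.
exact: natm_yval.
Qed.

Lemma gordon_fun_ge0 x : 0 <= gordon_fun x.
Proof. by apply: prodr_ge0 => u _; rewrite ltW// logistic_gt0. Qed.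

Lemma gordon_fun_le1 x : gordon_fun x <= 1.
Proof.
by apply: prodr_ile1 => u _; rewrite ltW ?logistic_gt0//= ltW// logistic_lt1.
Qed.

(** The product of logistic functions is a smooth version of the indicator that
    all processes exceed [a0]; gordon_gap_grad makes its cross terms
    favourable. *)
Theorem gordon_comparison d (T : measurableType d) (P : probability T R)
    (X : J -> {RV P >-> R}) :
  indep_on Jmat X -> indep_on Jvec X ->
  (forall j B, measurable B -> P (X j @^-1` B) = normal_prob 0 1 B) ->
  EP P (fun w => gordon_fun (partial_family X Jvec w)) <=
  EP P (fun w => gordon_fun (partial_family X Jmat w)).
Proof.
move=> iX iY law.
pose l u x := logistic (b * (gy u x - a0)).
pose l1 u x := l u x * (1 - l u x).
pose l2 u x := l u x * (1 - l u x) * (1 - 2 * l u x).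
have l1_0 u x : 0 <= l1 u x.
  by rewrite mulr_ge0 ?subr_ge0 ?ltW ?logistic_gt0 ?logistic_lt1.
have [] := @prod_ujet R J Jmat Jvec _ us (fun u x => logistic (b * (gy u x - a0))) l
  (fun u x i => l1 u x * b * ygrad (wcoef u) (rcoef u) x i)
  (fun u x i j => l1 u x * b * yhess (wcoef u) x i j + l2 u x / 2 * b ^+ 2 *
     (ygrad (wcoef u) (rcoef u) x i * ygrad (wcoef u) (rcoef u) x j)).
- move=> u /us1 u1.
  have w1 i k : `|wcoef u i k| <= 1 by exact: wcoef_le1.
  have r1 k : `|rcoef u k| <= 1 by exact: rcoef_le1.
  have [C C1 hC] := yval_expand (rcoef u) w1.
  pose D := C + (n%:R + 1) + (n%:R + n%:R ^+ 2).
  have n0 : 0 <= n%:R :> R by [].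
  have n20 : 0 <= n%:R ^+ 2 :> R by exact: sqr_ge0.
  apply: (@ujet_logistic R J (gy u) (ygrad (wcoef u) (rcoef u)) (yhess (wcoef u)) D b a0) => //.
  + rewrite /D; lra.
  + by move=> x i; apply: le_trans (ygrad_le w1 r1 x i) _; rewrite /D; lra.
  + by move=> x i j; apply: le_trans (yhess_le w1 x i j) _; rewrite /D; lra.
  + move=> x z z1; apply: le_trans (hC x z z1) _; rewrite ler_wpM2r ?exprn_ge0 ?n1_ge0//.
    by rewrite /D; lra.
- by move=> u x _; rewrite ltW// logistic_gt0.
- move=> u v x /us1 u1 /us1 v1.
  have [S S1 E] := gordon_gap_grad x u1 v1.
  rewrite (_ : trace_gap _ _ _ = (l1 u x * b) * (l1 v x * b) * trace_gap Jmat Jvec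
    (fun i j => ygrad (wcoef u) (rcoef u) x i * ygrad (wcoef v) (rcoef v) x j)); last first.
    by rewrite -trace_gapZ; apply: trace_gap_eq => i; ring.
  have b0' := ltW b0.
  rewrite E; apply: mulr_ge0; first exact: (mulr_ge0 (mulr_ge0 (l1_0 _ _) b0') (mulr_ge0 (l1_0 _ _) b0')).
  by apply: mulr_ge0; rewrite subr_ge0// unit_vec_dot.
- move=> u x /us1 u1.
  have [S S1 E] := gordon_gap_grad x u1 u1.
  rewrite trace_gapD !trace_gapZ gordon_gap_hess// mulr0 add0r E.
  have -> : \sum_j u j * u j = 1 by rewrite -[RHS]u1; apply: eq_bigr => j _; rewrite expr2.
  by rewrite subrr !mulr0.
move=> c' [a' [q' [uF _ _ gap]]].
apply: (gauss_comparison uniq_Jmat uniq_Jvec iX iY law natm_gordon_fun (M := 1) _ uF gap).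
by move=> x; rewrite ger0_norm ?gordon_fun_ge0// gordon_fun_le1.
Qed.

End Gordon.

(** * Markov and Chebyshev inequalities *)

Section Expectation.
Context {R : realType} {d : measure_display} {T : measurableType d}.
Variable P : probability T R.
Implicit Types f g : T -> R.
Local Notation E := (EP P).

Lemma EP_Z c f : P.-integrable setT (EFin \o f) -> E (fun x => c * f x) = c * E f.
Proof. by move=> hf; rewrite /EP RintegralZl. Qed.

Lemma EP_sum (I : Type) (s : seq I) (F : I -> T -> R) :
  (forall i, P.-integrable setT (EFin \o F i)) ->
  P.-integrable setT (EFin \o (fun w => \sum_(i <- s) F i w)) /\
  E (fun w => \sum_(i <- s) F i w) = \sum_(i <- s) E (F i).
Proof.
move=> iF; elim: s => [|i s [IH1 IH2]].
  rewrite big_nil (_ : (fun w => _) = fun=> 0).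
    by rewrite EP_cst; split=> //; apply: (@integrable_boundedP _ _ _ P 0) => // x; rewrite normr0.
  by apply/funext => w; rewrite big_nil.
rewrite (_ : (fun w => _) = fun w => F i w + \sum_(j <- s) F j w); last first.
  by apply/funext => w; rewrite big_cons.
by split; [exact: integrableDR|rewrite EP_D// big_cons IH2].
Qed.

Lemma EP_fin f : measurable_fun setT f -> (forall w, 0 <= f w) ->
  (\int[P]_w (f w)%:E < +oo)%E ->
  P.-integrable setT (EFin \o f) /\ (E f)%:E = (\int[P]_w (f w)%:E)%E.
Proof.
move=> mf f0 foo; split.
  apply/integrableP; split; first exact/measurable_EFinP.
  by under eq_integral => w _ do rewrite /= ger0_norm//.
by rewrite /EP /Rintegral fineK// ge0_fin_numE// integral_ge0// => w _; rewrite lee_fin.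
Qed.

Lemma measurable_set_le f g : measurable_fun setT f -> measurable_fun setT g ->
  measurable [set w | f w <= g w].
Proof.
move=> mf mg; rewrite (_ : [set w | _] = (fun w => g w - f w) @^-1` `[0, +oo[%classic).
  rewrite -[X in measurable X]setTI; apply: (measurable_funB mg mf) => //.
by apply/seteqP; split => w /=; rewrite in_itv/= andbT subr_ge0.
Qed.

Lemma measurable_set_lt f g : measurable_fun setT f -> measurable_fun setT g ->
  measurable [set w | f w < g w].
Proof.
move=> mf mg; rewrite (_ : [set w | _] = ~` [set w | g w <= f w]).
  by apply: measurableC; exact: measurable_set_le.
by apply/seteqP; split => w /=; rewrite ltNge => /negP.
Qed.

Lemma EP_indic (A : set T) : measurable A -> (E (\1_A : T -> R))%:E = P A.
Proof.
move=> mA; have iA : (\int[P]_w ((\1_A : T -> R) w)%:E = P A)%E by rewrite integral_indic// setIT.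
have [||_ ->] := @EP_fin (\1_A : T -> R) (measurable_indic mA) => //.
by rewrite iA (le_lt_trans (probability_le1 _ mA))// ltry.
Qed.

Lemma integrable_indicP (A : set T) : measurable A ->
  P.-integrable setT (EFin \o (\1_A : T -> R)).
Proof.
move=> mA; apply: (@integrable_boundedP _ _ _ P 1); first exact: measurable_indic.
by move=> w; rewrite indicE ger0_norm ?ler0n// lern1 leq_b1.
Qed.

Lemma markov_ge0 f (c : R) : P.-integrable setT (EFin \o f) -> (forall w, 0 <= f w) ->
  0 < c -> (P [set w | (c <= f w)%R] <= (E f / c)%R%:E)%E.
Proof.
move=> intf f0 c0.
have mf : measurable_fun setT f by apply/measurable_EFinP; case/integrableP: intf.
have mA : measurable [set w | c <= f w] by exact: measurable_set_le.
rewrite -EP_indic// lee_fin ler_pdivlMr// mulrC -EP_Z; last exact: integrable_indicP.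
apply: EP_le => //; first exact: (integrableZR c (integrable_indicP mA)).
move=> w; rewrite indicE; case: (boolP (w \in _)); rewrite ?mulr0// inE/= mulr1.
exact.
Qed.

Lemma EP_indep (U V : {RV P >-> R}) (f g : R -> R) :
  (forall A B, measurable A -> measurable B ->
     P (U @^-1` A `&` V @^-1` B) = (P (U @^-1` A) * P (V @^-1` B))%E) ->
  measurable_fun setT f -> measurable_fun setT g ->
  (forall x, 0 <= f x) -> (forall x, 0 <= g x) ->
  (\int[P]_w (f (U w) * g (V w))%:E = (\int[P]_w (f (U w))%:E) * (\int[P]_w (g (V w))%:E))%E.
Proof.
move=> ind mf mg f0 g0.
have mpair : measurable_fun setT (fun w : T => (U w, V w)).
  by apply: measurable_fun_pair.
pose pairm : {mfun T >-> (R * R)%type} := mfun_Sub (mem_set mpair).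
have mfg : measurable_fun (setT : set (R * R)) (fun p => (f p.1 * g p.2)%:E).
  apply/measurable_EFinP; apply: measurable_funM.
    exact: (measurableT_comp mf measurable_fst).
  exact: (measurableT_comp mg measurable_snd).
transitivity (\int[distribution P pairm]_p (f p.1 * g p.2)%:E)%E.
  by rewrite ge0_integral_distribution//= => p; rewrite lee_fin mulr_ge0.
transitivity (\int[distribution P U \x distribution P V]_p (f p.1 * g p.2)%:E)%E.
  apply: eq_measure_integral => S mS _; apply/esym.
  apply: product_measure_unique; last exact: mS.
  move=> A B mA mB.
  by rewrite -[RHS](ind A B mA mB); congr (P _); apply/seteqP; split.
have mEf : measurable_fun setT (fun x => (f x)%:E) by exact/measurable_EFinP.
have mEg : measurable_fun setT (fun x => (g x)%:E) by exact/measurable_EFinP.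
rewrite fubini_tonelli1//; last by move=> p; rewrite lee_fin mulr_ge0.
transitivity (\int[distribution P U]_x ((f x)%:E * \int[distribution P V]_y (g y)%:E))%E.
  apply: eq_integral => x _; rewrite /fubini_F /= -ge0_integralZl//=.
  - by move=> y _; rewrite lee_fin.
  - by rewrite lee_fin.
rewrite ge0_integralZr//=.
- by rewrite !ge0_integral_distribution// => x; rewrite lee_fin.
- by move=> x _; rewrite lee_fin.
- by apply: integral_ge0 => y _; rewrite lee_fin.
Qed.

(** Nonnegative terms keep all moments inside the integral with values in the
    extended reals, where product laws apply without integrability conditions. *)
Lemma chebyshev_sum (I : finType) (F : I -> T -> R) (mu : I -> R) (V t : R) :
  (forall i, measurable_fun setT (F i)) -> (forall i w, 0 <= F i w) ->
  (forall i, (\int[P]_w (F i w)%:E = (mu i)%:E)%E) ->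
  (forall i, (\int[P]_w (F i w ^+ 2)%:E <= V%:E)%E) ->
  (forall i j, i != j -> (\int[P]_w (F i w * F j w)%:E = (mu i * mu j)%:E)%E) ->
  0 < t ->
  (P [set w | (t <= `|\sum_i F i w - \sum_i mu i|)%R] <= (#|I|%:R * V / t ^+ 2)%R%:E)%E.
Proof.
move=> mF F0 Emu EV Eij t0.
have i1 i : P.-integrable setT (EFin \o F i) /\ (E (F i))%:E = (mu i)%:E.
  have [] := EP_fin (mF i) (F0 i); first by rewrite Emu ltry.
  by rewrite Emu.
have i2 i j : P.-integrable setT (EFin \o (fun w => F i w * F j w)) /\
    E (fun w => F i w * F j w) <= (if i == j then V else mu i * mu j).
  have mm : measurable_fun setT (fun w => F i w * F j w) by exact: measurable_funM.
  have mm0 w : 0 <= F i w * F j w by rewrite mulr_ge0.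
  have [] := EP_fin mm mm0.
    case: (eqVneq i j) => [->|ij]; last by rewrite Eij// ltry.
    by apply: le_lt_trans (EV j) (ltry _).
  move=> h1 h2; split => //; rewrite -lee_fin h2.
  case: (eqVneq i j) => [->|ij]; last by rewrite Eij.
  exact: EV.
have Emu' i : E (F i) = mu i by case: (i1 i) => _ /eqP; rewrite eqe => /eqP.
pose S w := \sum_i F i w; pose M := \sum_i mu i.
have [iS ES] := EP_sum (index_enum I) (fun i => proj1 (i1 i)).
have iSS : P.-integrable setT (EFin \o (fun w => \sum_i \sum_j F i w * F j w)) /\
  E (fun w => \sum_i \sum_j F i w * F j w) = \sum_i \sum_j E (fun w => F i w * F j w).
  have H i := EP_sum (index_enum I) (fun j => proj1 (i2 i j)).
  have [h1 h2] := EP_sum (index_enum I) (fun i => proj1 (H i)).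
  by split => //; rewrite h2; apply: eq_bigr => i _; exact: (proj2 (H i)).
have SS w : S w ^+ 2 = \sum_i \sum_j F i w * F j w.
  by rewrite expr2 /S mulr_suml; apply: eq_bigr => i _; rewrite mulr_sumr.
have EM : E S = M by rewrite ES; apply: eq_bigr => i _.
have iS2 : P.-integrable setT (EFin \o (fun w => S w ^+ 2)).
  by rewrite (_ : (fun w => _) = (fun w => \sum_i \sum_j F i w * F j w)); [exact: (proj1 iSS)|apply/funext].
have ES2 : E (fun w => S w ^+ 2) <= #|I|%:R * V + M ^+ 2.
  have -> : E (fun w => S w ^+ 2) = \sum_i \sum_j E (fun w => F i w * F j w).
    by rewrite -(proj2 iSS); congr EP; apply/funext.
  have -> : M ^+ 2 = \sum_i \sum_j mu i * mu j.
    by rewrite expr2 /M mulr_suml; apply: eq_bigr => i _; rewrite mulr_sumr.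
  have -> : #|I|%:R * V = \sum_(i : I) V by rewrite sumr_const mulr_natl.
  rewrite -big_split/=; apply: ler_sum => i _.
  rewrite (bigD1 i)//= [X in _ <= _ + X](bigD1 i)//= addrA lerD//.
    have := proj2 (i2 i i); rewrite eqxx => /le_trans; apply.
    by rewrite lerDl -expr2 sqr_ge0.
  apply: ler_sum => j ji; have := proj2 (i2 i j).
  by rewrite eq_sym (negbTE ji).
have iD : P.-integrable setT (EFin \o (fun w => S w ^+ 2 + (- (2 * M)) * S w)).
  exact: (integrableDR iS2 (integrableZR _ iS)).
have iC : P.-integrable setT (EFin \o (fun _ : T => M ^+ 2)).
  by apply: (@integrable_boundedP _ _ _ P `|M ^+ 2|).
have E2 : E (fun w => (S w - M) ^+ 2) <= #|I|%:R * V.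
  have -> : E (fun w => (S w - M) ^+ 2) = E (fun w => (S w ^+ 2 + (- (2 * M)) * S w) + M ^+ 2).
    by congr EP; apply/funext => w; ring.
  rewrite EP_D// EP_D//; last exact: (integrableZR _ iS).
  rewrite EP_Z// EP_cst EM; have := ES2; lra.
have iq : P.-integrable setT (EFin \o (fun w => (S w - M) ^+ 2)).
  rewrite (_ : (fun w => _) = (fun w => (S w ^+ 2 + (- (2 * M)) * S w) + M ^+ 2)).
    exact: (integrableDR iD iC).
  by apply/funext => w; ring.
rewrite (_ : [set w | _] = [set w | (t ^+ 2 <= (S w - M) ^+ 2)%R]); last first.
  apply/seteqP; split => w /=; rewrite -[(S w - M) ^+ 2]real_normK ?num_real//.
    by move=> h; rewrite lerXn2r// nnegrE// ltW.
  by rewrite ler_sqr// nnegrE// ltW.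
apply: le_trans (markov_ge0 iq (fun w => sqr_ge0 _) (exprn_gt0 2 t0)) _.
by rewrite lee_fin ler_wpM2r// invr_ge0 exprn_ge0// ltW.
Qed.

End Expectation.

(** * Cones of small drift *)

Section Deterministic.
Context {R : realType}.

Lemma cauchy_schwarz (I : finType) (a b : I -> R) :
  (\sum_i a i * b i) ^+ 2 <= (\sum_i a i ^+ 2) * (\sum_i b i ^+ 2).
Proof.
have : 0 <= \sum_i \sum_j (a i * b j - a j * b i) ^+ 2.
  by apply: sumr_ge0 => i _; apply: sumr_ge0 => j _; exact: sqr_ge0.
have -> : \sum_i \sum_j (a i * b j - a j * b i) ^+ 2 =
  2 * ((\sum_i a i ^+ 2) * (\sum_i b i ^+ 2)) - 2 * (\sum_i a i * b i) ^+ 2.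
  have e1 : (\sum_i a i ^+ 2) * (\sum_i b i ^+ 2) = \sum_i \sum_j a i ^+ 2 * b j ^+ 2.
    by rewrite mulr_suml; apply: eq_bigr => i _; rewrite mulr_sumr.
  have e2 : (\sum_i a i ^+ 2) * (\sum_i b i ^+ 2) = \sum_i \sum_j a j ^+ 2 * b i ^+ 2.
    by rewrite mulrC mulr_suml; apply: eq_bigr => i _; rewrite mulr_sumr; apply: eq_bigr => j _; rewrite mulrC.
  have e3 : (\sum_i a i * b i) ^+ 2 = \sum_i \sum_j (a i * b i) * (a j * b j).
    by rewrite expr2 mulr_suml; apply: eq_bigr => i _; rewrite mulr_sumr.
  rewrite mulrDl mul1r {1}e1 e2 e3 mulr_sumr -big_split/= -sumrB; apply: eq_bigr => i _.
  rewrite mulr_sumr -big_split/= -sumrB; apply: eq_bigr => j _; ring.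
lra.
Qed.

(** A bounded set has finite nets inside itself: round the coordinates and keep
    one representative of every nonempty cell. *)
Lemma net_exists (N : nat) (K : set {ffun 'I_N -> R}) (e : R) : 0 < e ->
  (forall u, K u -> forall j, `|u j| <= 1) ->
  exists us : seq {ffun 'I_N -> R}, (forall u, u \in us -> K u) /\
    forall u, K u -> exists2 v, v \in us & forall j, `|u j - v j| <= e.
Proof.
move=> e0 K1.
pose m := (Num.bound (2 / e)).+1.
pose cell (u : {ffun 'I_N -> R}) : {ffun 'I_N -> 'I_m} := [ffun j => inord (Num.truncn ((u j + 1) / e))].
have cellE u j : K u -> (cell u j : nat) = Num.truncn ((u j + 1) / e).
  move=> Ku; rewrite ffunE inordK// ltnS.
  have := K1 u Ku j; rewrite ler_norml => /andP[h1 h2].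
  have : (u j + 1) / e < (Num.bound (2 / e))%:R.
    apply: le_lt_trans (archi_boundP _); last by rewrite divr_ge0// ltW.
    by rewrite ler_pM2r ?invr_gt0//; lra.
  move=> h; apply: ltnW; rewrite truncn_lt_nat//.
  by rewrite divr_ge0 ?(ltW e0)//; lra.
pose rep (c : {ffun 'I_N -> 'I_m}) : option {ffun 'I_N -> R} :=
  if pselect (exists u, K u /\ cell u = c) is left h then Some (sval (cid h)) else None.
exists (pmap rep (enum [set: {ffun 'I_N -> 'I_m}])); split.
  move=> u; rewrite mem_pmap => /mapP[c _]; rewrite /rep; case: pselect => // h [->].
  by case: (svalP (cid h)).
move=> u Ku; have ex : exists v, K v /\ cell v = cell u by exists u.
pose v := sval (cid ex); have [Kv cv] := svalP (cid ex).
have repE : rep (cell u) = Some v.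
  by rewrite /rep; case: pselect => // h; congr (Some (sval (cid _))); exact: Prop_irrelevance.
exists v; first by rewrite mem_pmap -repE map_f// mem_enum inE.
move=> j; have := congr1 (fun c : {ffun 'I_N -> 'I_m} => (c j : nat)) cv; rewrite !cellE// => E.
have b w : K w -> 0 <= (w j + 1) / e.
  by move=> Kw; rewrite divr_ge0 ?(ltW e0)//; have := K1 w Kw j; rewrite ler_norml => /andP[h1 h2]; lra.
have /andP[u1 u2] := truncn_itv (b u Ku); have /andP[v1 v2] := truncn_itv (b v Kv).
rewrite -/v E in v1 v2; set k := Num.truncn _ in u1 u2 v1 v2.
rewrite ler_pdivlMr// in u1; rewrite ler_pdivlMr// in v1.
rewrite ltr_pdivrMr// in u2; rewrite ltr_pdivrMr// in v2.
move: u2 v2; rewrite -natr1 mulrDl mul1r => u2 v2.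
rewrite ler_norml; apply/andP; split; lra.
Qed.

(** The derivative of the l1 norm in the direction [u], at a point with signs
    [s]. *)
Definition l1_drift (N : nat) (s : 'I_N -> R) (u : 'I_N -> R) : R :=
  \sum_j (if s j == 0 then `|u j| else s j * u j).

(** The squared distance of [h] to [- t] times the subdifferential of the
    absolute value at a point of sign [s]. *)
Definition excess (t s h : R) : R := if s == 0 then soft t h ^+ 2 else (h + t * s) ^+ 2.

(** Move [h] to the nearest point of [- t] times the subdifferential of the l1
    norm: the displacement is handled by the Cauchy-Schwarz inequality, and the
    point reached pairs with [u] to at least [- t] times the drift. *)
Lemma linear_lower_bound (N : nat) (s h : 'I_N -> R) (u : {ffun 'I_N -> R}) (t : R) :
  0 <= t -> unit_vec u ->
  - (Num.sqrt (\sum_j excess t (s j) (h j)) + t * l1_drift s u) <= \sum_j h j * u j.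
Proof.
move=> t0 u1.
pose a j := if s j == 0 then soft t (h j) else `|h j + t * s j|.
have a0 j : 0 <= a j by rewrite /a; case: ifP => // _; rewrite le_max lexx.
have aE j : a j ^+ 2 = excess t (s j) (h j).
  by rewrite /a /excess; case: ifP => // _; rewrite real_normK ?num_real.
have S0 : 0 <= \sum_j excess t (s j) (h j) by apply: sumr_ge0 => j _; rewrite -aE sqr_ge0.
have CS : \sum_j a j * `|u j| <= Num.sqrt (\sum_j excess t (s j) (h j)).
  rewrite -[leLHS]ger0_norm; last by apply: sumr_ge0 => j _; rewrite mulr_ge0.
  rewrite -sqrtr_sqr ler_wsqrtr//; apply: le_trans (cauchy_schwarz _ _) _.
  have -> : \sum_j `|u j| ^+ 2 = 1.
    by rewrite -[RHS]u1; apply: eq_bigr => j _; rewrite real_normK ?num_real.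
  by rewrite mulr1; apply: ler_sum => j _; rewrite aE.
have : \sum_j (- (h j * u j)) <= \sum_j (a j * `|u j| + t * (if s j == 0 then `|u j| else s j * u j)).
  apply: ler_sum => j _; rewrite /a; case: ifP => _.
    have : `|h j| - t <= soft t (h j) by rewrite le_max lexx orbT.
    have : - (h j * u j) <= `|h j| * `|u j| by rewrite -normrM -normrN ler_norm.
    have : 0 <= `|u j| by []. nra.
  have : - ((h j + t * s j) * u j) <= `|h j + t * s j| * `|u j| by rewrite -normrM -normrN ler_norm.
  lra.
rewrite sumrN big_split/= -mulr_sumr -/(l1_drift s u); lra.
Qed.

End Deterministic.

(** * Gordon's comparison in probability *)

Section GordonProbability.
Context {R : realType} {n N : nat}.
Local Notation J := (@gordon_index n N).

Lemma sum_gordon_index (F : J -> R) : \sum_k F k =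
  (\sum_i \sum_j F (inl (inl (i, j))) + F (inl (inr tt))) +
  (\sum_i F (inr (inl i)) + \sum_j F (inr (inr j))).
Proof.
rewrite /gordon_index big_sumType/= !big_sumType/= pair_big/=; congr (_ + _ + _).
  by apply: eq_bigr => -[].
by rewrite (big_pred1 tt) => // -[].
Qed.

Lemma gordon_wvalE (u : {ffun 'I_N -> R}) i (x : J -> R) :
  wval (wcoef u) i x = \sum_j x (inl (inl (i, j))) * u j + x (inr (inl i)).
Proof.
rewrite /wval sum_gordon_index /= mul0r addr0 [X in _ + (_ + X)]big1 ?addr0; last first.
  by move=> j _; rewrite mul0r.
congr (_ + _).
  rewrite (bigD1 i)//= [X in _ + X]big1 ?addr0; last first.
    by move=> k /negbTE ki; rewrite big1// => j _; rewrite ki !mul0r.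
  by apply: eq_bigr => j _; rewrite eqxx mul1r mulrC.
rewrite (bigD1 i)//= eqxx mul1r big1 ?addr0// => k /negbTE ->; by rewrite mul0r.
Qed.

Lemma gordon_rvalE (u : {ffun 'I_N -> R}) (x : J -> R) :
  rval (rcoef u) x = x (inl (inr tt)) + \sum_j x (inr (inr j)) * u j.
Proof.
rewrite /rval sum_gordon_index /= mul1r [X in X + _ + _]big1 ?add0r; last first.
  by move=> i _; rewrite big1// => j _; rewrite mul0r.
rewrite [X in _ + (X + _)]big1 ?add0r; last by move=> j _; rewrite mul0r.
by congr (_ + _); apply: eq_bigr => j _; rewrite mulrC.
Qed.

Context {d : measure_display} {T : measurableType d}.
Variable P : probability T R.
Variable X : J -> {RV P >-> R}.
Hypothesis iX : indep_on Jmat X.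
Hypothesis iY : indep_on Jvec X.
Hypothesis law : forall j B, measurable B -> P (X j @^-1` B) = normal_prob 0 1 B.
Variable us : seq {ffun 'I_N -> R}.
Hypothesis us1 : forall u, u \in us -> unit_vec u.

Definition all_above (js : seq J) (a : R) : set T :=
  [set w | forall u, u \in us -> a <= gy u (partial_family X js w)].

Lemma measurable_gy js u : measurable_fun setT (fun w => gy u (partial_family X js w)).
Proof. by apply: natm_partial_family; exact: natm_yval. Qed.

Lemma measurable_all_above js a : measurable (all_above js a).
Proof.
rewrite (_ : all_above js a = \bigcap_(u in [set` us]) [set w | a <= gy u (partial_family X js w)]).
  apply: fin_bigcap_measurable; first exact: finite_seq.
  by move=> u _; apply: (measurable_set_le (f := cst a)) => //; exact: measurable_gy.
by apply/seteqP; split => w H u; exact: H.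
Qed.

Lemma prod_lower (I : eqType) (s : seq I) (f : I -> R) (e : R) : 0 <= e ->
  (forall i, i \in s -> 0 <= f i <= 1) -> (forall i, i \in s -> 1 - f i <= e) ->
  1 - (size s)%:R * e <= \prod_(i <- s) f i.
Proof.
move=> e0; elim: s => [|i s IH] f01 fe; first by rewrite big_nil mul0r subr0.
rewrite big_cons /= -natr1 mulrDl mul1r.
have sb j : j \in s -> j \in i :: s by move=> js; rewrite inE js orbT.
have /andP[h0 h1] := f01 i (mem_head _ _); have h2 := fe i (mem_head _ _).
have := IH (fun j js => f01 j (sb j js)) (fun j js => fe j (sb j js)).
have p1 : \prod_(j <- s) f j <= 1.
  rewrite big_seq; apply: prodr_ile1 => j js; exact: f01 (sb j js).
set p := \prod_(j <- s) f j in p1 *; nra.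
Qed.

(** The comparison in probability: a smooth threshold squeezed between the two
    levels turns the inequality of expectations into one of probabilities. *)
Lemma gordon_prob (a t th : R) : 0 < t -> 0 < th ->
  (P (all_above Jvec (a + t)) <= P (all_above Jmat (a - t)) + (2 * th)%:E)%E.
Proof.
move=> t0 th0.
pose m : R := (size us)%:R + 1.
have m0 : 0 < m by rewrite /m ltr_wpDl.
(* Steep enough for each logistic factor to be within th / m of its limit at
   distance t from the level. *)
pose b := m / (th * t).
have tt0 : 0 < th * t by rewrite mulr_gt0.
have b0 : 0 < b by rewrite divr_gt0.
have bt : (b * t)^-1 = th / m by rewrite /b; field; rewrite !gt_eqF.
have thm : th / m <= th by rewrite ler_pdivrMr// ler_peMr ?(ltW th0)// /m lerDr.
have C := gordon_comparison a us1 b0 iX iY law.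
have mF js : measurable_fun setT (fun w => gordon_fun us b a (partial_family X js w)).
  by apply: natm_partial_family; exact: natm_gordon_fun.
have iF js : P.-integrable setT (EFin \o (fun w => gordon_fun us b a (partial_family X js w))).
  apply: (@integrable_boundedP _ _ _ P 1) => // w.
  by rewrite ger0_norm ?gordon_fun_ge0// gordon_fun_le1.
have mA := measurable_all_above Jvec (a + t); have mB := measurable_all_above Jmat (a - t).
have iA := integrable_indicP P mA; have iB := integrable_indicP P mB.
have icst (c : R) : P.-integrable setT (EFin \o (fun _ : T => c)).
  by apply: (@integrable_boundedP _ _ _ P `|c|).
have H1 : EP P (\1_(all_above Jvec (a + t)) : T -> R) - th <=
          EP P (fun w => gordon_fun us b a (partial_family X Jvec w)).
  rewrite -[th](EP_cst P) -mulN1r -(EP_Z (-1) (icst th)) -(EP_D iA (integrableZR (-1) (icst th))).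
  apply: EP_le => //; first exact: (integrableDR iA (integrableZR (-1) (icst th))).
  move=> w; rewrite indicE mulN1r; case: (boolP (w \in _)) => wA; last first.
    by rewrite /= sub0r; apply: le_trans (gordon_fun_ge0 _ _ _ _); rewrite oppr_le0 ltW.
  rewrite inE in wA; rewrite /gordon_fun.
  have := @prod_lower _ us (fun u => logistic (b * (gy u (partial_family X Jvec w) - a))) (th / m).
  move=> /(_ (ltW (divr_gt0 th0 m0))) pl.
  apply: le_trans (pl _ _).
  - rewrite lerD2l lerN2 mulrA ler_pdivrMr// mulrC ler_wpM2l ?(ltW th0)//.
    by rewrite /m lerDl.
  - by move=> u _; rewrite ltW ?logistic_gt0//= ltW// logistic_lt1.
  - move=> u /wA hu.
    have z0 : b * t <= b * (gy u (partial_family X Jvec w) - a).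
      by rewrite (ler_pM2l b0) lerBrDl.
    have bt0 : 0 < b * t by rewrite mulr_gt0.
    apply: le_trans (logistic_hi (lt_le_trans bt0 z0)) _.
    by rewrite -bt lef_pV2 ?posrE// (lt_le_trans bt0).
have H2 : EP P (fun w => gordon_fun us b a (partial_family X Jmat w)) <=
          EP P (\1_(all_above Jmat (a - t)) : T -> R) + th.
  rewrite -[th](EP_cst P) -(EP_D iB (icst th)); apply: EP_le => //; first exact: (integrableDR iB (icst th)).
  move=> w; rewrite indicE; case: (boolP (w \in _)) => wB.
    by rewrite /=; apply: le_trans (gordon_fun_le1 _ _ _ _) _; rewrite lerDl ltW.
  rewrite add0r; have : exists2 u, u \in us & gy u (partial_family X Jmat w) < a - t.
    move: wB; rewrite notin_setE /all_above /= => /existsNP[u /not_implyP[uus /negP]].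
    by rewrite -ltNge; exists u.
  move=> [u uus hu]; rewrite /gordon_fun (big_rem u)//=.
  have z0 : b * t <= - (b * (gy u (partial_family X Jmat w) - a)).
    by rewrite -mulrN (ler_pM2l b0) opprB lerBrDl -lerBrDr ltW.
  have bt0 : 0 < b * t by rewrite mulr_gt0.
  have L := logistic_lo (lt_le_trans bt0 z0); rewrite opprK in L.
  apply: (@le_trans _ _ (th * 1)); last by rewrite mulr1.
  apply: ler_pM.
  - by rewrite ltW// logistic_gt0.
  - by apply: prodr_ge0 => v _; rewrite ltW// logistic_gt0.
  - apply: le_trans L _; apply: le_trans thm.
    by rewrite -bt lef_pV2 ?posrE// (lt_le_trans bt0).
  - by apply: prodr_ile1 => v _; rewrite ltW ?logistic_gt0//= ltW// logistic_lt1.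
rewrite -!EP_indic// -EFinD lee_fin.
have := le_trans H1 (le_trans C H2).
by rewrite lerBlDr -addrA -mulr2n -[th *+ 2]mulr_natl.
Qed.

End GordonProbability.

(** * Sums of independent terms *)

Section GaussianSums.
Context {R : realType}.
Local Notation gam := (normal_prob (0 : R) 1).

(** The second moment of [soft t] under the standard normal law; see
    gauss_soft_moment. *)
Definition soft_var (t : R) : R := 2 * ((1 + t ^+ 2) * std_cdf (- t) - t * phi t).

Definition excess_mean (t s : R) : R := if s == 0 then soft_var t else 1 + t ^+ 2.

Definition moment4 : R := fine (\int[gam]_x (x ^+ 4)%:E).

Lemma measurable_soft (t : R) : measurable_fun setT (soft t).
Proof.
by apply: measurable_maxr => //; apply: measurable_funB => //; exact: measurable_normr.
Qed.

Lemma measurable_excess (t s : R) : measurable_fun setT (excess t s).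
Proof.
rewrite (_ : excess t s = if s == 0 then fun h => soft t h ^+ 2 else fun h => (h + t * s) ^+ 2).
  by case: ifP => _; apply: measurable_funX; [exact: measurable_soft|exact: measurable_funD].
by apply/funext => h; rewrite /excess; case: ifP.
Qed.

Lemma excess_ge0 (t s x : R) : 0 <= excess t s x.
Proof. by rewrite /excess; case: ifP => _; exact: sqr_ge0. Qed.

Lemma soft_le (t x : R) : 0 <= t -> 0 <= soft t x <= `|x|.
Proof. by move=> t0; rewrite /soft le_max lexx/= ge_max normr_ge0 gerBl. Qed.

Lemma moment4E : (\int[gam]_x (x ^+ 4)%:E)%E = moment4%:E.
Proof.
rewrite fineK// ge0_fin_numE ?gauss_fourth_moment//.
by apply: integral_ge0 => x _; rewrite lee_fin exprn_even_ge0.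
Qed.

Lemma moment4_ge0 : 0 <= moment4.
Proof.
rewrite -lee_fin -moment4E; apply: integral_ge0 => x _.
by rewrite lee_fin exprn_even_ge0.
Qed.

Lemma integrable_pow4 : gam.-integrable setT (EFin \o (fun x : R => x ^+ 4)).
Proof.
apply: (@integrable_gauss R 1); first exact: exprn_measurable.
by move=> x; rewrite mul1r ger0_norm ?exprn_even_ge0// lerDr.
Qed.

Lemma integrable_pow2 : gam.-integrable setT (EFin \o (fun x : R => x ^+ 2)).
Proof.
apply: (@integrable_gauss R 1); first exact: exprn_measurable.
move=> x; rewrite mul1r ger0_norm ?sqr_ge0//.
by have := sqr_ge0 (x ^+ 2 - 1); have := sqr_ge0 x; nra.
Qed.

Lemma excess_moment (t s : R) : 0 <= t -> s = 0 \/ s ^+ 2 = 1 ->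
  (\int[gam]_x (excess t s x)%:E = (excess_mean t s)%:E)%E.
Proof.
move=> t0 hs; rewrite /excess /excess_mean; case: (boolP (s == 0)) => [_|s0].
  exact: gauss_soft_moment.
have {hs} s1 : s ^+ 2 = 1 by case: hs s0 => [->|//]; rewrite eqxx.
have E : (fun x : R => (x + t * s) ^+ 2) = (fun x : R => x ^+ 2 + ((2 * (t * s)) * x + t ^+ 2)).
  have ts : t ^+ 2 = (t * s) ^+ 2 by rewrite exprMn s1 mulr1.
  by apply/funext => x; rewrite ts; ring.
have i1 : gam.-integrable setT (EFin \o (fun x : R => x)).
  apply: (@integrable_gauss R 1) => // x; rewrite mul1r.
  have := sqr_ge0 (x ^+ 2 - 1); have := sqr_ge0 (`|x| - 1).
  by rewrite sqrrB real_normK ?num_real//; nra.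
have ic : gam.-integrable setT (EFin \o (fun x : R => t ^+ 2)).
  by apply: (@integrable_bounded R `|t ^+ 2|).
have il := integrableDR (integrableZR (2 * (t * s)) i1) ic.
have := integrableDR integrable_pow2 il.
have : EG (fun x : R => (x + t * s) ^+ 2) = 1 + t ^+ 2.
  by rewrite E (EG_D integrable_pow2 il) (EG_D (integrableZR _ i1) ic) (EG_Z _ i1) EG_cst EG_sq EG_id; ring.
rewrite -E /EG /Rintegral => <- ii; rewrite fineK//.
exact: (integrable_fin_num measurableT ii).
Qed.

Lemma excess_moment2 (t s : R) : 0 <= t -> s = 0 \/ s ^+ 2 = 1 ->
  (\int[gam]_x (excess t s x ^+ 2)%:E <= (8 * moment4 + 8 * t ^+ 4)%:E)%E.
Proof.
move=> t0 hs.
have ic : gam.-integrable setT (EFin \o (fun x : R => 8 * t ^+ 4)).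
  by apply: (@integrable_bounded R `|8 * t ^+ 4|).
have iD := integrableDR (integrableZR 8 integrable_pow4) ic.
have <- : (\int[gam]_x (8 * x ^+ 4 + 8 * t ^+ 4)%:E)%E = (8 * moment4 + 8 * t ^+ 4)%:E.
  have := EG_D (integrableZR 8 integrable_pow4) ic.
  rewrite (EG_Z _ integrable_pow4) EG_cst {1 2}/EG /Rintegral -/moment4 => <-.
  by rewrite fineK//; exact: (integrable_fin_num measurableT iD).
have x4 (x : R) : 0 <= x ^+ 4 by rewrite exprn_even_ge0.
have le x : excess t s x ^+ 2 <= 8 * x ^+ 4 + 8 * t ^+ 4.
  rewrite /excess; case: ifP => [_|/negbT s0].
    have /andP[h0 h1] := soft_le x t0.
    have h : soft t x ^+ 4 <= x ^+ 4.
      rewrite (_ : x ^+ 4 = `|x| ^+ 4); first by rewrite lerXn2r// nnegrE.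
      by rewrite -normrX ger0_norm.
    rewrite -exprM; have := x4 x; have := x4 t; lra.
  have s1 : s ^+ 2 = 1 by case: hs s0 => [->|//]; rewrite eqxx.
  have h1 : (x + t * s) ^+ 2 <= 2 * x ^+ 2 + 2 * t ^+ 2.
    have := sqr_ge0 (x - t * s); have : t ^+ 2 = (t * s) ^+ 2 by rewrite exprMn s1 mulr1.
    move=> ->; nra.
  apply: (@le_trans _ _ ((2 * x ^+ 2 + 2 * t ^+ 2) ^+ 2)).
    by rewrite lerXn2r// ?nnegrE ?sqr_ge0// (le_trans _ h1)// sqr_ge0.
  have := sqr_ge0 (x ^+ 2 - t ^+ 2); nra.
apply: ge0_le_integral => //=.
- by move=> x _; rewrite lee_fin sqr_ge0.
- apply/measurable_EFinP; apply: measurable_funX; exact: measurable_excess.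
- by apply/measurable_EFinP; case/integrableP: iD => /measurable_EFinP.
- by move=> x _; rewrite lee_fin.
Qed.

Lemma soft_var_le1 (t : R) : 0 <= t -> soft_var t <= 1.
Proof.
move=> t0; rewrite -lee_fin -gauss_soft_moment// -gauss_second_moment.
apply: ge0_le_integral => //=.
- by move=> x _; rewrite lee_fin sqr_ge0.
- by apply/measurable_EFinP; apply: measurable_funX; exact: measurable_soft.
- by apply/measurable_EFinP; exact: exprn_measurable.
- move=> x _; rewrite lee_fin -[x ^+ 2]real_normK ?num_real//.
  by have /andP[h0 h1] := soft_le x t0; rewrite lerXn2r// nnegrE.
Qed.

Context {d : measure_display} {T : measurableType d}.
Variable P : probability T R.

Lemma law_integral (X : {RV P >-> R}) (f : R -> R) :
  (forall B, measurable B -> P (X @^-1` B) = gam B) ->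
  measurable_fun setT f -> (forall x, 0 <= f x) ->
  (\int[P]_w (f (X w))%:E = \int[gam]_x (f x)%:E)%E.
Proof.
move=> law mf f0.
have mX0 : measurable_fun setT (X : T -> R) by [].
pose h : T -> measurableTypeR R := X.
have mh : measurable_fun setT h by exact: mX0.
pose Xm : {mfun T >-> measurableTypeR R} := mfun_Sub (mem_set mh).
have mEf : measurable_fun (setT : set (measurableTypeR R)) (fun x => (f x)%:E).
  by apply/measurable_EFinP.
transitivity (\int[distribution P Xm]_x (f x)%:E)%E.
  by rewrite ge0_integral_distribution.
by apply: eq_measure_integral => S mS _; exact: law.
Qed.

Lemma independent_chebyshev (I : finType) (X : I -> {RV P >-> R}) (f : I -> R -> R)
    (mu : I -> R) (V t : R) :
  indep_on (index_enum I) X ->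
  (forall i, measurable_fun setT (f i)) -> (forall i x, 0 <= f i x) ->
  (forall i, (\int[P]_w (f i (X i w))%:E = (mu i)%:E)%E) ->
  (forall i, (\int[P]_w (f i (X i w) ^+ 2)%:E <= V%:E)%E) -> 0 < t ->
  (P [set w | (t <= `|\sum_i f i (X i w) - \sum_i mu i|)%R] <= (#|I|%:R * V / t ^+ 2)%R%:E)%E.
Proof.
move=> ind mf f0 emu eV t0.
apply: chebyshev_sum => //; first by move=> i; exact: (measurableT_comp (mf i)).
move=> i j ij; rewrite EP_indep//; first by rewrite !emu.
move=> A B mA mB.
have := @ind [set i; j]%SET (fun k => if k == i then A else B).
have si : {subset [set i; j]%SET <= index_enum I} by move=> k _; rewrite mem_index_enum.
move=> /(_ si); rewrite big_setU1 ?inE//= big_set1 eqxx eq_sym (negbTE ij) => <-.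
  congr (P _); apply/seteqP; split => w /=.
    by move=> [hi hj] k; rewrite !inE => /orP[]/eqP->; rewrite ?eqxx// eq_sym (negbTE ij).
  move=> h; split; first by have := h i; rewrite !inE eqxx => /(_ isT).
  by have := h j; rewrite !inE eqxx orbT => /(_ isT); rewrite eq_sym (negbTE ij).
by move=> k; case: ifP.
Qed.

Lemma gauss_chebyshev (I : finType) (X : I -> {RV P >-> R}) (f : I -> R -> R)
    (mu : I -> R) (V t : R) :
  indep_on (index_enum I) X ->
  (forall i B, measurable B -> P (X i @^-1` B) = gam B) ->
  (forall i, measurable_fun setT (f i)) -> (forall i x, 0 <= f i x) ->
  (forall i, (\int[gam]_x (f i x)%:E = (mu i)%:E)%E) ->
  (forall i, (\int[gam]_x (f i x ^+ 2)%:E <= V%:E)%E) -> 0 < t ->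
  (P [set w | (t <= `|\sum_i f i (X i w) - \sum_i mu i|)%R] <= (#|I|%:R * V / t ^+ 2)%R%:E)%E.
Proof.
move=> ind law mf f0 emu eV t0; apply: independent_chebyshev => //.
  by move=> i; rewrite (law_integral (law i)).
move=> i; rewrite (@law_integral _ (fun x => f i x ^+ 2) (law i))//; last first.
  by move=> x; exact: sqr_ge0.
exact: measurable_funX.
Qed.

End GaussianSums.

(** * Smallest singular value on a cone *)

Section EventBounds.
Context {R : realType} {d : measure_display} {T : measurableType d}.
Variable P : probability T R.

Lemma prob_compl_le (A : set T) (e : R) : measurable A ->
  (P (~` A) <= e%:E)%E -> ((1 - e)%:E <= P A)%E.
Proof.
move=> mA; rewrite probability_setC// -(@fineK _ (P A)) ?fin_num_measure//.
by rewrite -EFinD !lee_fin; lra.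
Qed.

Lemma prob_compl_ge (A : set T) (e : R) : measurable A ->
  ((1 - e)%:E <= P A)%E -> (P (~` A) <= e%:E)%E.
Proof.
move=> mA; rewrite probability_setC// -(@fineK _ (P A)) ?fin_num_measure//.
by rewrite -EFinD !lee_fin; lra.
Qed.

Lemma prob_complI (A B : set T) (a b : R) : measurable A -> measurable B ->
  (P (~` A) <= a%:E)%E -> (P (~` B) <= b%:E)%E -> (P (~` (A `&` B)) <= (a + b)%:E)%E.
Proof.
move=> mA mB hA hB; rewrite setCI EFinD.
apply: le_trans (leeD hA hB); apply: measureU2; exact: measurableC.
Qed.

Lemma prob_sub_le (A B : set T) (e : R) : measurable A -> measurable B -> A `<=` B ->
  (P B <= e%:E)%E -> (P A <= e%:E)%E.
Proof. by move=> mA mB AB; apply: le_trans; apply: le_measure => //; rewrite inE. Qed.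

End EventBounds.

Section Discretisation.
Context {R : realType}.

(** Passing from the points of a net to all unit vectors costs a constant factor
    as long as the mesh is small against the Frobenius norm. *)
Lemma net_lower_bound (n N : nat) (G : 'I_n -> 'I_N -> R) (u v : {ffun 'I_N -> R})
    (a e F : R) : 0 <= e -> (forall j, `|u j - v j| <= e) ->
  \sum_i \sum_j G i j ^+ 2 <= F -> F * (N%:R * e ^+ 2) <= a / 4 ->
  a <= \sum_i (\sum_j G i j * v j) ^+ 2 -> a / 4 <= \sum_i (\sum_j G i j * u j) ^+ 2.
Proof.
move=> e0 uv GF Fa av.
have d1 : \sum_j (u j - v j) ^+ 2 <= N%:R * e ^+ 2.
  apply: (@le_trans _ _ (\sum_(j < N) e ^+ 2)); last by rewrite sumr_const card_ord mulr_natl.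
  apply: ler_sum => j _; rewrite -[(_ - _) ^+ 2]real_normK ?num_real//.
  by rewrite lerXn2r// nnegrE.
have d2 : \sum_i (\sum_j G i j * (u j - v j)) ^+ 2 <= a / 4.
  apply: le_trans Fa; apply: (@le_trans _ _ (\sum_i (\sum_j G i j ^+ 2) * (N%:R * e ^+ 2))).
    apply: ler_sum => i _; apply: le_trans (cauchy_schwarz _ _) _.
    by apply: ler_wpM2l => //; apply: sumr_ge0 => j _; exact: sqr_ge0.
  by rewrite -mulr_suml; apply: ler_wpM2r => //; rewrite mulr_ge0// sqr_ge0.
have : \sum_i (\sum_j G i j * v j) ^+ 2 <=
   2 * \sum_i (\sum_j G i j * u j) ^+ 2 + 2 * \sum_i (\sum_j G i j * (u j - v j)) ^+ 2.
  rewrite !mulr_sumr -big_split/=; apply: ler_sum => i _.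
  have -> : \sum_j G i j * v j = \sum_j G i j * u j - \sum_j G i j * (u j - v j).
    by rewrite -sumrB; apply: eq_bigr => j _; ring.
  set x := \sum_j _; set y := \sum_j _; have := sqr_ge0 (x + y); lra.
lra.
Qed.

Lemma l1_driftZ (N : nat) (s u : 'I_N -> R) (c : R) : 0 <= c ->
  l1_drift s (fun j => c * u j) = c * l1_drift s u.
Proof.
move=> c0; rewrite /l1_drift mulr_sumr; apply: eq_bigr => j _; case: ifP => _.
  by rewrite normrM ger0_norm.
ring.
Qed.

End Discretisation.

Section GaussianMatrix.
Context {R : realType} {d : measure_display} {T : measurableType d}.
Variable P : probability T R.
Variables (n N : nat) (Z : 'I_n.+1 * 'I_N.+1 -> {RV P >-> R}).
Hypothesis indZ : mutually_independent Z.
Hypothesis lawZ : forall k B, measurable B -> P (Z k @^-1` B) = normal_prob 0 1 B.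
Local Notation L := (N.+1%:R : R).

(** The first row and column of the design supply the auxiliary Gaussian
    vectors; the two sides of the comparison are never used jointly, so they
    may share entries. *)
Definition entry (k : @gordon_index n N.+1) : 'I_n.+1 * 'I_N.+1 :=
  match k with
  | inl (inl ij) => (lift ord0 ij.1, ij.2)
  | inl (inr _) => (ord0, ord0)
  | inr (inl i) => (lift ord0 i, ord0)
  | inr (inr j) => (ord0, j)
  end.

Local Notation W := (fun k => Z (entry k)).

Lemma indep_entry_mat : indep_on Jmat W.
Proof.
apply: indep_on_comp => // a b /mapP[x _ ->] /mapP[y _ ->].
case: x => [[i j]|[]]; case: y => [[i' j']|[]] //= [].
by move=> /val_inj -> ->.
Qed.

Lemma indep_entry_vec : indep_on Jvec W.
Proof.
apply: indep_on_comp => // a b /mapP[x _ ->] /mapP[y _ ->].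
case: x => [i|j]; case: y => [i'|j'] //= [].
  by move=> /val_inj ->.
by move=> ->.
Qed.

Lemma all_above_vec (us : seq {ffun 'I_N.+1 -> R}) (s : 'I_N.+1 -> R) (t V D c kap : R) :
  0 <= t -> 0 <= V -> 0 < D -> (forall u, u \in us -> unit_vec u /\ l1_drift s u <= kap * Num.sqrt L) ->
  4 * c <= Num.sqrt (V + 2 * D) - Num.sqrt (V + D) -> t * kap <= c ->
  forall w, (V + 2 * D) * L <= \sum_i Z (lift ord0 i, ord0) w ^+ 2 ->
   \sum_j excess t (s j) (Z (ord0, j) w) <= (V + D) * L ->
  all_above W us Jvec (3 * c * Num.sqrt L) w.
Proof.
move=> t0 V0 D0 usK c4 tk w hg he u uus; have [u1 ul] := usK u uus.
have inv k : (inr k : @gordon_index n N.+1) \in Jvec.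
  by rewrite mem_map ?mem_enum// => a b [].
have ninv k : (inl k : @gordon_index n N.+1) \in Jvec = false.
  by apply/negbTE/negP => /mapP[].
have rE : rval (rcoef u) (partial_family W Jvec w) = \sum_j Z (ord0, j) w * u j.
  by rewrite gordon_rvalE /partial_family ninv add0r; apply: eq_bigr => j _; rewrite inv.
have wE i : wval (wcoef u) i (partial_family W Jvec w) = Z (lift ord0 i, ord0) w.
  rewrite gordon_wvalE /partial_family inv big1 ?add0r// => j _.
  by rewrite ninv mul0r.
rewrite /gy /yval /nval rE; under eq_bigr => i _ do rewrite wE.
have H1 := @linear_lower_bound _ _ s (fun j => Z (ord0, j) w) u t t0 u1.
have H2 : Num.sqrt (V + 2 * D) * Num.sqrt L <= Num.sqrt (1 + \sum_i Z (lift ord0 i, ord0) w ^+ 2).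
  rewrite -sqrtrM; last by lra.
  by apply: ler_wsqrtr; apply: le_trans hg _; rewrite lerDr.
have H3 : Num.sqrt (\sum_j excess t (s j) (Z (ord0, j) w)) <= Num.sqrt (V + D) * Num.sqrt L.
  by rewrite -sqrtrM; [exact: ler_wsqrtr|lra].
have L0 : 0 <= Num.sqrt L by exact: sqrtr_ge0.
have H4 : t * l1_drift s u <= c * Num.sqrt L.
  apply: (@le_trans _ _ (t * (kap * Num.sqrt L))); first exact: ler_wpM2l.
  by rewrite mulrA ler_wpM2r.
have H5 : 4 * c * Num.sqrt L <= (Num.sqrt (V + 2 * D) - Num.sqrt (V + D)) * Num.sqrt L by rewrite ler_wpM2r.
rewrite /= in H1 *; lra.
Qed.

Lemma prob_all_above_vec (us : seq {ffun 'I_N.+1 -> R}) (s : 'I_N.+1 -> R) (t V D C c kap : R) :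
  0 <= t -> 0 <= V -> 0 < D -> (forall u, u \in us -> unit_vec u /\ l1_drift s u <= kap * Num.sqrt L) ->
  4 * c <= Num.sqrt (V + 2 * D) - Num.sqrt (V + D) -> t * kap <= c ->
  (forall j, s j = 0 \/ s j ^+ 2 = 1) -> \sum_j excess_mean t (s j) <= V * L ->
  (V + 5 / 2 * D) * L <= n%:R -> n%:R <= C * L ->
  (P (~` all_above W us Jvec (3 * c * Num.sqrt L)) <=
    (((4 * C * moment4 + 8 * moment4 + 8 * t ^+ 4) / D ^+ 2) / L)%:E)%E.
Proof.
move=> t0 V0 D0 usK c4 tk hs em nl nu.
have L0 : 0 < L by [].
have Hg : (P [set w | D / 2 * L <= `|\sum_i Z (lift ord0 i, ord0) w ^+ 2 - \sum_(i < n) 1|]%R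
    <= (n%:R * moment4 / (D / 2 * L) ^+ 2)%:E)%E.
  rewrite (_ : n%:R * moment4 = #|'I_n|%:R * moment4); last by rewrite card_ord.
  apply: (@gauss_chebyshev _ _ _ P _ (fun i => Z (lift ord0 i, ord0)) (fun _ x => x ^+ 2) (fun=> 1)) => //.
  - by apply: indep_on_comp => // i j _ _ [] /val_inj.
  - by move=> i B; exact: lawZ.
  - by move=> i x; exact: sqr_ge0.
  - by move=> i; exact: gauss_second_moment.
  - by move=> i; under eq_integral => x _ do rewrite -exprM; rewrite moment4E.
  - by rewrite mulr_gt0// divr_gt0.
have He : (P [set w | D * L <= `|\sum_j excess t (s j) (Z (ord0, j) w) - \sum_j excess_mean t (s j)|]%R
    <= (L * (8 * moment4 + 8 * t ^+ 4) / (D * L) ^+ 2)%:E)%E.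
  rewrite (_ : L * _ = #|'I_N.+1|%:R * (8 * moment4 + 8 * t ^+ 4)); last by rewrite card_ord.
  apply: (@gauss_chebyshev _ _ _ P _ (fun j => Z (ord0, j)) (fun j x => excess t (s j) x)) => //.
  - by apply: indep_on_comp => // i j _ _ [].
  - by move=> i B; exact: lawZ.
  - by move=> i; exact: measurable_excess.
  - by move=> i x; exact: excess_ge0.
  - by move=> i; exact: excess_moment.
  - by move=> i; exact: excess_moment2.
  - by rewrite mulr_gt0.
pose f1 w := \sum_i Z (lift ord0 i, ord0) w ^+ 2.
pose f2 w := \sum_j excess t (s j) (Z (ord0, j) w).
have mf1 : measurable_fun setT f1.
  by apply: measurable_sum => i; exact: measurable_funX.
have mf2 : measurable_fun setT f2.
  by apply: measurable_sum => j; exact: (measurableT_comp (measurable_excess _ _)).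
have mabs (f : T -> R) (a b : R) : measurable_fun setT f -> measurable [set w | a <= `|f w - b|].
  move=> mf; apply: (measurable_set_le (f := cst a)) => //.
  by apply: measurableT_comp => //; exact: measurable_funB.
pose A1 := [set w | D / 2 * L <= `|f1 w - \sum_(i < n) 1|].
pose A2 := [set w | D * L <= `|f2 w - \sum_j excess_mean t (s j)|].
have mA1 : measurable A1 by exact: mabs.
have mA2 : measurable A2 by exact: mabs.
apply: (@prob_sub_le _ _ _ P _ (A1 `|` A2)).
- by apply: measurableC; exact: measurable_all_above.
- exact: measurableU.
- move=> w; apply: contra_notP => /not_orP[/= /negP h1 /negP h2].
  rewrite -ltNge in h1; rewrite -ltNge in h2.
  move: h1 h2; rewrite !ltr_norml sumr_const card_ord => /andP[h1 h1'] /andP[h2 h2'].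
  by apply: (all_above_vec t0 V0 D0 usK c4 tk); rewrite -/(f1 w) -/(f2 w); lra.
apply: (@le_trans _ _ (P A1 + P A2)%E); first exact: measureU2.
apply: le_trans (leeD Hg He) _; rewrite -EFinD lee_fin.
have -> : (4 * C * moment4 + 8 * moment4 + 8 * t ^+ 4) / D ^+ 2 / L =
  (C * L) * moment4 / (D / 2 * L) ^+ 2 + L * (8 * moment4 + 8 * t ^+ 4) / (D * L) ^+ 2.
  by field; rewrite !gt_eqF.
rewrite lerD2r ler_wpM2r ?invr_ge0 ?sqr_ge0//.
by rewrite ler_wpM2r// moment4_ge0.
Qed.

End GaussianMatrix.

Section RestrictedSingularValue.
Context {R : realType}.

Lemma soft_var_ge0 (t : R) : 0 <= t -> 0 <= soft_var t.
Proof.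
move=> t0; rewrite -lee_fin -gauss_soft_moment//; apply: integral_ge0 => x _.
by rewrite lee_fin sqr_ge0.
Qed.

Lemma sum_excess_mean (N : nat) (s : 'I_N -> R) (t rho : R) : 0 <= t ->
  #|[set j | s j != 0]%SET|%:R <= rho * N%:R ->
  \sum_j excess_mean t (s j) <= (rho * (1 + t ^+ 2) + (1 - rho) * soft_var t) * N%:R.
Proof.
move=> t0 hS; set S := [set j | _]%SET in hS.
have -> : \sum_j excess_mean t (s j) = N%:R * soft_var t + #|S|%:R * (1 + t ^+ 2 - soft_var t).
  have -> : N%:R = \sum_(j < N) (1 : R) by rewrite sumr_const card_ord.
  have -> : #|S|%:R = \sum_(j < N) (s j != 0)%:R :> R.
    by rewrite -sum1_card natr_sum big_mkcond; apply: eq_bigr => j _; rewrite inE; case: eqP.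
  rewrite !mulr_suml -big_split/=; apply: eq_bigr => j _.
  by rewrite /excess_mean; case: eqP => _ /=; ring.
have : 0 <= (1 + t ^+ 2 - soft_var t).
  by have := soft_var_le1 t0; have := sqr_ge0 t; lra.
move=> h; have := ler_wpM2r h hS; lra.
Qed.

Section Model.
Context {d : measure_display} {T : measurableType d}.
Variable P : probability T R.
Variables (n N : nat) (Z : 'I_n.+1 * 'I_N.+1 -> {RV P >-> R}).
Hypothesis indZ : mutually_independent Z.
Hypothesis lawZ : forall k B, measurable B -> P (Z k @^-1` B) = normal_prob 0 1 B.
Local Notation L := (N.+1%:R : R).
Local Notation W := (fun k => Z (@entry n N k)).

Definition frobenius (w : T) : R := \sum_i \sum_j Z (lift ord0 i, j) w ^+ 2.

Lemma measurable_frobenius : measurable_fun setT frobenius.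
Proof.
by apply: measurable_sum => i; apply: measurable_sum => j; exact: measurable_funX.
Qed.

Lemma second_moment k : (\int[P]_w (Z k w ^+ 2)%:E = 1)%E.
Proof.
rewrite (@law_integral _ _ _ P (Z k) (fun x => x ^+ 2) (lawZ k)).
- exact: gauss_second_moment.
- exact: exprn_measurable.
- by move=> x; exact: sqr_ge0.
Qed.

Lemma second_momentE k : P.-integrable setT (EFin \o (fun w => Z k w ^+ 2)) /\
  EP P (fun w => Z k w ^+ 2) = 1.
Proof.
have m : measurable_fun setT (fun w => Z k w ^+ 2) by exact: measurable_funX.
have p w : 0 <= Z k w ^+ 2 by exact: sqr_ge0.
have [] := @EP_fin _ _ _ P _ m p; first by rewrite second_moment ltry.
by move=> h; rewrite second_moment => /eqP; rewrite eqe => /eqP.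
Qed.

Lemma prob_frobenius (F : R) : 0 < F ->
  (P (~` [set w | (frobenius w <= F)%R]) <= (n%:R * L / F)%:E)%E.
Proof.
move=> F0.
have s1 i := EP_sum (index_enum 'I_N.+1) (fun j => proj1 (second_momentE (lift ord0 i, j))).
have [i2 e2] := EP_sum (index_enum 'I_n) (fun i => proj1 (s1 i)).
have f0 w : 0 <= frobenius w by apply: sumr_ge0 => i _; apply: sumr_ge0 => j _; exact: sqr_ge0.
have mf := measurable_frobenius.
apply: (@prob_sub_le _ _ _ P _ [set w | F <= frobenius w]).
- by apply: measurableC; apply: measurable_set_le => //; exact: measurable_cst.
- by apply: (measurable_set_le (f := cst F)).
- by move=> w /= /negP; rewrite -ltNge => /ltW.
apply: le_trans (markov_ge0 i2 f0 F0) _.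
rewrite lee_fin e2 ler_wpM2r ?invr_ge0 ?(ltW F0)//.
under eq_bigr => i _.
  rewrite (proj2 (s1 i)).
  under eq_bigr => j _ do rewrite (proj2 (second_momentE _)).
  rewrite sumr_const card_ord; over.
by rewrite sumr_const card_ord -[leLHS]mulr_natl.
Qed.

Lemma prob_corner (a : R) : 0 < a ->
  (P (~` [set w | (Z (ord0, ord0) w <= a)%R]) <= (1 / a ^+ 2)%:E)%E.
Proof.
move=> a0; have [i2 e2] := second_momentE (ord0, ord0).
have mf : measurable_fun setT (fun w => Z (ord0, ord0) w ^+ 2) by exact: measurable_funX.
apply: (@prob_sub_le _ _ _ P _ [set w | a ^+ 2 <= Z (ord0, ord0) w ^+ 2]).
- by apply: measurableC; apply: measurable_set_le => //; exact: measurable_cst.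
- by apply: (measurable_set_le (f := cst (a ^+ 2))).
- move=> w /= /negP; rewrite -ltNge => h.
  by rewrite lerXn2r ?nnegrE ?ltW// (lt_trans a0).
apply: le_trans (markov_ge0 i2 (fun w => sqr_ge0 _) (exprn_gt0 2 a0)) _.
by rewrite e2.
Qed.

Lemma gy_matE (u : {ffun 'I_N.+1 -> R}) w : gy u (partial_family W Jmat w) =
  Num.sqrt (1 + \sum_i (\sum_j Z (lift ord0 i, j) w * u j) ^+ 2) + Z (ord0, ord0) w.
Proof.
have inm k : (inl k : @gordon_index n N.+1) \in Jmat.
  by rewrite mem_map ?mem_enum// => a b [].
have nm k : (inr k : @gordon_index n N.+1) \in Jmat = false.
  by apply/negbTE/negP => /mapP[].
rewrite /gy /yval /nval; congr (Num.sqrt (1 + _) + _).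
  apply: eq_bigr => i _; rewrite gordon_wvalE /partial_family nm addr0.
  by congr (_ ^+ 2); apply: eq_bigr => j _; rewrite inm.
rewrite gordon_rvalE /partial_family inm big1 ?addr0// => j _.
by rewrite nm mul0r.
Qed.

End Model.

(** Let [G] be the matrix without its first row. By the comparison,
    [|G u| + gamma] is on the net at least [|g| + <h, u>] up to [o(sqrt N)]. Here
    [|g|] is close to [sqrt n], and linear_lower_bound keeps [<h, u>] above minus
    [sqrt (V N)], where [V < dl] is the left-hand side of the hypothesis, up to
    the drift. The net is as fine as the Frobenius norm of [G] requires; this
    does not affect the constants. *)
Theorem restricted_singular_value (t rho dl : R) : 0 <= t -> 0 <= rho <= 1 ->
  rho * (1 + t ^+ 2) + (1 - rho) * soft_var t < dl ->
  exists kap c eta : R, [/\ 0 < kap, 0 < c, 0 < eta &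
  forall th : R, 0 < th -> exists N1 : R, forall n N : nat, N1 <= N.+1%:R ->
    (dl - eta) * N.+1%:R <= n%:R -> n%:R <= (dl + 1) * N.+1%:R ->
  forall s : 'I_N.+1 -> R, (forall j, s j = 0 \/ s j ^+ 2 = 1) ->
    #|[set j | s j != 0]%SET|%:R <= rho * N.+1%:R ->
  forall (d : measure_display) (T : measurableType d) (P : probability T R)
    (Z : 'I_n.+1 * 'I_N.+1 -> {RV P >-> R}), mutually_independent Z ->
    (forall k B, measurable B -> P (Z k @^-1` B) = normal_prob 0 1 B) ->
  exists E : set T, [/\ measurable E, ((1 - th)%:E <= P E)%E &
    forall w, E w -> forall h : 'I_N.+1 -> R,
      l1_drift s h <= kap * Num.sqrt (N.+1%:R * \sum_j h j ^+ 2) ->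
      c * N.+1%:R * \sum_j h j ^+ 2 <= \sum_i (\sum_j Z (i, j) w * h j) ^+ 2]].
Proof.
move=> t0 /andP[r0 r1] Vdl.
set V := (_ + _) in Vdl.
have sv0 := soft_var_ge0 t0.
have V0 : 0 <= V by rewrite /V addr_ge0// mulr_ge0// ?subr_ge0// addr_ge0// sqr_ge0.
(* One third of the gap is spent on each of the two empirical means, which
   leaves room between sqrt (V + D) and sqrt (V + 2 * D). *)
pose D := (dl - V) / 3.
have D0 : 0 < D by rewrite /D divr_gt0// subr_gt0.
pose c0 := (Num.sqrt (V + 2 * D) - Num.sqrt (V + D)) / 4.
have c00 : 0 < c0.
  rewrite /c0 divr_gt0// subr_gt0 ltr_sqrt; lra.
pose kap := c0 / (t + 1).
have t10 : 0 < t + 1 by lra.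
have kap0 : 0 < kap by rewrite divr_gt0.
exists kap, (c0 ^+ 2 / 4), (D / 2); split => //.
- by rewrite divr_gt0// exprn_gt0.
- by rewrite divr_gt0.
move=> th th0.
pose K1 := (4 * (dl + 1) * moment4 + 8 * moment4 + 8 * t ^+ 4) / D ^+ 2.
have K10 : 0 <= K1.
  have m0 := @moment4_ge0 R; have : 0 <= t ^+ 4 by rewrite exprn_ge0.
  have dl0 : 0 <= dl + 1 by lra.
  by move=> t40; rewrite divr_ge0 ?sqr_ge0// !addr_ge0// ?mulr_ge0.
have c02 : 0 < c0 ^+ 2 by rewrite exprn_gt0.
exists (4 * K1 / th + 16 / (c0 ^+ 2 * th) + 1 / c0 ^+ 2) => n N hN nl nu s hs cs d T P Z indZ lawZ.
set L : R := N.+1%:R.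
have L0 : 0 < L by [].
have sL0 : 0 < Num.sqrt L by rewrite sqrtr_gt0.
have sLL : Num.sqrt L ^+ 2 = L by rewrite sqr_sqrtr ?ltW.
have p1 : 0 <= 4 * K1 / th by apply: divr_ge0; [exact: mulr_ge0|exact: ltW].
have p2 : 0 <= 16 / (c0 ^+ 2 * th) by rewrite divr_ge0// ltW// mulr_gt0.
have p3 : 0 <= 1 / c0 ^+ 2 by rewrite divr_ge0 ?(ltW c02).
have L1 : K1 / L <= th / 4.
  have : 4 * K1 / th <= L by apply: le_trans hN; lra.
  rewrite (ler_pdivrMr _ _ th0) (ler_pdivrMr _ _ L0); clearbody K1 L; lra.
have L2 : 4 / (c0 ^+ 2 * L) <= th / 4.
  have : 16 / (c0 ^+ 2 * th) <= L by apply: le_trans hN; lra.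
  rewrite (ler_pdivrMr _ _ (mulr_gt0 c02 th0)) (ler_pdivrMr _ _ (mulr_gt0 c02 L0)); clearbody c0 L; lra.
have L3 : 1 <= c0 ^+ 2 * L.
  have : 1 / c0 ^+ 2 <= L by apply: le_trans hN; lra.
  by rewrite (ler_pdivrMr _ _ c02) mulrC.
pose K : set {ffun 'I_N.+1 -> R} := [set u | unit_vec u /\ l1_drift s u <= kap * Num.sqrt L].
pose F := n%:R * L * 4 / th + 1.
have F0 : 0 < F by rewrite /F ltr_wpDl// divr_ge0 ?(ltW th0)// !mulr_ge0.
(* Chosen so that F * e ^ 2 <= c0 ^ 2 / 4. *)
pose e := c0 / (2 * (F + 1)).
have F10 : 0 < F + 1 by lra.
have e0 : 0 < e by rewrite divr_gt0// mulr_gt0.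
have [us [usK net]] := @net_exists R N.+1 K e e0 (fun u Ku j => unit_vec_le1 j (proj1 Ku)).
pose W := fun k => Z (@entry n N k).
have E1 : (P (~` all_above W us Jvec (3 * c0 * Num.sqrt L)) <= (K1 / L)%:E)%E.
  apply: (@prob_all_above_vec _ _ _ P n N Z indZ lawZ us s t V D (dl + 1) c0 kap) => //.
  - by rewrite /c0; lra.
  - by rewrite /kap mulrA ler_pdivrMr// mulrC ler_wpM2l ?(ltW c00)//; lra.
  - exact: sum_excess_mean.
  - by apply: le_trans nl; rewrite ler_wpM2r ?(ltW L0)// /D; lra.
have us1 u : u \in us -> unit_vec u by move=> /usK[].
have mvec := measurable_all_above W us Jvec; have mmat := measurable_all_above W us Jmat.
have E2 : (P (~` all_above W us Jmat (2 * c0 * Num.sqrt L)) <= (K1 / L + th / 4)%:E)%E.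
  have c0L : 0 < c0 * Num.sqrt L by rewrite mulr_gt0.
  have th8 : 0 < th / 8 by rewrite divr_gt0.
  have t2 : 0 < c0 * Num.sqrt L / 2 by rewrite divr_gt0.
  have := gordon_prob (indep_entry_mat indZ) (indep_entry_vec indZ) (fun j => lawZ _)
    us1 (5 / 2 * (c0 * Num.sqrt L)) t2 th8.
  have -> : 5 / 2 * (c0 * Num.sqrt L) + c0 * Num.sqrt L / 2 = 3 * c0 * Num.sqrt L by field.
  have -> : 5 / 2 * (c0 * Num.sqrt L) - c0 * Num.sqrt L / 2 = 2 * c0 * Num.sqrt L by field.
  have := prob_compl_le (mvec _) E1; rewrite -/W.
  move=> /le_trans h /h; rewrite -(@fineK _ (P (all_above W us Jmat _))) ?fin_num_measure//.
  rewrite -EFinD lee_fin => {}h; apply: prob_compl_ge => //.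
  rewrite -(@fineK _ (P (all_above W us Jmat _))) ?fin_num_measure//.
  rewrite lee_fin; move: h; set pr := fine _; set k := K1 / L.
  by clearbody pr k; move=> h; lra.
have c0L2 : 0 < c0 * Num.sqrt L / 2 by rewrite divr_gt0// mulr_gt0.
have E3 := prob_corner lawZ c0L2.
have E4 := prob_frobenius lawZ F0.
pose A3 := [set w | Z (ord0, ord0) w <= c0 * Num.sqrt L / 2].
pose A4 := [set w | frobenius Z w <= F].
have mA3 : measurable A3 by apply: measurable_set_le => //; exact: measurable_cst.
have mA4 : measurable A4 by apply: measurable_set_le; [exact: measurable_frobenius|exact: measurable_cst].
exists (all_above W us Jmat (2 * c0 * Num.sqrt L) `&` A3 `&` A4); split.
- by apply: measurableI => //; exact: measurableI.
- apply: prob_compl_le; first by apply: measurableI => //; exact: measurableI.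
  have := prob_complI (measurableI _ _ (mmat _) mA3) mA4 (prob_complI (mmat _) mA3 E2 E3) E4.
  move=> /le_trans; apply; rewrite lee_fin.
  have -> : 1 / (c0 * Num.sqrt L / 2) ^+ 2 = 4 / (c0 ^+ 2 * L).
    by rewrite -[in RHS]sLL; field; rewrite !gt_eqF.
  have : n%:R * L / F <= th / 4.
    rewrite ler_pdivrMr// /F mulrDr mulr1.
    have -> : th / 4 * (n%:R * L * 4 / th) = n%:R * L by field; rewrite gt_eqF.
    by rewrite lerDl divr_ge0// ltW.
  move: L1 L2; set x1 := K1 / L; set x2 := 4 / _; set x3 := _ / F.
  by clearbody x1 x2 x3; lra.
move=> w [[wa w3] w4] h hd.
pose H := \sum_j h j ^+ 2.
have H0 : 0 <= H by apply: sumr_ge0 => j _; exact: sqr_ge0.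
have step1 : \sum_(i < n) (\sum_j Z (lift ord0 i, j) w * h j) ^+ 2 <=
   \sum_i (\sum_j Z (i, j) w * h j) ^+ 2.
  by rewrite [leRHS]big_ord_recl lerDr sqr_ge0.
apply: le_trans step1.
have [H00|Hn0] := eqVneq H 0.
  by rewrite -/H H00 mulr0; apply: sumr_ge0 => i _; exact: sqr_ge0.
have Hp : 0 < H by rewrite lt_neqAle eq_sym Hn0.
pose r := Num.sqrt H.
have rp : 0 < r by rewrite sqrtr_gt0.
have rr : r ^+ 2 = H by rewrite sqr_sqrtr.
pose u : {ffun 'I_N.+1 -> R} := [ffun j => r^-1 * h j].
have Ku : K u.
  split.
    rewrite /unit_vec; under eq_bigr do rewrite ffunE exprMn.
    by rewrite -mulr_sumr -/H exprVn rr mulVf.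
  have -> : l1_drift s u = r^-1 * l1_drift s h.
    rewrite -l1_driftZ ?invr_ge0 ?(ltW rp)//; congr (l1_drift s _).
    by apply/funext => j; rewrite ffunE.
  rewrite mulrC ler_pdivrMr//; apply: le_trans hd _.
  by rewrite sqrtrM ?(ltW L0)// -/H -/r mulrA.
have [v vus uv] := net u Ku.
have main : c0 ^+ 2 * L / 4 <= \sum_(i < n) (\sum_j Z (lift ord0 i, j) w * u j) ^+ 2.
  apply: (@net_lower_bound _ _ _ (fun i j => Z (lift ord0 i, j) w) u v _ e F (ltW e0) uv w4).
    rewrite -/L /e.
    have -> : F * (L * (c0 / (2 * (F + 1))) ^+ 2) = (c0 ^+ 2 * L / 4) * (F / (F + 1) ^+ 2).
      by field; rewrite gt_eqF.
    apply: ler_piMr; first by rewrite divr_ge0// mulr_ge0 ?(ltW c02) ?(ltW L0).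
    by rewrite ler_pdivrMr ?exprn_gt0//; nra.
  have := wa v vus; rewrite gy_matE.
  set S := \sum_i _; move: w3; rewrite /A3/= => w3 h1.
  have S0 : 0 <= S by apply: sumr_ge0 => i _; exact: sqr_ge0.
  have h2 : 3 / 2 * (c0 * Num.sqrt L) <= Num.sqrt (1 + S) by lra.
  have h3 : (3 / 2 * (c0 * Num.sqrt L)) ^+ 2 <= 1 + S.
    rewrite -[leRHS]sqr_sqrtr; last by lra.
    by rewrite lerXn2r// nnegrE ?sqrtr_ge0// mulr_ge0// mulr_ge0// ltW.
  have h4 : (3 / 2 * (c0 * Num.sqrt L)) ^+ 2 = 9 / 4 * (c0 ^+ 2 * L) by rewrite -[in RHS]sLL; field.
  lra.
have hu : \sum_(i < n) (\sum_j Z (lift ord0 i, j) w * h j) ^+ 2 =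
   H * \sum_(i < n) (\sum_j Z (lift ord0 i, j) w * u j) ^+ 2.
  rewrite mulr_sumr; apply: eq_bigr => i _; rewrite -rr -exprMn; congr (_ ^+ 2).
  rewrite mulr_sumr; apply: eq_bigr => j _; rewrite ffunE.
  by field; rewrite gt_eqF.
rewrite hu -/H; have := ler_wpM2l H0 main; rewrite -/L; lra.
Qed.

End RestrictedSingularValue.

(** * Conditioning on the signs of the coefficients *)

Section NormalScaling.
Context {R : realType}.
Local Notation mu := (@lebesgue_measure R).

Lemma normal_pdf_scale (s x : R) : 0 < s -> normal_pdf 0 s x = normal_pdf 0 1 (s^-1 * x + 0) * s^-1.
Proof.
move=> s0; rewrite !normal_pdfE ?gt_eqF// /normal_peak /normal_fun.
have -> : s ^+ 2 * pi *+ 2 = s ^+ 2 * (1 ^+ 2 * pi *+ 2) by rewrite expr1n mul1r mulrnAr.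
rewrite sqrtrM ?sqr_ge0// sqrtr_sqr gtr0_norm// invfM [RHS]mulrAC [_^-1 * s^-1]mulrC; congr (_ * expR _).
rewrite !subr0 addr0 expr1n !mulr2n; field.
by rewrite !gt_eqF ?addr_gt0 ?exprn_gt0.
Qed.

Lemma normal_prob_scale (s : R) (B : set R) : 0 < s -> measurable B ->
  normal_prob 0 s ((fun x => s^-1 * x) @^-1` B) = normal_prob 0 1 B.
Proof.
move=> s0 mB.
have si0 : 0 < s^-1 by rewrite invr_gt0.
have mh : measurable_fun setT (fun x : R => s^-1 * x) by apply: measurable_funM.
have mB' : measurable ((fun x : R => s^-1 * x) @^-1` B).
  by rewrite -[X in measurable X]setTI; exact: mh.
have ind (A : set R) (r : R) : measurable A -> 0 < r ->
    normal_prob 0 r A = (\int[mu]_x ((\1_A x * normal_pdf 0 r x)%:E))%E.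
  move=> mA r0.
  transitivity (\int[normal_prob 0 r]_x (\1_A x)%:E)%E.
    by rewrite integral_indic//= setIT.
  rewrite ge0_integral_normal_prob//.
  by apply/measurable_EFinP; exact: measurable_indic.
rewrite (ind _ _ mB' s0) (ind _ _ mB ltr01).
have mf : measurable_fun setT (fun x : R => \1_B x * normal_pdf 0 1 x).
  by apply: measurable_funM; [exact: measurable_indic|exact: measurable_normal_pdf].
rewrite -(ge0_integral_affine 0 si0 mf); last first.
  by move=> x; rewrite mulr_ge0// normal_pdf_ge0.
apply: eq_integral => x _; rewrite (normal_pdf_scale x s0) !addr0 mulrA.
by congr (_ * _ * _)%:E; rewrite !indicE.
Qed.

End NormalScaling.

Section Conditioning.
Context {R : realType} {d : measure_display} {T : measurableType d}.
Variable P : probability T R.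

Lemma conditional_probability (B : set T) : measurable B -> (0 < P B)%E ->
  exists Q : probability T R, forall A, measurable A -> (P (A `&` B) = Q A * P B)%E.
Proof.
move=> mB PB.
exists (mnormalize (mrestr P mB) P) => A mA.
rewrite /= /mnormalize /= /mrestr setTI.
have Pfin : P B \is a fin_num by exact: fin_num_measure.
rewrite (gt_eqF PB) /=; case: eqP => [h|_]; first by rewrite h in Pfin.
rewrite -muleA -{2}(fineK Pfin) -EFinM mulVf ?mule1//.
by rewrite gt_eqF// -lte_fin fineK.
Qed.

Lemma measurable_cylinder_set (I : finType) (U : I -> {RV P >-> R}) (S : {set I}) (A : I -> set R) :
  (forall i, measurable (A i)) -> measurable [set w | forall i, i \in S -> A i (U i w)].
Proof.
move=> mA; rewrite (_ : [set w | _] = \bigcap_(i in [set` S]) (U i @^-1` A i)).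
  apply: fin_bigcap_measurable; first exact: finite_finset.
  by move=> i _; have mU : measurable_fun setT (U i) by []; rewrite -[X in measurable X]setTI; exact: mU.
by apply/seteqP; split => w h i; exact: h.
Qed.

End Conditioning.

Section ConditionalIndependence.
Context {R : realType} {d : measure_display} {T : measurableType d}.
Variable P : probability T R.

(** This freezes the signs of the coefficients while the design keeps its law. *)
Lemma conditional_independent (I K : finType) (U : I -> {RV P >-> R}) (S : {set I})
    (A : I -> set R) (phi : K -> I) (g : R -> R) (Q : probability T R) :
  mutually_independent U -> (forall i, measurable (A i)) -> injective phi ->
  (forall k, phi k \notin S) -> measurable_fun setT g ->
  let B := [set w | forall i, i \in S -> A i (U i w)] in
  (0 < P B)%E -> (forall C, measurable C -> P (C `&` B) = (Q C * P B)%E) ->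
  forall V : K -> {RV Q >-> R}, (forall k w, V k w = g (U (phi k) w)) ->
  mutually_independent V /\
  forall k C, measurable C -> Q (V k @^-1` C) = P (U (phi k) @^-1` (g @^-1` C)).
Proof.
move=> indU mA phiI phiS mg B PB QB V VE.
have mgC (C : set R) : measurable C -> measurable (g @^-1` C).
  by move=> mC; rewrite -[X in measurable X]setTI; exact: mg.
have mVC k (C : set R) : measurable C -> measurable (V k @^-1` C).
  by move=> mC; have mV : measurable_fun setT (V k) by []; rewrite -[X in measurable X]setTI; exact: mV.
pose psi (x : K + I) := match x with inl k => phi k | inr i => i end.
pose js : seq (K + I)%type := [seq x <- enum {: K + I} | if x is inr i then i \in S else true].
have ind : indep_on js (fun x => U (psi x)).
  apply: indep_on_comp => // -[k|i] [k'|i'] /=; rewrite !mem_filter /=.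
  - by move=> _ _ /phiI ->.
  - by move=> _ /andP[iS _] e; move: (phiS k); rewrite e iS.
  - by move=> /andP[iS _] _ e; move: (phiS k'); rewrite -e iS.
  - by move=> _ _ ->.
have key (J : {set K}) (C : K -> set R) : (forall k, measurable (C k)) ->
    P ([set w | forall k, k \in J -> C k (V k w)] `&` B) =
    ((\prod_(k in J) P (U (phi k) @^-1` (g @^-1` C k))) * P B)%E.
  move=> mC.
  pose D x := match x with inl k => g @^-1` C k | inr i => A i end.
  have mD x : measurable (D x) by case: x => [k|i]; [exact: mgC|exact: mA].
  have PBE : P B = (\prod_(i in S) P (U i @^-1` A i))%E by exact: indU.
  pose J' := [set x : K + I | match x with inl k => k \in J | inr i => i \in S end]%SET.
  have J'js : {subset J' <= js}.
    by move=> -[k|i]; rewrite inE mem_filter mem_enum//= andbT.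
  have := ind J' D J'js mD; rewrite big_sumType/=.
  under eq_bigl => k do rewrite inE.
  under [X in (_ * X)%E]eq_bigl => i do rewrite inE.
  rewrite -PBE => <-; congr (P _); apply/seteqP; split => w /=.
    by move=> [h1 h2] [k|i]; rewrite inE /= => hk; [rewrite -VE; exact: h1|exact: h2].
  move=> h; split => [k kJ|i iS]; first by have := h (inl k); rewrite inE /= VE; apply.
  by have := h (inr i); rewrite inE; apply.
have Pfin : P B \is a fin_num.
  by rewrite fin_num_measure//; exact: (measurable_cylinder_set U S).
have cancelB (x y : \bar R) : (x * P B = y * P B -> x = y)%E.
  move=> /(congr1 (fun z => z * (fine (P B))^-1%:E)%E).
  have e : (P B * (fine (P B))^-1%:E = 1)%E.
    rewrite -{1}(fineK Pfin) -EFinM mulfV//.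
    by rewrite gt_eqF// -lte_fin fineK.
  by rewrite -!muleA e !mule1.
have law k C : measurable C -> Q (V k @^-1` C) = P (U (phi k) @^-1` (g @^-1` C)).
  move=> mC; apply: cancelB; rewrite -QB; last exact: mVC.
  have := key [set k]%SET (fun=> C) (fun=> mC); rewrite big_set1 => <-.
  congr (P _); apply/seteqP; split => w /= [h1 h2]; split => //.
    by move=> k'; rewrite inE => /eqP ->.
  by apply: h1; rewrite inE.
split => // J C mC; apply: cancelB; rewrite -QB.
  by rewrite key//; congr (_ * _)%E; apply: eq_bigr => k _; rewrite law.
exact: (measurable_cylinder_set V J).
Qed.

Lemma partition_prob (K : finType) (B E : K -> set T) (good : pred K) (th : R) :
  (forall k, measurable (B k)) -> (forall k, measurable (E k)) ->
  (forall j k w, B j w -> B k w -> j = k) -> 0 <= th <= 1 ->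
  (forall k, good k -> (1 - th)%:E * P (B k) <= P (E k `&` B k))%E ->
  ((1 - th)%:E * P (\bigcup_(k in good) B k) <= P (\bigcup_(k in good) (E k `&` B k)))%E.
Proof.
move=> mB mE dis /andP[th0 th1] h.
have fin : finite_set [set` good] by exact: finite_finset.
rewrite !measure_fin_bigcup//.
- rewrite ge0_mule_fsumr// ?lee_fin ?subr_ge0//; apply: lee_fsum => // k; exact: h.
- by move=> j k _ _ [w [[_ Bj] [_ Bk]]]; exact: (dis j k w).
- by move=> k _; exact: measurableI.
- by move=> j k _ _ [w [Bj Bk]]; exact: (dis j k w).
Qed.

End ConditionalIndependence.

Section Signs.
Context {R : realType}.

(** A finite type of signs, so that the sample space splits into finitely many
    measurable events. *)
Definition sign_code (y : R) : option bool := if y == 0 then None else Some (0 < y).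

Definition sign_val (o : option bool) : R :=
  match o with None => 0 | Some true => 1 | Some false => -1 end.

Lemma sign_codeK y : sign_val (sign_code y) = Num.sg y.
Proof.
rewrite /sign_code; case: eqP => [->|/eqP y0] /=; first by rewrite sgr0.
by case: (ltgtP 0 y) y0 => //= h _; [rewrite gtr0_sg|rewrite ltr0_sg].
Qed.

Lemma measurable_sign_code o : measurable [set y : R | sign_code y = o].
Proof.
case: o => [[]|].
- rewrite (_ : [set y | _] = `]0, +oo[%classic); first exact: measurable_itv.
  apply/seteqP; split => y /=; rewrite in_itv /= andbT /sign_code.
    by case: eqP => // _ [].
  by move=> y0; rewrite gt_eqF// y0.
- rewrite (_ : [set y | _] = `]-oo, 0[%classic); first exact: measurable_itv.
  apply/seteqP; split => y /=; rewrite in_itv /= /sign_code.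
    by case: eqP => // /eqP yn [] /negbT; rewrite -leNgt le_eqVlt (negbTE yn).
  by move=> y0; rewrite lt_eqF// ltNge (ltW y0).
- rewrite (_ : [set y | _] = [set 0]); first exact: measurable_set1.
  by apply/seteqP; split => y /=; rewrite /sign_code; case: eqP => // ->.
Qed.

(** The knockoff coordinates carry no signal. *)
Definition sign_pattern (p : nat) (b : 'I_p -> R) (j : 'I_(p + p)) : R :=
  match fintype.split j with inl i => Num.sg (b i) | inr _ => 0 end.

End Signs.

Section Design.
Context {R : realType}.

(** Conditionally on a sign pattern of the coefficients the design keeps its law,
    so restricted_singular_value applies with that deterministic pattern. The
    events obtained for the finitely many patterns of small support are glued
    together. *)
Theorem design_bound (t rho dl : R) : 0 <= t -> 0 <= rho <= 1 ->
  rho * (1 + t ^+ 2) + (1 - rho) * soft_var t < dl ->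
  exists kap c eta : R, [/\ 0 < kap, 0 < c, 0 < eta &
  forall th : R, 0 < th <= 1 -> exists N1 : R, forall n p : nat, N1 <= (p + p)%:R ->
    (0 < p)%N -> (0 < n)%N ->
    (dl - eta) * (p + p)%:R + 1 <= n%:R -> n%:R <= (dl + 1) * (p + p)%:R ->
  forall (d : measure_display) (T : measurableType d) (P : probability T R)
    (X Xt : 'I_n -> 'I_p -> {RV P >-> R}) (beta : 'I_p -> {RV P >-> R})
    (xi : 'I_n -> {RV P >-> R}) (sigma : R) (law : set R -> \bar R),
    knockoff_model X Xt beta xi sigma law ->
  let small := [set w | #|[set j | beta j w != 0]%SET|%:R <= rho * (p + p)%:R] in
  exists E : set T, [/\ measurable E, measurable small,
    ((1 - th)%:E * P small <= P E)%E &
    forall w, E w -> forall h : 'cV[R]_(p + p),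
      l1_drift (sign_pattern (fun j => beta j w)) (fun j => h j 0) <=
        kap * Num.sqrt ((p + p)%:R * \sum_j h j 0 ^+ 2) ->
      c * \sum_j h j 0 ^+ 2 <=
        \sum_i (row_mx (random_matrix X w) (random_matrix Xt w) *m h) i 0 ^+ 2]].
Proof.
move=> t0 rho01 Vdl.
have dl0 : 0 < dl.
  apply: le_lt_trans Vdl; case/andP: rho01 => r0 r1.
  by rewrite addr_ge0// mulr_ge0// ?subr_ge0// ?soft_var_ge0// addr_ge0// sqr_ge0.
have [kap [c [eta [kap0 c0 eta0 rsv]]]] := restricted_singular_value t0 rho01 Vdl.
have dl1 : 0 < dl + 1 by lra.
exists kap, (c / (dl + 1)), eta; split => //; first exact: divr_gt0.
move=> th /andP[th0 th1]; have [N1 {}rsv] := rsv th th0.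
have rsv' (n N : nat) : N1 <= N%:R -> (0 < N)%N -> (0 < n)%N ->
    (dl - eta) * N%:R + 1 <= n%:R -> n%:R <= (dl + 1) * N%:R ->
  forall s : 'I_N -> R, (forall j, s j = 0 \/ s j ^+ 2 = 1) ->
    #|[set j | s j != 0]%SET|%:R <= rho * N%:R ->
  forall (d : measure_display) (T : measurableType d) (P : probability T R)
    (Z : 'I_n * 'I_N -> {RV P >-> R}), mutually_independent Z ->
    (forall k B, measurable B -> P (Z k @^-1` B) = normal_prob 0 1 B) ->
  exists E : set T, [/\ measurable E, ((1 - th)%:E <= P E)%E &
    forall w, E w -> forall h : 'I_N -> R,
      l1_drift s h <= kap * Num.sqrt (N%:R * \sum_j h j ^+ 2) ->
      c * N%:R * \sum_j h j ^+ 2 <= \sum_i (\sum_j Z (i, j) w * h j) ^+ 2].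
  case: n N => [//|n] [//|N] hN _ _ nl nu; apply: rsv => //.
    by move: nl; rewrite -[n.+1%:R]natr1; lra.
  by apply: le_trans nu; rewrite ler_nat.
exists N1 => n p hN p0 n0 nl nu d T P X Xt beta xi sigma law [ind lX lXt _ _] small.
pose U := all_entries X Xt beta xi.
pose I := ((('I_n * 'I_p) + ('I_n * 'I_p) + 'I_p + 'I_n)%type : finType).
pose phi (k : 'I_n * 'I_(p + p)) : I := match fintype.split k.2 with
  | inl j => inl (inl (inl (k.1, j))) | inr j => inl (inl (inr (k.1, j))) end.
have phiI : injective phi.
  move=> [i j] [i' j']; rewrite /phi /= -{2}(fintype.splitK j) -{2}(fintype.splitK j').
  by case: (fintype.split j) => a; case: (fintype.split j') => b //= [-> ->].
pose S : {set I} := [set x : I | if x is inl (inr _) then true else false]%SET.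
have phiS k : phi k \notin S by rewrite inE /phi; case: fintype.split.
have n0R : 0 < n%:R^-1 :> R by rewrite invr_gt0 ltr0n.
pose sn : R := Num.sqrt n%:R^-1.
have sn0 : 0 < sn by rewrite sqrtr_gt0.
pose g (x : R) := sn^-1 * x.
have mg : measurable_fun setT g by apply: measurable_funM.
pose A (c : {ffun 'I_p -> option bool}) (x : I) : set R :=
  if x is inl (inr j) then [set y | sign_code y = c j] else setT.
have mA c' x : measurable (A c' x).
  by case: x => [[[?|?]|j]|?] //=; exact: measurable_sign_code.
pose B c' := [set w | forall x, x \in S -> A c' x (U x w)].
have mB c' : measurable (B c') by exact: measurable_cylinder_set.
have BE c' w : B c' w -> forall j, sign_code (beta j w) = c' j.
  by move=> h j; have := h (inl (inr j)); rewrite inE => /(_ isT).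
pose good (c' : {ffun 'I_p -> option bool}) :=
  #|[set j | c' j != None]%SET|%:R <= rho * (p + p)%:R :> R.
have smallE : small = \bigcup_(c' in good) B c'.
  have cnt w c' : (forall j, sign_code (beta j w) = c' j) ->
      [set j | c' j != None]%SET = [set j | beta j w != 0]%SET.
    move=> h; apply/setP => j; rewrite !inE -h /sign_code.
    by case: (beta j w == 0).
  apply/seteqP; split => w.
    move=> hw; exists [ffun j => sign_code (beta j w)].
      by rewrite /good /= (cnt w)// => j; rewrite ffunE.
    by move=> -[[[?|?]|j]|?]; rewrite inE //= ffunE.
  by move=> [c' gc Bc]; rewrite /small /= -(cnt w c')//; exact: BE.
have msmall : measurable small.
  by rewrite smallE; apply: fin_bigcup_measurable => //; exact: finite_finset.
pose prop c' w := forall h : 'cV[R]_(p + p),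
  l1_drift (fun j => match fintype.split j with inl i => sign_val (c' i) | inr _ => 0 end)
     (fun j => h j 0) <= kap * Num.sqrt ((p + p)%:R * \sum_j h j 0 ^+ 2) ->
  c / (dl + 1) * \sum_j h j 0 ^+ 2 <=
   \sum_i (row_mx (random_matrix X w) (random_matrix Xt w) *m h) i 0 ^+ 2.
have ex (c' : {ffun 'I_p -> option bool}) : exists E : set T, [/\ measurable E,
   good c' -> ((1 - th)%:E * P (B c') <= P (E `&` B c'))%E & forall w, E w -> prop c' w].
  have [gc|ng] := boolP (good c'); last first.
    by exists set0; split => // gc; rewrite gc in ng.
  have [PB0|PBn] := eqVneq (P (B c')) 0%E.
    by exists set0; split => //; rewrite PB0 mule0 set0I measure0.
  have PB : (0 < P (B c'))%E by rewrite lt0e PBn measure_ge0.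
  have [Q QB] := conditional_probability (mB c') PB.
  have mV k : measurable_fun setT (fun w => g (U (phi k) w)).
    exact: (measurableT_comp mg).
  pose V k : {RV Q >-> R} := mkRV Q (mV k).
  have VE k w : V k w = g (U (phi k) w) by [].
  have [indV lawV] := conditional_independent ind (mA c') phiI phiS mg PB QB VE.
  have lawV' k C : measurable C -> Q (V k @^-1` C) = normal_prob 0 1 C.
    move=> mC; rewrite lawV// -(normal_prob_scale sn0 mC).
    have mgC : measurable (g @^-1` C) by rewrite -[X in measurable X]setTI; exact: mg.
    have GL : gauss_law 0 sn = normal_prob 0 sn by rewrite /gauss_law gt_eqF.
    rewrite -GL /phi; case: fintype.split => j; first exact: (lX k.1 j _ mgC).
    exact: (lXt k.1 j _ mgC).
  pose s (j : 'I_(p + p)) : R := match fintype.split j with inl i => sign_val (c' i) | inr _ => 0 end.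
  have hs j : s j = 0 \/ s j ^+ 2 = 1.
    rewrite /s; case: fintype.split => [i|_]; last by left.
    case: (c' i) => [[]|] /=; [right|right|left] => //; first by rewrite expr1n.
    by rewrite sqrrN expr1n.
  have cs : #|[set j | s j != 0]%SET|%:R <= rho * (p + p)%:R.
    apply: le_trans gc; rewrite ler_nat.
    rewrite -(card_imset _ (@lshift_inj p p)); apply: subset_leq_card.
    apply/fintype.subsetP => j; rewrite inE /s; case: fintype.splitP => [i ji|i ji]; last by rewrite eqxx.
    move=> h; apply/imsetP; exists i; last exact: val_inj.
    by rewrite inE; apply: contra h => /eqP ->.
  have [E [mE QE hE]] : exists E : set T, [/\ measurable E, ((1 - th)%:E <= Q E)%E &
    forall w, E w -> forall h : 'I_(p + p) -> R,
      l1_drift s h <= kap * Num.sqrt ((p + p)%:R * \sum_j h j ^+ 2) ->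
      c * (p + p)%:R * \sum_j h j ^+ 2 <= \sum_i (\sum_j V (i, j) w * h j) ^+ 2].
    have pp0 : (0 < p + p)%N by rewrite addn_gt0 p0.
    exact: (rsv' n (p + p)%N hN pp0 n0 nl nu s hs cs d T Q V indV lawV').
  exists E; split => //.
    by move=> _; rewrite QB//; apply: lee_wpmul2r => //; exact: measure_ge0.
  move=> w Ew h hd; have := hE w Ew (fun j => h j 0) hd.
  set H := \sum_j h j 0 ^+ 2.
  have H0 : 0 <= H by apply: sumr_ge0 => j _; exact: sqr_ge0.
  have -> : \sum_i (row_mx (random_matrix X w) (random_matrix Xt w) *m h) i 0 ^+ 2 =
     n%:R^-1 * \sum_i (\sum_j V (i, j) w * h j 0) ^+ 2.
    rewrite mulr_sumr; apply: eq_bigr => i _.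
    have -> : n%:R^-1 = sn ^+ 2 :> R by rewrite sqr_sqrtr ?ltW.
    rewrite -exprMn; congr (_ ^+ 2); rewrite !mxE mulr_sumr; apply: eq_bigr => j _.
    rewrite VE /g !mulrA mulfV ?gt_eqF// mul1r; congr (_ * _).
    by rewrite /phi /= mxE; case: fintype.split => a; rewrite mxE.
  move=> h1.
  have nR : 0 < n%:R :> R by rewrite ltr0n.
  have q : (dl + 1)^-1 <= (p + p)%:R / n%:R.
    by rewrite (ler_pdivlMr _ _ nR) mulrC (ler_pdivrMr _ _ dl1) mulrC.
  apply: (@le_trans _ _ (n%:R^-1 * (c * (p + p)%:R * H))); last first.
    by apply: ler_wpM2l => //; exact: ltW.
  rewrite (_ : c / _ * H = c * H * (dl + 1)^-1); last by ring.
  rewrite (_ : n%:R^-1 * _ = c * H * ((p + p)%:R / n%:R)); last by ring.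
  by apply: ler_wpM2l => //; rewrite mulr_ge0 ?(ltW c0).
have [E hE] := choice ex.
exists (\bigcup_(c' in good) (E c' `&` B c')); split => //.
- apply: fin_bigcup_measurable; first exact: finite_finset.
  by move=> c' _; apply: measurableI => //; case: (hE c').
- rewrite smallE; apply: partition_prob => //.
  + by move=> c'; case: (hE c').
  + move=> a b w /BE ha /BE hb; apply/ffunP => j; by rewrite -ha hb.
  + by rewrite (ltW th0).
  + by move=> c' gc; case: (hE c') => _ /(_ gc).
move=> w [c' gc [Ew Bw]] h hd; case: (hE c') => _ _ /(_ w Ew h); apply.
apply: le_trans hd; rewrite le_eqVlt; apply/orP; left; apply/eqP; congr (l1_drift _ _).
apply/funext => j; rewrite /sign_pattern; case: fintype.split => // i.
by rewrite -sign_codeK (BE _ _ Bw).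
Qed.

End Design.

(** * The error of the lasso *)

Section Lasso.
Context {R : realType}.

Lemma continuous_bigsum (V : topologicalType) (I : Type) (r : seq I) (F : I -> V -> R) :
  (forall i, continuous (F i)) -> continuous (fun v => \sum_(i <- r) F i v).
Proof.
move=> cF; elim: r => [|i r IH].
  rewrite (_ : (fun v => _) = fun=> 0); first by move=> v; exact: cvg_cst.
  by apply/funext => v; rewrite big_nil.
rewrite (_ : (fun v => _) = fun v => F i v + \sum_(j <- r) F j v); last first.
  by apply/funext => v; rewrite big_cons.
by move=> v; apply: cvgD; [exact: cF|exact: IH].
Qed.

(** The objective is continuous and exceeds its value at [0] as soon as one
    coordinate is large, so a minimum over a cube is a global one. *)
Lemma lasso_minimal (n k : nat) (A : 'M[R]_(n, k)) (y : 'cV[R]_n) (lambda : R) :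
  0 < lambda -> forall b, lasso_obj A y lambda (lasso A y lambda) <= lasso_obj A y lambda b.
Proof.
move=> l0; rewrite /lasso; case: xgetP => [b -> h //|nomin].
exfalso.
pose f (r : 'rV[R]_k) := lasso_obj A y lambda r^T.
have fE r : f r = 2^-1 * (\sum_i (y i 0 - \sum_j A i j * r 0 j) ^+ 2) + lambda * (\sum_j `|r 0 j|).
  rewrite /f /lasso_obj; congr (_ * _ + _ * _).
    apply: eq_bigr => i _; rewrite !mxE; congr ((_ - _) ^+ 2).
    by apply: eq_bigr => j _; rewrite mxE.
  by apply: eq_bigr => j _; rewrite mxE.
have cf : continuous f.
  rewrite (_ : f = fun r => 2^-1 * (\sum_i (y i 0 - \sum_j A i j * r 0 j) ^+ 2) +
     lambda * (\sum_j `|r 0 j|)); last by apply/funext => r; exact: fE.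
  have cc j : continuous (fun r : 'rV[R]_k => r 0 j) by exact: (@coord_continuous R 1 k 0 j).
  have c1 i : continuous (fun r : 'rV[R]_k => (y i 0 - \sum_j A i j * r 0 j) ^+ 2).
    have cg : continuous (fun r : 'rV[R]_k => y i 0 - \sum_j A i j * r 0 j).
      move=> r; apply: continuousB; first exact: cst_continuous.
      apply: (@continuous_bigsum _ _ _ (fun j (r : 'rV[R]_k) => A i j * r 0 j)) => j {}r.
      by apply: continuousM; [exact: cst_continuous|exact: cc].
    by move=> r; exact: (continuousM (cg r) (cg r)).
  have c2 j : continuous (fun r : 'rV[R]_k => `|r 0 j|).
    move=> r; apply: (@continuous_comp _ _ _ (fun r : 'rV[R]_k => r 0 j) (fun x : R => `|x|)); first exact: cc.
    exact: norm_continuous.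
  pose k1 (_ : 'rV[R]_k) : R := 2^-1; pose k2 (_ : 'rV[R]_k) : R := lambda.
  have ck1 : continuous k1 by exact: cst_continuous.
  have ck2 : continuous k2 by exact: cst_continuous.
  have c3 := continuous_bigsum (r := index_enum 'I_n) c1.
  have c4 := continuous_bigsum (r := index_enum 'I_k) c2.
  by move=> r; exact: (continuousD (continuousM (ck1 r) (c3 r)) (continuousM (ck2 r) (c4 r))).
pose M := f 0 / lambda.
have f00 : 0 <= f 0.
  by rewrite fE addr_ge0// mulr_ge0 ?(ltW l0)// ?invr_ge0// sumr_ge0// => i _; exact: sqr_ge0.
have M0 : 0 <= M by rewrite divr_ge0 ?(ltW l0).
pose C := [set v : 'rV[R]_k | forall i, `[- M, M]%classic (v ord0 i)].
have cC : compact C by apply: (@rV_compact R k (fun=> `[- M, M]%classic)) => i; exact: segment_compact.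
have C0 : C 0 by move=> i /=; rewrite mxE in_itv/= oppr_le0 M0.
have [c /set_mem Cc hc] := EVT_min_rV (ex_intro _ 0 C0) cC (continuous_subspaceT cf).
apply: (nomin c^T) => b; rewrite -/(f c) -[b]trmxK -/(f b^T).
have [Cb|nCb] := pselect (C b^T); first by apply: hc; exact: mem_set.
apply: le_trans (hc 0 (mem_set C0)) _.
move: nCb => /existsNP[j]; rewrite /= in_itv/= => /negP; rewrite -ler_norml -ltNge => hj.
rewrite [leRHS]fE; apply: (@le_trans _ _ (lambda * M)).
  by rewrite /M mulrCA divff ?mulr1// gt_eqF.
rewrite ler_wpDl//.
  by rewrite mulr_ge0// ?invr_ge0// sumr_ge0// => i _; exact: sqr_ge0.
rewrite ler_pM2l// (bigD1 j)//=; apply: (le_trans (ltW hj)).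
by rewrite lerDl sumr_ge0.
Qed.

Lemma l1_drift_le (N : nat) (b h : 'I_N -> R) :
  l1_drift (fun j => Num.sg (b j)) h <= \sum_j `|b j + h j| - \sum_j `|b j|.
Proof.
rewrite /l1_drift -sumrB; apply: ler_sum => j _; rewrite sgr_eq0.
case: (ltrgt0P (b j)) => [h0|h0|->].
- by rewrite gtr0_sg// mul1r lerBrDl ler_norm.
- by rewrite ltr0_sg// mulN1r; have := ler_norm (- (b j + h j)); rewrite normrN; lra.
- by rewrite add0r subr0.
Qed.

(** By the basic inequality the drift of the error [h] is at most
    [|xi|^2 / (2 lambda)], hence [O(N)]. If [|h|] is at least a large multiple of
    [sqrt N], then [h] lies in the cone where the design is bounded below, and
    the quadratic term dominates the penalty, which is at most
    [lambda2 * sqrt N * |h|]. *)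
Lemma lasso_error (n N : nat) (A : 'M[R]_(n, N)) (b0 : 'cV[R]_N) (xi : 'cV[R]_n)
    (lambda lambda1 lambda2 kap c C1 : R) :
  0 < lambda1 -> lambda1 <= lambda <= lambda2 -> 0 < kap -> 0 < c -> 0 <= C1 -> (0 < N)%N ->
  (forall h : 'cV[R]_N,
     l1_drift (fun j => Num.sg (b0 j 0)) (fun j => h j 0) <=
       kap * Num.sqrt (N%:R * \sum_j h j 0 ^+ 2) ->
     c * \sum_j h j 0 ^+ 2 <= \sum_i (A *m h) i 0 ^+ 2) ->
  \sum_i xi i 0 ^+ 2 <= C1 * N%:R ->
  \sum_j (lasso A (A *m b0 + xi) lambda - b0) j 0 ^+ 2 <=
    ((C1 / (2 * lambda1 * kap)) ^+ 2 + 2 / c * (4 * C1 + 8 * lambda2 ^+ 2 / c)) * N%:R.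
Proof.
move=> l10 /andP[l1l ll2] kap0 c0 C10 N0 cone xiN.
have l0 : 0 < lambda by apply: lt_le_trans l1l.
have l20 : 0 < lambda2 by apply: lt_le_trans ll2.
set bh := lasso _ _ _; set h := bh - b0; set H := \sum_j h j 0 ^+ 2.
have H0 : 0 <= H by apply: sumr_ge0 => j _; exact: sqr_ge0.
have NR : 0 < N%:R :> R by rewrite ltr0n.
pose X2 := \sum_i xi i 0 ^+ 2.
pose r := \sum_i (xi - A *m h) i 0 ^+ 2.
have r0 : 0 <= r by apply: sumr_ge0 => i _; exact: sqr_ge0.
pose L0 := \sum_j `|b0 j 0|; pose L1 := \sum_j `|b0 j 0 + h j 0|.
have basic : 2^-1 * r + lambda * L1 <= 2^-1 * X2 + lambda * L0.
  have := lasso_minimal A (A *m b0 + xi) l0 b0; rewrite -/bh /lasso_obj.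
  have -> : A *m b0 + xi - A *m bh = xi - A *m h by rewrite /h mulmxBr opprB addrCA addrA addrC.
  have -> : A *m b0 + xi - A *m b0 = xi by rewrite addrAC subrr add0r.
  have -> // : \sum_j `|bh j 0| = L1.
  by apply: eq_bigr => j _; rewrite /h !mxE addrCA subrr addr0.
have drift := l1_drift_le (fun j => b0 j 0) (fun j => h j 0).
rewrite /= -/L0 -/L1 in drift.
pose K := C1 / (2 * lambda1 * kap).
have K0 : 0 <= K by rewrite divr_ge0// !mulr_ge0// ltW.
have C2p : 0 <= 2 / c * (4 * C1 + 8 * lambda2 ^+ 2 / c).
  apply: mulr_ge0; first by apply: divr_ge0 => //; exact: ltW.
  apply: addr_ge0; first exact: mulr_ge0.
  by apply: divr_ge0; [apply: mulr_ge0 => //; exact: sqr_ge0|exact: ltW].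
have [small|big] := leP H (K ^+ 2 * N%:R).
  by apply: le_trans small _; rewrite ler_wpM2r// lerDl.
have driftK : l1_drift (fun j => Num.sg (b0 j 0)) (fun j => h j 0) <= kap * Num.sqrt (N%:R * H).
  apply: le_trans drift _; apply: (@le_trans _ _ (C1 * N%:R / (2 * lambda1))).
    rewrite ler_pdivlMr ?mulr_gt0//.
    have h1 : 2 * lambda * (L1 - L0) <= C1 * N%:R by rewrite -/X2 in xiN; lra.
    have [neg|pos] := leP (L1 - L0) 0.
      apply: (@le_trans _ _ 0); last by rewrite mulr_ge0.
      by rewrite mulr_le0_ge0// mulr_ge0// ltW.
    apply: le_trans h1; rewrite mulrC ler_pM2r//; lra.
  apply: (@le_trans _ _ (kap * (K * N%:R))).
    by rewrite /K le_eqVlt; apply/orP; left; apply/eqP; field; rewrite !gt_eqF.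
  have KN : K * N%:R = Num.sqrt ((K * N%:R) ^+ 2).
    by rewrite sqrtr_sqr ger0_norm//; apply: mulr_ge0 => //; exact: ltW.
  rewrite ler_pM2l// KN ler_wsqrtr// exprMn; have := ltW big => /(ler_wpM2l (ltW NR)); lra.
have lower := cone h driftK; rewrite -/H in lower.
have tri : \sum_i (A *m h) i 0 ^+ 2 <= 2 * r + 2 * X2.
  rewrite !mulr_sumr -big_split/=; apply: ler_sum => i _.
  rewrite !mxE; set a := \sum_j _; have := sqr_ge0 (a - 2 * xi i 0); lra.
pose l1h := \sum_j `|h j 0|.
have l1h0 : 0 <= l1h by apply: sumr_ge0.
have L01 : L0 - L1 <= l1h.
  rewrite /L0 /L1 /l1h -sumrB; apply: ler_sum => j _.
  by have := ler_normB (b0 j 0 + h j 0) (h j 0); rewrite addrK; lra.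
have CS : l1h ^+ 2 <= N%:R * H.
  have := cauchy_schwarz (fun j : 'I_N => `|h j 0|) (fun=> 1).
  under eq_bigr do rewrite mulr1.
  under [X in _ <= X * _ -> _]eq_bigr do rewrite real_normK ?num_real//.
  by rewrite [X in _ * X](eq_bigr (fun=> 1)) ?sumr_const ?card_ord 1?mulrC// => j _; rewrite expr1n.
have r1 : r <= X2 + 2 * lambda2 * l1h.
  have : lambda * (L0 - L1) <= lambda2 * l1h.
    apply: (@le_trans _ _ (lambda * l1h)); first by rewrite ler_pM2l.
    by rewrite ler_wpM2r.
  lra.
have amgm : 4 * lambda2 * l1h <= c / 2 * H + 8 * lambda2 ^+ 2 / c * N%:R.
  have e : 4 * lambda2 * l1h <= c / 2 * (l1h ^+ 2 / N%:R) + 8 * lambda2 ^+ 2 / c * N%:R.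
    rewrite -subr_ge0.
    have -> : c / 2 * (l1h ^+ 2 / N%:R) + 8 * lambda2 ^+ 2 / c * N%:R - 4 * lambda2 * l1h =
      (c * l1h - 4 * lambda2 * N%:R) ^+ 2 / (2 * c * N%:R) by field; rewrite !gt_eqF.
    by rewrite divr_ge0 ?sqr_ge0// !mulr_ge0 ?(ltW c0) ?(ltW NR).
  apply: le_trans e _; rewrite lerD2r ler_pM2l ?divr_gt0// ler_pdivrMr//.
  by rewrite [H * _]mulrC.
have fin : c / 2 * H <= (4 * C1 + 8 * lambda2 ^+ 2 / c) * N%:R.
  rewrite -/X2 in xiN; rewrite mulrDl; lra.
apply: (@le_trans _ _ (2 / c * (4 * C1 + 8 * lambda2 ^+ 2 / c) * N%:R)).
  have := ler_wpM2l (ltW (divr_gt0 (ltr0n R 2) c0)) fin.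
  by rewrite mulrA (_ : 2 / c * (c / 2) = 1) ?mul1r ?mulrA//; field; rewrite gt_eqF.
by rewrite ler_wpM2r ?(ltW NR)// lerDr sqr_ge0.
Qed.

End Lasso.

(** * The data-driven threshold *)

Section Selection.
Context {R : realType}.

Lemma card_large (N : nat) (h : 'I_N -> R) (t M : R) : 0 < t ->
  \sum_j h j ^+ 2 <= M -> #|[set j | t <= `|h j|]%SET|%:R <= M / t ^+ 2.
Proof.
move=> t0 hM; rewrite ler_pdivlMr ?exprn_gt0//; apply: le_trans hM.
rewrite -sum1_card natr_sum mulr_suml big_mkcond; apply: ler_sum => j _.
rewrite inE; case: ifP => [tj|_]; last exact: sqr_ge0.
by rewrite mul1r -[leRHS]real_normK ?num_real// lerXn2r// nnegrE// ltW.
Qed.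

(** At the smallest statistic above [t] the estimated proportion of false
    discoveries is at most [(1 + M) / G], so the threshold does not exceed it. *)
Lemma selected_above (p : nat) (W : 'I_p -> R) (q t M G : R) (j : 'I_p) : 0 < t ->
  (count_le W (- t))%:R <= M -> G <= (count_ge W t)%:R -> 0 < G -> 1 + M <= q * G ->
  t <= W j -> j \in selected W q.
Proof.
move=> t0 cM cG G0 MG tj.
pose j0 := [arg min_(i < j | t <= W i) W i]%O.
have [tj0 j0min] : t <= W j0 /\ forall i, t <= W i -> W j0 <= W i.
  by rewrite /j0; case: arg_minP.
have W0 : 0 < W j0 by apply: lt_le_trans tj0.
rewrite inE; apply: (@le_trans _ _ (W j0)%:E); last by rewrite lee_fin j0min.
have ge : count_ge W (W j0) = count_ge W t.
  rewrite /count_ge; congr #|pred_of_set _|; apply/setP => i; rewrite !inE.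
  by apply/idP/idP => [|ti]; [exact: le_trans|exact: j0min].
have le : (count_le W (- W j0) <= count_le W (- t))%N.
  apply: subset_leq_card; apply/fintype.subsetP => i; rewrite !inE => /le_trans; apply.
  by rewrite lerN2.
have D0 : 0 < (count_ge W t)%:R :> R by apply: lt_le_trans cG.
have q0 : 0 < q.
  have : 0 < q * G by apply: lt_le_trans MG; have := ler0n R (count_le W (- t)); lra.
  by rewrite pmulr_lgt0.
have ok : (0 < `|W j0|) && threshold_ok W q `|W j0|.
  rewrite gtr0_norm// W0 /threshold_ok ge -(ltr0n R) D0/= ler_pdivrMr//.
  apply: (@le_trans _ _ (q * G)); last by rewrite ler_pM2l.
  by apply: le_trans MG; rewrite natrD lerD2l; apply: le_trans cM; rewrite ler_nat.
rewrite /threshold (bigD1 j0)//= ge_min; apply/orP; left.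
by rewrite gtr0_norm.
Qed.

Variables (n p : nat).

(** A statistic is spoilt only if one of its two estimation errors reaches [t]. A
    signal above [3 * t] whose statistic is not spoilt has [t <= W], while
    [W <= - t] needs a spoilt statistic. *)
Lemma TPP_lower (X Xt : 'M[R]_(n, p)) (beta : 'cV[R]_p) (xi : 'cV[R]_n) (q lambda t M M' : R) :
  let A := row_mx X Xt in let b0 := col_mx beta (0 : 'cV[R]_p) in
  let S := #|[set j | beta j 0 != 0]%SET|%:R : R in
  0 < t ->
  \sum_j (lasso A (A *m b0 + xi) lambda - b0) j 0 ^+ 2 <= M * t ^+ 2 ->
  #|[set j | (beta j 0 != 0) && (`|beta j 0| <= 3 * t)]%SET|%:R <= M' ->
  0 < S - M' - M -> 1 + M <= q * (S - M' - M) ->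
  1 - (M' + M) / S <= TPP X Xt beta xi q lambda.
Proof.
move=> A b0 S t0 hM cM' G0 qG.
have YE : X *m beta + xi = A *m b0 + xi by rewrite /A /b0 mul_row_col mulmx0 addr0.
rewrite /TPP YE; set W := lcd_stat _ _ _ _.
set b := lasso A (A *m b0 + xi) lambda in hM; pose h := b - b0.
have WE j : W j = `|beta j 0 + h (lshift p j) 0| - `|h (rshift p j) 0|.
  rewrite /W /lcd_stat -/A -/b /h !mxE.
  by rewrite (unsplitK (inl _)) (unsplitK (inr _)) mxE subr0 addrCA subrr addr0.
pose bad := [set j | t <= `|h j 0|]%SET.
have cbad : #|bad|%:R <= M.
  have := card_large t0 hM; rewrite -mulrA divff ?mulr1//.
  by rewrite expf_neq0// gt_eqF.
pose sig := [set j | beta j 0 != 0]%SET.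
pose weak := [set j | (beta j 0 != 0) && (`|beta j 0| <= 3 * t)]%SET.
pose badp := [set j | (lshift p j \in bad) || (rshift p j \in bad)]%SET.
have cbadp : (#|badp| <= #|bad|)%N.
  pose f j := if lshift p j \in bad then lshift p j else rshift p j.
  have fI : injective f.
    move=> i j; rewrite /f; case: ifP => _; case: ifP => _ //.
    - exact: lshift_inj.
    - by move/eqP; rewrite eq_lrshift.
    - by move/eqP; rewrite eq_rlshift.
    - exact: rshift_inj.
  rewrite -(card_imset _ fI); apply: subset_leq_card; apply/fintype.subsetP => i /imsetP[j].
  by rewrite inE => hj ->; rewrite /f; case: (boolP (lshift p j \in bad)) hj => [h1 _|].
pose G := (sig :\: weak :\: badp)%SET.
have cG : S - M' - M <= #|G|%:R.
  have h1 : (#|sig| <= #|G| + #|badp| + #|weak|)%N.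
    apply: (@leq_trans #|G :|: badp :|: weak|%SET); last first.
      by apply: leq_trans (leq_card_setU _ _) _; rewrite leq_add2r leq_card_setU.
    apply: subset_leq_card; apply/fintype.subsetP => j js.
    rewrite /G !finset.in_setU !finset.in_setD js.
    by case: (j \in badp); case: (j \in weak).
  have : #|sig|%:R <= #|G|%:R + #|badp|%:R + #|weak|%:R :> R by rewrite -!natrD ler_nat.
  have : #|badp|%:R <= M by apply: le_trans cbad; rewrite ler_nat.
  rewrite -/weak in cM'; rewrite /S -/sig; lra.
have GW j : j \in G -> t <= W j.
  rewrite !inE !negb_or -!ltNge negb_and negbK => /and3P[/andP[h1 h2] h3 h4].
  have {}h3 : 3 * t < `|beta j 0|.
    by move: h3; rewrite (negbTE h4)/= -ltNge.
  have := ler_normB (beta j 0 + h (lshift p j) 0) (h (lshift p j) 0).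
  by rewrite WE addrK; lra.
have cle : (count_le W (- t))%:R <= M.
  apply: le_trans cbad; rewrite ler_nat; apply: leq_trans cbadp.
  apply: subset_leq_card; apply/fintype.subsetP => j; rewrite !inE WE => hj; apply/orP; right.
  by have := normr_ge0 (beta j 0 + h (lshift p j) 0); lra.
have cge : S - M' - M <= (count_ge W t)%:R.
  apply: le_trans cG _; rewrite ler_nat; apply: subset_leq_card.
  by apply/fintype.subsetP => j /GW; rewrite inE.
have S0 : 0 < S.
  have M0 : 0 <= M by apply: le_trans cbad.
  have M'0 : 0 <= M' by apply: le_trans cM'.
  lra.
rewrite /TPP_of -/S ler_pdivlMr// mulrBl mul1r divfK ?gt_eqF//.
apply: (@le_trans _ _ #|G|%:R); first lra.
rewrite ler_nat; apply: subset_leq_card; apply/fintype.subsetP => j jG.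
have := GW j jG => tW; rewrite inE (selected_above t0 cle cge G0 qG tW)/=.
by move: jG; rewrite !inE => /and3P[].
Qed.

End Selection.

(** * Below the phase transition *)

Section PhaseTransition.
Context {R : realType}.

Lemma std_cdf_le0 (t : R) : 0 <= t -> std_cdf (- t) <= 2^-1 :> R.
Proof.
move=> t0; rewrite -[leRHS]mul1r -std_cdf0 /std_cdf fine_le// ?fin_num_measure//.
apply: le_measure => //; rewrite ?inE//.
by move=> x /=; rewrite !in_itv/= => /le_trans; apply; rewrite oppr_le0.
Qed.

Lemma phi_lower (t : R) : phi 0 * (1 - t ^+ 2 / 2) <= phi t :> R.
Proof.
have p0 : phi 0 = (Num.sqrt (pi *+ 2))^-1 :> R by rewrite phiE expr0n/= mul0r oppr0 expR0 mulr1.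
rewrite p0 phiE ler_pM2l; last by rewrite -p0 phi_gt0.
by have := expR_ge1Dx (- (t ^+ 2 / 2)); lra.
Qed.

(** On the curve the two sides agree, and the left-hand side increases with
    the sparsity; at aspect ratio at least one a small threshold suffices. *)
Lemma below_phase_transition (delta eps : R) : 0 < delta -> 0 < eps < 1 ->
  eps < 2 * eps_star (delta / 2) ->
  exists t rho : R, [/\ 0 <= t, eps / 2 < rho, rho <= 1 &
    rho * (1 + t ^+ 2) + (1 - rho) * soft_var t < delta / 2].
Proof.
move=> d0 /andP[e0 e1]; rewrite /eps_star; case: (leP 1 (delta / 2)) => [d1 _|d1].
  pose rho := (eps + 1) / 4; pose f0 : R := phi 0.
  have f00 : 0 < f0 by exact: phi_gt0.
  have f10 : 0 < 2 * (1 + f0) by lra.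
  have r1 : rho < 1 by rewrite /rho; lra.
  pose t := (1 - rho) * f0 / (2 * (1 + f0)).
  have t0 : 0 < t by rewrite divr_gt0// mulr_gt0// subr_gt0.
  have tE : t * (2 * (1 + f0)) = (1 - rho) * f0 by rewrite divfK// gt_eqF.
  have r0 : 0 < rho by rewrite /rho; lra.
  clearbody t; exists t, rho; split; rewrite ?(ltW t0)//; try by rewrite /rho; lra.
  have h1 := std_cdf_le0 (ltW t0); have h2 := phi_lower t; rewrite -/f0 in h2.
  have t1 : t <= 1.
    rewrite -(ler_pM2r f10) tE.
    have : (1 - rho) * f0 <= 1 * f0 by rewrite ler_pM2r//; lra.
    lra.
  have t2 : t ^+ 2 <= 1 by rewrite expr_le1// ltW.
  have h3 : f0 / 2 <= phi t.
    apply: le_trans h2; have := ler_wpM2l (ltW f00) t2; lra.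
  have h4 : soft_var t <= 1 + t ^+ 2 - t * f0.
    have a1 : (1 + t ^+ 2) * std_cdf (- t) <= (1 + t ^+ 2) * 2^-1.
      by rewrite ler_pM2l// ltr_wpDr// sqr_ge0.
    have a2 : t * (f0 / 2) <= t * phi t by rewrite ler_pM2l.
    rewrite /soft_var; lra.
  apply: lt_le_trans d1.
  have h5 : (1 - rho) * soft_var t <= (1 - rho) * (1 + t ^+ 2 - t * f0).
    by apply: ler_wpM2l h4; rewrite subr_ge0 ltW.
  have h6 : t * t < (1 - rho) * (t * f0).
    have -> : (1 - rho) * (t * f0) = t * ((1 - rho) * f0) by ring.
    by rewrite ltr_pM2l// -tE; nra.
  rewrite expr2 in h5 *; lra.
case: xgetP => [e _ [s [s0 sd se]] he|_ h]; last by exfalso; lra.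
pose den := s + dt_num s.
have den0 : den != 0.
  by apply/eqP => dn; move: sd; rewrite /dt_delta -/den dn invr0 mulr0; lra.
have curve : e * (1 + s ^+ 2) + (1 - e) * soft_var s = delta / 2.
  rewrite -sd -se /dt_delta /dt_eps -/den.
  have -> : 1 - dt_num s / den = s / den by rewrite /den; field; exact: den0.
  rewrite /soft_var /dt_num; change (std_pdf s) with (phi s); field; exact: den0.
have slope : 0 < 1 + s ^+ 2 - soft_var s.
  by have := soft_var_le1 (ltW s0); have := exprn_gt0 2 s0; lra.
pose rho := (eps / 2 + Num.min e 1) / 2.
have [r1 r2 r3] : [/\ eps / 2 < rho, rho < e & rho <= 1].
  by rewrite /rho; case: (leP e 1) => h; split; lra.
exists s, rho; split; rewrite ?(ltW s0)//.
rewrite -curve; clearbody rho.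
have := mulr_gt0 slope (_ : 0 < e - rho); rewrite subr_gt0 => /(_ r2); lra.
Qed.

End PhaseTransition.

(** * Coefficients and noise *)

Section Coefficients.
Context {R : realType} {d : measure_display} {T : measurableType d}.
Variable P : probability T R.

Lemma sum_indic (p : nat) (D : pred R) (b : 'I_p -> R) :
  \sum_j (\1_[set x | D x] (b j) : R) = #|[set j | D (b j)]%SET|%:R.
Proof.
rewrite -sum1_card natr_sum [RHS]big_mkcond/=; apply: eq_bigr => j _.
have -> : (j \in [set j | D (b j)]%SET) = D (b j) by rewrite finset.inE.
rewrite indicE (_ : (b j \in [set x | D x]) = D (b j)); first by case: (D (b j)).
by apply/idP/idP => [/set_mem|h]; last exact: mem_set.
Qed.

Lemma integral_indic_comp (X : {RV P >-> R}) (D : set R) : measurable D ->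
  (\int[P]_w (\1_D (X w) : R)%:E = P (X @^-1` D))%E.
Proof.
move=> mD; have mXD : measurable (X @^-1` D).
  have mX : measurable_fun setT (X : T -> R) by [].
  by rewrite -[X in measurable X]setTI; exact: mX.
transitivity (\int[P]_w (\1_(X @^-1` D) w : R)%:E)%E; first by [].
by rewrite integral_indic// setIT.
Qed.

Variables (p : nat) (beta : 'I_p -> {RV P >-> R}).
Hypothesis p0 : (0 < p)%N.

Lemma measurable_count (D : pred R) : measurable [set x | D x] ->
  measurable_fun setT (fun w => #|[set j | D (beta j w)]%SET|%:R : R).
Proof.
move=> mD; rewrite (_ : (fun w => _) = fun w => \sum_j (\1_[set x | D x] (beta j w) : R)).
  by apply: measurable_sum => j; apply: measurableT_comp => //; exact: measurable_indic.
by apply/funext => w; rewrite (sum_indic D (fun j => beta j w)).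
Qed.

Lemma support_size (D : pred R) (eps gm : R) : measurable [set x | D x] ->
  indep_on (index_enum 'I_p) beta -> 0 <= eps <= 1 -> 0 < gm ->
  (forall j, P (beta j @^-1` [set x | D x]) = eps%:E) ->
  (P (~` [set w | (`|#|[set j | D (beta j w)]%SET|%:R - eps * p%:R| < gm * p%:R)%R])
    <= ((gm ^+ 2)^-1 / p%:R)%:E)%E.
Proof.
move=> mD ind /andP[e0 e1] g0 law.
have pR : 0 < p%:R :> R by rewrite ltr0n.
have mi : measurable_fun setT (\1_[set x | D x] : R -> R) by exact: measurable_indic.
have := @independent_chebyshev _ _ _ P _ beta (fun _ => \1_[set x | D x]) (fun=> eps) 1 (gm * p%:R) ind.
have -> : (#|'I_p|%:R * 1 / (gm * p%:R) ^+ 2)%R = (gm ^+ 2)^-1 / p%:R.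
  by rewrite card_ord; field; rewrite !gt_eqF.
have -> : [set w | gm * p%:R <= `|\sum_i \1_[set x | D x] (beta i w) - \sum_(i < p) eps|] =
   ~` [set w | `|#|[set j | D (beta j w)]%SET|%:R - eps * p%:R| < gm * p%:R].
  have se : \sum_(i < p) eps = eps * p%:R by rewrite sumr_const card_ord -[LHS]mulr_natr.
  apply/seteqP; split => w /=; rewrite (sum_indic D (fun j => beta j w)) se.
    by rewrite leNgt => /negP.
  by move/negP; rewrite -leNgt.
apply => //.
- by move=> j; rewrite integral_indic_comp// law.
- move=> j; under eq_integral => w _.
    rewrite (_ : \1_[set x | D x] (beta j w) ^+ 2 = (\1_[set x | D x] (beta j w) : R)); last first.
      by rewrite indicE; case: (_ \in _); rewrite ?expr1n ?expr0n.
    over.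
  by rewrite integral_indic_comp// law lee_fin.
- exact: mulr_gt0.
Qed.

Lemma count_markov (D : pred R) (w0 gm : R) : measurable [set x | D x] -> 0 < gm ->
  (forall j, P (beta j @^-1` [set x | D x]) <= w0%:E)%E ->
  (P (~` [set w | (#|[set j | D (beta j w)]%SET|%:R <= gm * p%:R)%R]) <= (w0 / gm)%:E)%E.
Proof.
move=> mD g0 law.
have pR : 0 < p%:R :> R by rewrite ltr0n.
have mi : measurable_fun setT (\1_[set x | D x] : R -> R) by exact: measurable_indic.
have mF j : measurable_fun setT (fun w => \1_[set x | D x] (beta j w) : R).
  exact: measurableT_comp.
have F0 j w : 0 <= (\1_[set x | D x] (beta j w) : R) by rewrite indicE ler0n.
have iF j : P.-integrable setT (EFin \o (fun w => \1_[set x | D x] (beta j w) : R)) /\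
    EP P (fun w => \1_[set x | D x] (beta j w) : R) <= w0.
  have [] := @EP_fin _ _ _ P _ (mF j) (F0 j).
    by rewrite integral_indic_comp//; apply: le_lt_trans (law j) (ltry _).
  by move=> h; rewrite integral_indic_comp// => h2; split => //; rewrite -lee_fin h2.
have [i2 e2] := EP_sum (index_enum 'I_p) (fun j => proj1 (iF j)).
have S0 w : 0 <= \sum_j (\1_[set x | D x] (beta j w) : R) by apply: sumr_ge0 => j _.
have gp : 0 < gm * p%:R by exact: mulr_gt0.
have mc := measurable_count mD.
apply: (@prob_sub_le _ _ _ P _ [set w | gm * p%:R <= \sum_j (\1_[set x | D x] (beta j w) : R)]).
- by apply: measurableC; apply: measurable_set_le => //; exact: measurable_cst.
- by apply: (measurable_set_le (f := cst (gm * p%:R))) => //; exact: measurable_sum.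
- by move=> w /= /negP; rewrite -ltNge (sum_indic D (fun j => beta j w)) => /ltW.
apply: le_trans (markov_ge0 i2 S0 gp) _.
rewrite lee_fin e2 ler_pdivrMr//; apply: (@le_trans _ _ (\sum_(j < p) w0)).
  by apply: ler_sum => j _; exact: (proj2 (iF j)).
rewrite sumr_const card_ord -[leLHS]mulr_natr le_eqVlt; apply/orP; left; apply/eqP.
by field; rewrite gt_eqF.
Qed.

End Coefficients.

Section Noise.
Context {R : realType} {d : measure_display} {T : measurableType d}.
Variable P : probability T R.

Lemma gauss_law_second_moment (X : {RV P >-> R}) (sigma : R) : 0 <= sigma ->
  has_law X (gauss_law 0 sigma) -> (\int[P]_w (X w ^+ 2)%:E = (sigma ^+ 2)%:E)%E.
Proof.
move=> s0 lX; have mX : measurable_fun setT (X : T -> R) by [].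
have [s00|sn] := eqVneq sigma 0.
  rewrite s00 expr0n/=.
  transitivity (\int[distribution P X]_x (x ^+ 2)%:E)%E.
    rewrite ge0_integral_distribution//; last by move=> x; rewrite lee_fin sqr_ge0.
    by apply/measurable_EFinP; exact: exprn_measurable.
  transitivity (\int[dirac (0%R : R)]_x (x ^+ 2)%:E)%E.
    by apply: eq_measure_integral => A mA _; have := lX A mA; rewrite /gauss_law s00 eqxx.
  rewrite integral_dirac//; last by apply/measurable_EFinP; exact: exprn_measurable.
  by rewrite diracT mul1e expr0n.
have sp : 0 < sigma by rewrite lt_neqAle eq_sym sn.
have mg : measurable_fun setT (fun x : R => sigma^-1 * x) by apply: measurable_funM.
have mV : measurable_fun setT (fun w => sigma^-1 * X w) by exact: (measurableT_comp mg mX).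
pose V : {RV P >-> R} := mkRV P mV.
have lV B : measurable B -> P (V @^-1` B) = normal_prob 0 1 B.
  move=> mB; have mgB : measurable ((fun x : R => sigma^-1 * x) @^-1` B).
    by rewrite -[X in measurable X]setTI; exact: mg.
  by rewrite -(normal_prob_scale sp mB); have := lX _ mgB; rewrite /gauss_law (negbTE sn).
have -> : (fun w => (X w ^+ 2)%:E) = (fun w => (sigma ^+ 2)%:E * (V w ^+ 2)%:E)%E.
  by apply/funext => w; rewrite -EFinM -exprMn /= mulrA mulfV// mul1r.
rewrite ge0_integralZl//=.
- rewrite (@law_integral _ _ _ P V (fun x => x ^+ 2) lV) ?gauss_second_moment ?mule1//.
  by move=> x; exact: sqr_ge0.
- by apply/measurable_EFinP; exact: measurable_funX.
- by move=> w _; rewrite lee_fin sqr_ge0.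
- by rewrite lee_fin sqr_ge0.
Qed.

Lemma noise_markov (n : nat) (xi : 'I_n -> {RV P >-> R}) (sigma C : R) : 0 <= sigma -> 0 < C ->
  (forall i, has_law (xi i) (gauss_law 0 sigma)) ->
  measurable [set w | \sum_i xi i w ^+ 2 <= C] /\
  (P (~` [set w | (\sum_i xi i w ^+ 2 <= C)%R]) <= (n%:R * sigma ^+ 2 / C)%:E)%E.
Proof.
move=> s0 C0 law.
have mF i : measurable_fun setT (fun w => xi i w ^+ 2) by exact: measurable_funX.
have mS : measurable_fun setT (fun w => \sum_i xi i w ^+ 2) by exact: measurable_sum.
have mE : measurable [set w | \sum_i xi i w ^+ 2 <= C].
  by apply: measurable_set_le => //; exact: measurable_cst.
split => //.
have iF i : P.-integrable setT (EFin \o (fun w => xi i w ^+ 2)) /\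
    EP P (fun w => xi i w ^+ 2) = sigma ^+ 2.
  have [] := @EP_fin _ _ _ P _ (mF i) (fun w => sqr_ge0 _).
    by rewrite (gauss_law_second_moment s0 (law i)) ltry.
  by move=> h; rewrite (gauss_law_second_moment s0 (law i)) => /eqP; rewrite eqe => /eqP.
have [i2 e2] := EP_sum (index_enum 'I_n) (fun i => proj1 (iF i)).
have S0 w : 0 <= \sum_i xi i w ^+ 2 by apply: sumr_ge0 => i _; exact: sqr_ge0.
apply: (@prob_sub_le _ _ _ P _ [set w | C <= \sum_i xi i w ^+ 2]).
- exact: measurableC.
- exact: (measurable_set_le (f := cst C)).
- by move=> w /= /negP; rewrite -ltNge => /ltW.
apply: le_trans (markov_ge0 i2 S0 C0) _.
rewrite lee_fin e2; under eq_bigr => i _ do rewrite (proj2 (iF i)).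
by rewrite sumr_const card_ord -[X in X / C]mulr_natl.
Qed.

End Noise.

Section Growth.
Context {R : realType} {d : measure_display} {T : measurableType d}.
Variable Q : probability T R.

Lemma weak_signals (eps a M : R) (Pi : nat -> {RV Q >-> R}) : 0 < eps -> 0 < a -> 0 < M ->
  sparse_and_growing eps Pi -> exists m', forall m, (m' <= m)%N ->
  (Q [set w | ((Pi m w != 0) && (`|Pi m w| <= M))%R] <= (eps * a)%:E)%E.
Proof.
move=> e0 a0 M0 [spa gro]; have := gro M M0.
move=> /cvgrPdist_le /(_ a a0) [m' _ hm]; exists m' => m mm.
have := hm m mm; rewrite /cond_prob => {}hm.
have mPi : measurable_fun setT (Pi m : T -> R) by [].
have mn : measurable_fun setT (fun w => `|Pi m w|) by apply: measurableT_comp.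
have mA : measurable [set w | M < `|Pi m w|] by exact: (measurable_set_lt (f := cst M)).
have m0 : measurable [set w | Pi m w != 0].
  rewrite (_ : [set w | _] = [set w | 0 < `|Pi m w|]); last by apply/seteqP; split => w /=; rewrite normr_gt0.
  exact: (measurable_set_lt (f := cst 0)).
set A := [set w | M < _] in mA hm; set N0 := [set w | _ != 0] in m0 hm.
have -> : [set w | (Pi m w != 0) && (`|Pi m w| <= M)] = N0 `\` A.
  apply/seteqP; split => w /=.
    by move=> /andP[h0 h]; split => //; apply/negP; rewrite -leNgt.
  by move=> [h0 /negP]; rewrite -leNgt => h; apply/andP.
rewrite measureD//; last by rewrite (le_lt_trans (probability_le1 _ m0))// ltry.
have eE : Q N0 = eps%:E by exact: spa.
have fA : Q (A `&` N0) \is a fin_num by rewrite fin_num_measure//; exact: measurableI.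
rewrite (_ : (_ - _)%E = (eps - fine (Q (A `&` N0)))%:E); last first.
  by rewrite EFinB -eE (fineK fA) (setIC A).
rewrite lee_fin.
move: hm; rewrite eE /= ler_norml => /andP[_].
rewrite lerBlDr -lerBlDl ler_pdivlMr//; lra.
Qed.

End Growth.

(** * Power of the procedure *)

Section Assembly.
Context {R : realType}.

(** The error bound leaves at most [z * p] coordinates off by [t] or more, and
    at most [z * p] signals are below [3 * t]; both are a small fraction of the
    signals. *)
Lemma TPP_uniform (n p : nat) (X Xt : 'M[R]_(n, p)) (beta : 'cV[R]_p) (xi : 'cV[R]_n)
    (lambda1 lambda2 lambda kap c C1 q eps z zz t : R) :
  let C2 := (C1 / (2 * lambda1 * kap)) ^+ 2 + 2 / c * (4 * C1 + 8 * lambda2 ^+ 2 / c) in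
  let S := #|[set j | beta j 0 != 0]%SET|%:R : R in
  (0 < p)%N -> 0 < lambda1 -> lambda1 <= lambda <= lambda2 -> 0 < kap -> 0 < c -> 0 <= C1 ->
  0 < q -> 0 < eps -> 0 < zz <= 1 -> zz <= q -> z = eps / 8 * zz -> 0 < t ->
  2 * C2 <= z * t ^+ 2 -> 8 <= q * eps * p%:R ->
  (forall h : 'cV[R]_(p + p),
     l1_drift (sign_pattern (fun j => beta j 0)) (fun j => h j 0) <=
       kap * Num.sqrt ((p + p)%:R * \sum_j h j 0 ^+ 2) ->
     c * \sum_j h j 0 ^+ 2 <= \sum_i (row_mx X Xt *m h) i 0 ^+ 2) ->
  \sum_i xi i 0 ^+ 2 <= C1 * (p + p)%:R ->
  eps / 2 * p%:R <= S ->
  #|[set j | (beta j 0 != 0) && (`|beta j 0| <= 3 * t)]%SET|%:R <= z * p%:R ->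
  1 - zz / 2 <= TPP X Xt beta xi q lambda.
Proof.
move=> C2 S p0 l10 lin kap0 c0 C10 q0 e0 /andP[zz0 zz1] zzq zE t0 Ct qp cone noise Slow weak.
have pR : 0 < p%:R :> R by rewrite ltr0n.
have z0 : 0 < z by rewrite zE mulr_gt0// divr_gt0.
have zp : z * p%:R <= eps / 8 * p%:R.
  by rewrite ler_pM2r// zE ler_piMr// divr_ge0// ltW.
have err : \sum_j (lasso (row_mx X Xt) (row_mx X Xt *m col_mx beta 0 + xi) lambda
    - col_mx beta 0) j 0 ^+ 2 <= z * p%:R * t ^+ 2.
  have pp0 : (0 < p + p)%N by rewrite addn_gt0 p0.
  have := @lasso_error R n (p + p) (row_mx X Xt) (col_mx beta 0) xi lambda lambda1 lambda2
    kap c C1 l10 lin kap0 c0 C10 pp0 _ noise.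
  have sgE : (fun j => Num.sg (col_mx beta (0 : 'cV[R]_p) j 0)) = sign_pattern (fun j => beta j 0).
    apply/funext => j; rewrite /sign_pattern mxE; case: fintype.split => i //.
    by rewrite mxE sgr0.
  rewrite sgE => /(_ cone) /le_trans; apply.
  rewrite -/C2 natrD; have := ler_wpM2r (ltW pR) Ct; lra.
have G0 : eps / 4 * p%:R <= S - z * p%:R - z * p%:R by lra.
have Gp : 0 < S - z * p%:R - z * p%:R.
  by apply: lt_le_trans G0; rewrite mulr_gt0// divr_gt0.
have zq : z * p%:R <= q * (eps / 8 * p%:R).
  have h : zz * (eps / 8 * p%:R) <= q * (eps / 8 * p%:R).
    by apply: ler_wpM2r => //; rewrite mulr_ge0// ?divr_ge0 ?(ltW e0).
  rewrite zE; lra.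
have qG : 1 + z * p%:R <= q * (S - z * p%:R - z * p%:R).
  apply: (@le_trans _ _ (q * (eps / 4 * p%:R))); first lra.
  by rewrite ler_pM2l.
apply: le_trans (TPP_lower t0 err weak Gp qG); rewrite -/S.
have S0 : 0 < S by apply: lt_le_trans Slow; rewrite mulr_gt0// divr_gt0.
rewrite lerD2l lerN2 ler_pdivrMr//.
have : zz / 2 * (eps / 2 * p%:R) <= zz / 2 * S by rewrite ler_wpM2l// divr_ge0// ltW.
rewrite zE; lra.
Qed.

Lemma le_sum4 (a b x y : R) : 0 <= a -> 0 <= b -> 0 <= x -> 0 <= y ->
  [/\ a <= a + b + x + y, b <= a + b + x + y, x <= a + b + x + y & y <= a + b + x + y].
Proof. by move=> *; split; lra. Qed.

Lemma min_bounds (a b : R) : 0 < a -> 0 < b ->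
  [/\ 0 < Num.min a b, Num.min a b <= a & Num.min a b <= b].
Proof. by move=> a0 b0; rewrite lt_min a0 b0 !ge_min !lexx orbT. Qed.

Lemma eventual_dimensions (delta eta pmin : R) (p : nat -> nat) : 0 < delta -> 0 < eta ->
  0 <= pmin -> (n%:R / (p n)%:R : R) @[n --> \oo] --> delta ->
  exists n0, forall n, (n0 <= n)%N ->
    [/\ (0 < p n)%N, (0 < n)%N, pmin <= (p n)%:R, n%:R <= (delta + 1) * (p n)%:R &
        (delta - eta) * (p n)%:R <= n%:R].
Proof.
move=> d0 eta0 pmin0 /cvgrPdist_le hp.
have d10 : 0 < delta + 1 by lra.
pose e := Num.min eta (Num.min (delta / 2) 1).
have d20 : 0 < delta / 2 by lra.
have [m0 m1 m2] := min_bounds d20 ltr01.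
have [ep0 ep1 m3] := min_bounds eta0 m0.
have ep2 : e <= delta / 2 by exact: le_trans m3 m1.
have ep3 : e <= 1 by exact: le_trans m3 m2.
rewrite -/e in ep0 ep1; clearbody e; have [n0 _ hn] := hp e ep0.
exists (maxn n0 (Num.bound ((delta + 1) * pmin))) => n.
rewrite geq_max => /andP[n0n nb].
have := hn n n0n; rewrite /= ler_norml => /andP[ra rb].
have ratio_lo : delta - e <= n%:R / (p n)%:R by lra.
have ratio_hi : n%:R / (p n)%:R <= delta + 1 by lra.
have p0 : (0 < p n)%N.
  rewrite lt0n; apply/negP => /eqP pn0; move: ratio_lo; rewrite pn0 invr0 mulr0; lra.
have pR : 0 < (p n)%:R :> R by rewrite ltr0n.
have n_hi : n%:R <= (delta + 1) * (p n)%:R by rewrite -ler_pdivrMr.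
have n_lo : (delta - e) * (p n)%:R <= n%:R by rewrite -ler_pdivlMr.
split => //.
- by rewrite -(ltr0n R); apply: lt_le_trans n_lo; rewrite mulr_gt0//; lra.
- rewrite -(ler_pM2l d10); apply: le_trans n_hi.
  apply: (le_trans (ltW (archi_boundP _))); first by rewrite mulr_ge0// ltW.
  by rewrite ler_nat.
- by apply: le_trans n_lo; rewrite ler_pM2r//; lra.
Qed.

End Assembly.

Theorem theorem2 (R : realType) (sigma delta q eps : R) (p : nat -> nat)
    (d0 : measure_display) (T0 : measurableType d0) (Q : probability T0 R)
    (Pi : nat -> {RV Q >-> R}) (lambda1 lambda2 nu : R)
    (hsigma : 0 <= sigma)
    (hdelta : 0 < delta)
    (hp : (n%:R / (p n)%:R : R) @[n --> \oo] --> delta)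
    (hq : 0 < q)
    (heps : 0 < eps < 1)
    (heps_star : eps < 2 * eps_star (delta / 2))
    (hPi2 : forall m, ('E_Q[(fun w => Pi m w ^+ 2)%R] < +oo)%E)
    (hPi : sparse_and_growing eps Pi)
    (hlambda1 : 0 < lambda1)
    (hlambda2 : lambda1 < lambda2)
    (hnu : 0 < nu) :
  exists (m' : nat) (n' : nat -> nat), forall m n : nat,
    (m' <= m)%N -> (n' m <= n)%N ->
    forall (d : measure_display) (T : measurableType d) (P : probability T R)
      (X Xt : 'I_n -> 'I_(p n) -> {RV P >-> R})
      (beta : 'I_(p n) -> {RV P >-> R}) (xi : 'I_n -> {RV P >-> R}),
    knockoff_model X Xt beta xi sigma (distribution Q (Pi m)) ->
    prob_atleast P
      [set w | 1 - nu <
         inf [set TPP (random_matrix X w) (random_matrix Xt w)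
                (random_vector beta w) (random_vector xi w) q lambda
             | lambda in `[lambda1, lambda2]]]
      (1 - nu).
Proof.
have [t [rho [t0 rho_gt rho_le V]]] := below_phase_transition hdelta heps heps_star.
have /andP[e0 e1] := heps.
have rho01 : 0 <= rho <= 1 by rewrite rho_le andbT; lra.
have [kap [c [eta [kap0 c0 eta0 DB]]]] := design_bound t0 rho01 V.
pose nu0 := Num.min nu 1.
have [nu00 nu0n nu01] := min_bounds hnu ltr01.
rewrite -/nu0 in nu00 nu0n nu01; clearbody nu0.
pose th := nu0 / 5.
have th0 : 0 < th by rewrite divr_gt0.
have th1 : 0 < th <= 1 by rewrite th0 /th; lra.
have thE : nu0 = 5 * th by rewrite /th mulrC divfK.
have [N1 {}DB] := DB th th1; clearbody th.
(* Markov's inequality makes |xi| ^ 2 <= C1 * 2 p fail with probability at most th. *)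
pose C1 := (delta + 1) * (sigma ^+ 2 + 1) / th.
have s20 : 0 < sigma ^+ 2 + 1 by have := sqr_ge0 sigma; lra.
have d10 : 0 < delta + 1 by lra.
have C10 : 0 < C1 by rewrite divr_gt0// mulr_gt0.
have C1E : C1 * th = (delta + 1) * (sigma ^+ 2 + 1) by rewrite divfK// gt_eqF.
clearbody C1.
pose C2 := (C1 / (2 * lambda1 * kap)) ^+ 2 + 2 / c * (4 * C1 + 8 * lambda2 ^+ 2 / c).
have C20 : 0 <= C2.
  apply: addr_ge0; first exact: sqr_ge0.
  apply: mulr_ge0; first by apply: divr_ge0 => //; exact: ltW.
  apply: addr_ge0; first by rewrite mulr_ge0// ltW.
  by apply: divr_ge0; [apply: mulr_ge0 => //; exact: sqr_ge0|exact: ltW].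
have C2E : C2 = (C1 / (2 * lambda1 * kap)) ^+ 2 + 2 / c * (4 * C1 + 8 * lambda2 ^+ 2 / c) by [].
clearbody C2.
(* At most nu0, for the power, and at most q, for the ratio that defines the
   threshold. *)
pose zz := nu0 * q / (1 + q).
have q10 : 0 < 1 + q by lra.
have zzE : zz * (1 + q) = nu0 * q by rewrite divfK// gt_eqF.
have zz0 : 0 < zz by rewrite divr_gt0// mulr_gt0.
clearbody zz.
have zznu : zz <= nu0.
  by rewrite -(ler_pM2r q10) zzE ler_wpM2l ?(ltW nu00)//; clear - hq; lra.
have zzq : zz <= q.
  by rewrite -(ler_pM2r q10) zzE mulrC ler_wpM2l ?(ltW hq)//; clear - nu01 hq; lra.
have zz1 : 0 < zz <= 1 by rewrite zz0; exact: le_trans nu01.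
pose z := eps / 8 * zz.
have z0 : 0 < z by rewrite mulr_gt0// divr_gt0.
have zE : z = eps / 8 * zz by [].
clearbody z.
(* Large enough for 2 * C2 <= z * tt ^ 2, since tt <= tt ^ 2. *)
pose tt := 2 * C2 / z + 1.
have C2z : 0 <= 2 * C2 / z by apply: divr_ge0; [exact: mulr_ge0|exact: ltW].
have tt0 : 0 < tt by rewrite /tt ltr_wpDl.
have Ct : 2 * C2 <= z * tt ^+ 2.
  have h : 2 * C2 / z <= tt ^+ 2 by rewrite /tt; move: C2z; set x := 2 * C2 / z; clearbody x; clear => ?; nra.
  by move: h; rewrite (ler_pdivrMr _ _ z0) [z * _]mulrC.
clearbody tt.
have a0 : 0 < z * th / eps by rewrite divr_gt0// mulr_gt0.
have tt30 : 0 < 3 * tt by rewrite mulr_gt0.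
have [m' weakQ] := weak_signals e0 a0 tt30 hPi.
(* Keeps the number of signals below rho * 2 p and above eps / 2 * p. *)
pose gm := Num.min (2 * rho - eps) (eps / 2).
have ga : 0 < 2 * rho - eps by clear - rho_gt; lra.
have gb : 0 < eps / 2 by clear - e0; lra.
have [gm0 gm1 gm2] := min_bounds ga gb.
rewrite -/gm in gm0 gm1 gm2; clearbody gm.
pose pmin := `|N1| + 1 / eta + (gm ^+ 2 * th)^-1 + 8 / (q * eps).
have gt0 : 0 < gm ^+ 2 * th by rewrite mulr_gt0// exprn_gt0.
have qe0 : 0 < q * eps by rewrite mulr_gt0.
have pm1 : 0 <= 1 / eta by rewrite divr_ge0// ltW.
have pm2 : 0 <= (gm ^+ 2 * th)^-1 by rewrite invr_ge0 ltW.
have pm3 : 0 <= 8 / (q * eps) by rewrite divr_ge0// ltW.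
have [pa pb pc pd] := le_sum4 (normr_ge0 N1) pm1 pm2 pm3; rewrite -/pmin in pa pb pc pd.
have pmin0 : 0 <= pmin by exact: le_trans pa.
have pN := le_trans (ler_norm N1) pa.
clearbody pmin.
have [n' dims] := eventual_dimensions hdelta eta0 pmin0 hp.
exists m', (fun=> n') => m n mm /dims[p0 npos pmp n_hi n_lo] d T P X Xt beta xi model.
have pR : 0 < (p n)%:R :> R by rewrite ltr0n.
have [ind _ _ lB lxi] := model.
have ppE : (p n + p n)%:R = 2 * (p n)%:R :> R by rewrite natrD; ring.
have [|||E1 [mE1 msmall PE1 coneE1]] := DB n (p n) _ p0 npos _ _ d T P X Xt beta xi sigma _ model.
- by rewrite ppE; apply: le_trans pN _; apply: (le_trans pmp); clear - pR; lra.
- rewrite ppE.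
  have h1 : 1 <= eta * (p n)%:R.
    have := le_trans pb pmp.
    by rewrite (ler_pdivrMr _ _ eta0) [_ * eta]mulrC.
  by clear - h1 n_lo; lra.
- by rewrite ppE; clear - n_hi pR; lra.
set small := [set w | _] in msmall PE1.
have indB : indep_on (index_enum 'I_(p n)) beta.
  have inj : {in index_enum 'I_(p n) &, injective (fun j : 'I_(p n) =>
      inl (inr j) : (('I_n * 'I_(p n)) + ('I_n * 'I_(p n)) + 'I_(p n) + 'I_n)%type)}.
    by move=> i j _ _ [].
  exact: (indep_on_comp inj ind).
have mne : measurable [set x : R | x != 0].
  rewrite (_ : [set x | _] = ~` [set 0]); first by apply: measurableC; exact: measurable_set1.
  by apply/seteqP; split => x /=; [move/eqP|move=> h; apply/eqP].
pose D (x : R) := (x != 0) && (`|x| <= 3 * tt).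
have mD : measurable [set x | D x].
  rewrite (_ : [set x | D x] = [set x | x != 0] `&` [set x | `|x| <= 3 * tt]).
    by apply: measurableI => //; apply: measurable_set_le => //; exact: measurable_cst.
  by apply/seteqP; split => x /= => [/andP[]//|[h1 h2]]; apply/andP.
have lawS j : P (beta j @^-1` [set x | x != 0]) = eps%:E.
  by transitivity (distribution Q (Pi m) [set x | x != 0]); [exact: lB|case: hPi => h _; exact: h].
have lawW j : (P (beta j @^-1` [set x | D x]) <= (z * th)%:E)%E.
  have -> : P (beta j @^-1` [set x | D x]) = distribution Q (Pi m) [set x | D x] by exact: lB.
  have -> : z * th = eps * (z * th / eps) by field; rewrite gt_eqF.
  exact: weakQ.
have e01 : 0 <= eps <= 1 by rewrite !ltW.
pose S w := #|[set j | beta j w != 0]%SET|%:R : R.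
pose E2 := [set w | `|S w - eps * (p n)%:R| < gm * (p n)%:R].
have mS : measurable_fun setT S by exact: (measurable_count (D := fun x => x != 0) beta mne).
have mE2 : measurable E2.
  apply: measurable_set_lt; last exact: measurable_cst.
  by apply: measurableT_comp => //; exact: measurable_funB.
have PE2 : (P (~` E2) <= th%:E)%E.
  apply: le_trans (support_size p0 (D := fun x => x != 0) mne indB e01 gm0 lawS) _.
  rewrite lee_fin (ler_pdivrMr _ _ pR).
  have := le_trans pc pmp.
  have g20 : 0 < gm ^+ 2 by rewrite exprn_gt0.
  rewrite invfM => h; have := ler_wpM2l (ltW th0) h.
  by rewrite mulrCA divff ?mulr1// gt_eqF.
have E2b w : E2 w -> eps / 2 * (p n)%:R <= S w /\ S w <= rho * (p n + p n)%:R.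
  rewrite /E2 /= ltr_norml ppE => /andP[h1 h2].
  have h3 := ler_wpM2r (ltW pR) gm1; have h4 := ler_wpM2r (ltW pR) gm2.
  by clear - h1 h2 h3 h4; split; lra.
have Psmall : ((1 - th)%:E <= P small)%E.
  apply: prob_compl_le => //; apply: prob_sub_le PE2; [exact: measurableC|exact: measurableC|].
  by apply: subsetC => w /E2b[].
have PE1' : (P (~` E1) <= (2 * th)%:E)%E.
  apply: prob_compl_ge => //; apply: le_trans PE1.
  apply: (@le_trans _ _ ((1 - th)%:E * (1 - th)%:E)%E).
    by rewrite -EFinM lee_fin; clear -th; have := sqr_ge0 th; lra.
  by apply: lee_wpmul2l => //; rewrite lee_fin; clear - th1; lra.
pose E3 := [set w | (#|[set j | D (beta j w)]%SET|%:R <= z * (p n)%:R)%R].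
have mE3 : measurable E3.
  by apply: measurable_set_le; [exact: measurable_count|exact: measurable_cst].
have PE3 : (P (~` E3) <= th%:E)%E.
  apply: le_trans (count_markov p0 mD z0 lawW) _.
  by rewrite mulrAC divff ?mul1r// gt_eqF.
have C1p : 0 < C1 * (p n + p n)%:R by rewrite ppE !mulr_gt0.
have [mE4 PE4] := noise_markov hsigma C1p lxi.
set E4 := [set w | _] in mE4 PE4.
have PE4' : (P (~` E4) <= th%:E)%E.
  apply: le_trans PE4 _; rewrite lee_fin (ler_pdivrMr _ _ C1p) [leRHS]mulrA [th * C1]mulrC C1E ppE.
  have h1 := ler_wpM2r (sqr_ge0 sigma) n_hi.
  have h2 : 0 <= (delta + 1) * (p n)%:R by rewrite mulr_ge0// ltW.
  have h3 := mulr_ge0 h2 (sqr_ge0 sigma); clear - h1 h2 h3; lra.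
exists (E1 `&` E2 `&` E3 `&` E4).
have mE12 := measurableI _ _ mE1 mE2; have mE123 := measurableI _ _ mE12 mE3.
split; first exact: measurableI.
- move=> w [[[w1 w2] w3] w4]; have [S1 S2] := E2b w w2.
  rewrite /=; apply: (@lt_le_trans _ _ (1 - zz / 2)); first by clear - zznu nu0n nu00 zz0; lra.
  apply: lb_le_inf.
    exists (TPP (random_matrix X w) (random_matrix Xt w) (random_vector beta w)
      (random_vector xi w) q lambda1); exists lambda1 => //=.
    by rewrite in_itv/= lexx ltW.
  move=> _ [lambda lin <-]; rewrite /= in_itv /= in lin.
  have vE : (fun j => random_vector beta w j 0) = (fun j => beta j w).
    by apply/funext => j; rewrite mxE.
  have cS : #|[set j | random_vector beta w j 0 != 0]%SET|%:R = S w.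
    by rewrite /S; congr (_%:R); apply: eq_card => j; rewrite !inE mxE.
  have cW : #|[set j | (random_vector beta w j 0 != 0) && (`|random_vector beta w j 0| <= 3 * tt)]%SET|%:R
      <= z * (p n)%:R.
    apply: le_trans w3; rewrite ler_nat; apply: eq_leq; apply: eq_card => j.
    by rewrite !inE /D !mxE.
  have noise : \sum_i random_vector xi w i 0 ^+ 2 <= C1 * (p n + p n)%:R.
    by apply: le_trans w4; apply: ler_sum => i _; rewrite mxE.
  apply: (@TPP_uniform R n (p n) _ _ _ _ lambda1 lambda2 lambda kap c C1 q eps z zz tt) => //; rewrite -?C2E//.
  - exact: ltW.
  - have := le_trans pd pmp.
    by rewrite (ler_pdivrMr _ _ qe0) mulrC.
  - by rewrite vE; exact: coneE1.
  - by rewrite cS.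
apply: (@le_trans _ _ (1 - (2 * th + th + th + th))%:E).
  by rewrite lee_fin; clear - thE nu0n; lra.
apply: prob_compl_le; first exact: measurableI.
exact: prob_complI (prob_complI mE12 mE3 (prob_complI mE1 mE2 PE1' PE2) PE3) PE4'.
Qed.
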